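(* Let $f:M\to\mathbb{R}^3$ be a constant mean curvature surface with mean curvature $H=1$ (not a round sphere), Gauss map $N$ and dual surface $g=f+N$. Then any $\varrho$-Darboux transform $\hat f:\tilde M\to\mathbb{R}^4$ of $f$, $\varrho\in\mathbb{C}\setminus\{0,1\}$, is given by $$\hat f=f+(\alpha_++\alpha_-)(\beta_++\beta_-)^{-1}$$ where $d^N_{\mu_\pm}\alpha_\pm=0$, $\beta_\pm=\frac12(N\alpha_\pm(a-1)\pm\alpha_\pm b)$, $a=1-2\varrho$, $b=2\sqrt{\varrho(1-\varrho)}$ and $\mu_\pm=a\pm ib=1-2\varrho\pm2i\sqrt{\varrho(1-\varrho)}$. Moreover, the $\mu$-Darboux transforms of $f$, $\mu\in\mathbb{C}\setminus\{0,\pm1\}$, are exactly those $\varrho$-Darboux transforms of $f$, $\varrho\in\mathbb{C}\setminus\{0,1\}$, which have constant mean curvature in 3-space (possibly after translation).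
   Context: $\mathbb{H}=\mathrm{span}_{\mathbb{R}}\{1,i,j,k\}=\mathbb{R}^4$, $\mathbb{R}^3=\mathrm{Im}\,\mathbb{H}$, $S^2=\{n\in \mathrm{Im}\,\mathbb{H}: n^2=-1\}$, $\mathbb{C}=\mathrm{span}_{\mathbb{R}}\{1,i\}$ acting by right multiplication. $M$ is a Riemann surface with universal cover $\tilde M$; $*\omega(X)=\omega(JX)$. A conformal (branched) immersion into $\mathbb{R}^4$ has left and right normals $N,R$ with values in $S^2$ and $*df=N\,df=-df\,R$; for surfaces in $\mathbb{R}^3$, $N=R$ is the Gauss map. Throughout, constant mean curvature (CMC) means normalized $H=1$, i.e. $df=-\frac12(dN-N*dN)$ with $N$ the Gauss map; round spheres are excluded. ''In 3-space after translation'' means constant real part. $\varrho$-Darboux transform: $f+\alpha\beta^{-1}$ where $\alpha,\beta:\tilde M\to\mathbb{H}$ satisfy $d\alpha=-df\,\beta$, $d\beta=-dg\,\alpha\varrho$ and $\alpha\beta^{-1}:\tilde M\to\mathbb{H}\setminus\{0\}$. CMC family: $d^N_\lambda\alpha=d\alpha+\frac12 df\,(N\alpha(a_\lambda-1)+\alpha b_\lambda)$, $a_\lambda=\frac{\lambda+\lambda^{-1}}2$, $b_\lambda=i\frac{\lambda^{-1}-\lambda}2$, $\lambda\in\mathbb{C}\setminus\{0\}$. $\mu$-Darboux transform: $D^N_{\alpha,\mu}(f)=f+\alpha\beta^{-1}$ where $\alpha\neq0$ is $d^N_\mu$-parallel on $\tilde M$ and $\beta=\frac12(N\alpha(a_\mu-1)+\alpha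 b_\mu)$. *)

(* Defs.v *)
From HB Require Import structures.
From mathcomp Require Import all_boot all_order all_algebra.
From mathcomp Require Import ring.
From mathcomp Require Import complex.
From mathcomp Require Import all_classical all_reals all_analysis.

Set Implicit Arguments.
Unset Strict Implicit.
Unset Printing Implicit Defensive.

Import Order.TTheory GRing.Theory Num.Theory.
Import numFieldNormedType.Exports.
Local Open Scope classical_set_scope.
Local Open Scope ring_scope.

(* [(a, b, c, d)] stands for [a + b i + c j + d k].  The topology and the real
   vector space structure are those of R^4; the library norm is the sup norm,
   so the Euclidean length is expressed through [qnormsq]. *)
Definition quat (R : realType) : Type := (R * R * R * R)%type.

HB.instance Definition _ (R : realType) :=
  NormedModule.copy (quat R) (R * R * R * R)%type.

Definition qre (R : realType) (x : quat R) : R := x.1.1.1.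

Definition qnormsq (R : realType) (x : quat R) : R :=
  x.1.1.1 ^+ 2 + x.1.1.2 ^+ 2 + x.1.2 ^+ 2 + x.2 ^+ 2.

Definition qone (R : realType) : quat R := (1, 0, 0, 0).

Definition qmul (R : realType) (x y : quat R) : quat R :=
  let: (a, b, c, d) := x in
  let: (a', b', c', d') := y in
  (a * a' - b * b' - c * c' - d * d',
   a * b' + b * a' + c * d' - d * c',
   a * c' - b * d' + c * a' + d * b',
   a * d' + b * c' - c * b' + d * a').

Definition qinv (R : realType) (x : quat R) : quat R :=
  (qnormsq x)^-1 *: ((x.1.1.1, - x.1.1.2, - x.1.2, - x.2) : quat R).

Lemma qaddE (R : realType) (a b c d a' b' c' d' : R) :
  ((a, b, c, d) : quat R) + ((a', b', c', d') : quat R) =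
  ((a + a', b + b', c + c', d + d') : quat R).
Proof. by []. Qed.

Lemma qmulA (R : realType) : associative (@qmul R).
Proof.
by move=> [[[? ?] ?] ?] [[[? ?] ?] ?] [[[? ?] ?] ?] /=; congr (_, _, _, _); ring.
Qed.

Lemma qmul1 (R : realType) : left_id (qone R) (@qmul R).
Proof. by move=> [[[? ?] ?] ?] /=; congr (_, _, _, _); ring. Qed.

Lemma qmulr1 (R : realType) : right_id (qone R) (@qmul R).
Proof. by move=> [[[? ?] ?] ?] /=; congr (_, _, _, _); ring. Qed.

Lemma qmulDl (R : realType) : left_distributive (@qmul R) +%R.
Proof.
move=> [[[? ?] ?] ?] [[[? ?] ?] ?] [[[? ?] ?] ?].
by rewrite qaddE /qmul qaddE; congr (_, _, _, _); ring.
Qed.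

Lemma qmulDr (R : realType) : right_distributive (@qmul R) +%R.
Proof.
move=> [[[? ?] ?] ?] [[[? ?] ?] ?] [[[? ?] ?] ?].
by rewrite qaddE /qmul qaddE; congr (_, _, _, _); ring.
Qed.

Lemma qone_neq0 (R : realType) : qone R != 0.
Proof.
by apply/eqP => /(congr1 (@qre R)) /= /eqP; rewrite /qre /= oner_eq0.
Qed.

HB.instance Definition _ (R : realType) :=
  GRing.Zmodule_isNzRing.Build (quat R) (@qmulA R) (@qmul1 R) (@qmulr1 R)
    (@qmulDl R) (@qmulDr R) (@qone_neq0 R).

Lemma qnormsq_eq0 (R : realType) (x : quat R) : (qnormsq x == 0) = (x == 0).
Proof.
case: x => [[[a b] c] d]; apply/eqP/eqP => [h|[-> -> -> ->]]; last first.
  by rewrite /qnormsq /= expr0n /= !addr0.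
have := h; rewrite /qnormsq /= => /eqP.
rewrite !paddr_eq0 ?addr_ge0 ?sqr_ge0 // !sqrf_eq0.
by move=> /andP[/andP[/andP[/eqP -> /eqP ->] /eqP ->] /eqP ->].
Qed.

Lemma qmulVx (R : realType) :
  {in [pred x : quat R | x != 0], left_inverse 1 (@qinv R) *%R}.
Proof.
move=> x; rewrite inE -qnormsq_eq0; case: x => [[[a b] c] d].
rewrite /qinv /qnormsq /= => h.
by congr (_, _, _, _); rewrite /GRing.scale /=; field.
Qed.

Lemma qmulxV (R : realType) :
  {in [pred x : quat R | x != 0], right_inverse 1 (@qinv R) *%R}.
Proof.
move=> x; rewrite inE -qnormsq_eq0; case: x => [[[a b] c] d].
rewrite /qinv /qnormsq /= => h.
by congr (_, _, _, _); rewrite /GRing.scale /=; field.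
Qed.

Lemma qunitP (R : realType) (x y : quat R) :
  y * x = 1 /\ x * y = 1 -> [pred x : quat R | x != 0] x.
Proof.
move=> [h _] /=; apply/eqP => x0; move: h; rewrite x0 mulr0 => /eqP.
by rewrite eq_sym oner_eq0.
Qed.

Lemma qinv0 (R : realType) :
  {in [predC [pred x : quat R | x != 0]], @qinv R =1 id}.
Proof.
by move=> x; rewrite !inE negbK => /eqP ->; rewrite /qinv oppr0 scaler0.
Qed.

HB.instance Definition _ (R : realType) :=
  GRing.NzRing_hasMulInverse.Build (quat R) (@qmulVx R) (@qmulxV R)
    (@qunitP R) (@qinv0 R).

(* C = span{1, i} inside H. *)
Definition qC (R : realType) (z : R[i]) : quat R :=
  (complex.Re z, complex.Im z, 0, 0).

Notation "z %:H" := (qC z) (at level 1, format "z %:H").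

Definition S2 (R : realType) : set (quat R) :=
  [set n | qre n = 0 /\ n ^+ 2 = -1].

Fixpoint Ck (R : realType) (V W : normedModType R) (k : nat)
    (U : set V) (u : V -> W) : Prop :=
  if k is k'.+1 then
    (forall x, U x -> differentiable u x) /\
    (forall v, Ck k' U (fun x => 'd u x v))
  else forall x, U x -> {for x, continuous u}.

Definition smooth_on (R : realType) (V W : normedModType R)
    (U : set V) (u : V -> W) : Prop := forall k, Ck k U u.

(* Multiplication by i on the coordinate plane C = R^2. *)
Definition rotJ (R : realType) (v : R * R) : R * R := (- v.2, v.1).

(* For open [U] this is complex differentiability on [U], where smoothness is
   automatic. *)
Definition holomorphic_on (R : realType) (U : set (R * R))
    (h : R * R -> R * R) : Prop :=
  smooth_on U h /\
  forall x v, U x -> 'd h x (rotJ v) = rotJ ('d h x v).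

Record chart (R : realType) (T : topologicalType) := Chart {
  chart_dom : set T;
  chart_map :> T -> R * R;
  chart_inv : R * R -> T;
  chart_dom_open : open chart_dom;
  chart_img_open : open (chart_map @` chart_dom);
  chart_mapK : forall p, chart_dom p -> chart_inv (chart_map p) = p;
  chart_map_continuous : {within chart_dom, continuous chart_map};
  chart_inv_continuous :
    {within chart_map @` chart_dom, continuous chart_inv} }.

Record riemann_surface (R : realType) := RiemannSurface {
  rs_space :> topologicalType;
  rs_atlas : set (chart R rs_space);
  rs_nonempty : [set: rs_space] !=set0;
  rs_hausdorff : hausdorff_space rs_space;
  rs_connected : connected [set: rs_space];
  rs_atlas_cover : forall p : rs_space,
    exists2 phi, rs_atlas phi & chart_dom phi p;
  rs_atlas_holomorphic : forall phi psi, rs_atlas phi -> rs_atlas psi ->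
    holomorphic_on (phi @` (chart_dom phi `&` chart_dom psi))
      (psi \o chart_inv phi) }.

Definition holomorphic (R : realType) (S S' : riemann_surface R)
    (F : S -> S') : Prop :=
  continuous F /\
  forall (phi : chart R S) (psi : chart R S'), rs_atlas phi -> rs_atlas psi ->
    holomorphic_on (phi @` (chart_dom phi `&` F @^-1` chart_dom psi))
      (psi \o F \o chart_inv phi).

Definition simply_connected (R : realType) (T : topologicalType) : Prop :=
  (forall x y : T, exists gamma : R -> T,
     [/\ {within `[0, 1], continuous gamma}, gamma 0 = x & gamma 1 = y]) /\
  (forall gamma : R -> T,
     {within `[0, 1], continuous gamma} -> gamma 0 = gamma 1 ->
     exists G : R * R -> T,
       [/\ {within `[0, 1]%classic `*` `[0, 1]%classic, continuous G},
           forall t, `[0, 1]%classic t -> G (0, t) = gamma t,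
           forall t, `[0, 1]%classic t -> G (1, t) = gamma 0 &
           forall s, `[0, 1]%classic s -> G (s, 0) = gamma 0 /\ G (s, 1) = gamma 0]).

Definition homeo_onto (T T' : topologicalType) (F : T -> T')
    (V : set T) (U : set T') : Prop :=
  F @` V = U /\
  exists s : T' -> T,
    {within U, continuous s} /\ (forall x, V x -> s (F x) = x).

Definition covering_map (T T' : topologicalType) (F : T -> T') : Prop :=
  continuous F /\
  forall p : T', exists U : set T',
    [/\ open U, U p &
      exists sheets : set (set T),
        [/\ sheets !=set0,
            F @^-1` U = \bigcup_(V in sheets) V,
            trivIset sheets id &
            forall V, sheets V -> open V /\ homeo_onto F V U]].

Definition universal_cover (R : realType) (Mt M : riemann_surface R)
    (pr : Mt -> M) : Prop :=
  [/\ holomorphic pr, covering_map pr & simply_connected R Mt].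

(* A tangent vector is presented by its coordinates in a chart of the atlas;
   presentations in different charts are not identified, but the values of
   [D f] and [star] below do not depend on the chart, since the transition
   maps are holomorphic. *)
Record tangent (R : realType) (S : riemann_surface R) := Tangent {
  base : S;
  tchart : chart R S;
  tcoord : R * R;
  tchart_atlas : rs_atlas tchart;
  tchart_dom : chart_dom tchart base }.

Definition tangentJ (R : realType) (S : riemann_surface R) (X : tangent S)
  : tangent S := Tangent (rotJ (tcoord X)) (tchart_atlas X) (tchart_dom X).

Definition D (R : realType) (S : riemann_surface R) (f : S -> quat R)
    (X : tangent S) : quat R :=
  'd (f \o chart_inv (tchart X)) (tchart X (base X)) (tcoord X).

Definition star (R : realType) (S : riemann_surface R)
    (w : tangent S -> quat R) (X : tangent S) : quat R := w (tangentJ X).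

Definition smooth (R : realType) (S : riemann_surface R) (f : S -> quat R)
  : Prop :=
  forall phi, rs_atlas phi ->
    smooth_on (phi @` chart_dom phi) (f \o chart_inv phi).

(* The zeros of the differential (the branch points) are isolated, and the
   normals extend smoothly through them. *)
Definition conformal_branched_immersion (R : realType)
    (S : riemann_surface R) (f N Rn : S -> quat R) : Prop :=
  [/\ [/\ smooth f, smooth N & smooth Rn],
      (forall p, S2 (N p) /\ S2 (Rn p)),
      (forall X, star (D f) X = N (base X) * D f X),
      (forall X, star (D f) X = - (D f X * Rn (base X))) &
      (forall p : S, \forall q \near p^',
         exists2 X : tangent S, base X = q & D f X != 0)].

Definition round_sphere (R : realType) (S : riemann_surface R)
    (f : S -> quat R) : Prop :=
  exists (c : quat R) (r : R),
    [/\ qre c = 0, 0 < r & forall p, qnormsq (f p - c) = r ^+ 2].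

(* R^3 = Im H.  The third clause is the normalization H = 1, with [N] the Gauss
   map.  The last one also excludes open pieces of round spheres. *)
Definition cmc_surface (R : realType) (S : riemann_surface R)
    (f N : S -> quat R) : Prop :=
  [/\ forall p, qre (f p) = 0,
      conformal_branched_immersion f N N,
      (forall X, D f X = - (2^-1 *: (D N X - N (base X) * star (D N) X))) &
      ~ round_sphere f].

Definition cmc_in_3space_after_translation (R : realType)
    (S : riemann_surface R) (f : S -> quat R) : Prop :=
  exists (c : quat R) (N : S -> quat R), cmc_surface (fun p => f p + c) N.

Definition rho_darboux (R : realType) (S : riemann_surface R)
    (f g : S -> quat R) (rho : R[i]) (fhat : S -> quat R) : Prop :=
  exists alpha beta : S -> quat R,
    [/\ smooth alpha /\ smooth beta,
        (forall X, D alpha X = - (D f X * beta (base X))),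
        (forall X, D beta X = - (D g X * alpha (base X) * rho%:H)),
        (forall p, alpha p != 0 /\ beta p != 0) &
        (forall p, fhat p = f p + alpha p * (beta p)^-1)].

Definition coef_a (R : realType) (lambda : R[i]) : R[i] :=
  (lambda + lambda^-1) / 2.

Definition coef_b (R : realType) (lambda : R[i]) : R[i] :=
  'i%C * ((lambda^-1 - lambda) / 2).

Definition cmc_parallel (R : realType) (S : riemann_surface R)
    (f N : S -> quat R) (lambda : R[i]) (alpha : S -> quat R) : Prop :=
  smooth alpha /\
  forall X,
    D alpha X
    + 2^-1 *: (D f X *
        (N (base X) * alpha (base X) * (coef_a lambda - 1)%:H
         + alpha (base X) * (coef_b lambda)%:H)) = 0.

Definition darboux_beta (R : realType) (S : riemann_surface R)
    (N alpha : S -> quat R) (a b : R[i]) (p : S) : quat R :=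
  2^-1 *: (N p * alpha p * (a - 1)%:H + alpha p * b%:H).

(* [alpha] is a nontrivial parallel section.  It then has no zeros, and for
   [mu] different from 1 neither has the corresponding [beta]. *)
Definition mu_darboux (R : realType) (S : riemann_surface R)
    (f N : S -> quat R) (mu : R[i]) (fhat : S -> quat R) : Prop :=
  exists alpha : S -> quat R,
    [/\ cmc_parallel f N mu alpha,
        (exists p, alpha p != 0) &
        (forall p, fhat p =
           f p + alpha p * (darboux_beta N alpha (coef_a mu) (coef_b mu) p)^-1)].

(* Main.v *)
(* A Darboux transform of [f] is determined by [s = beta alpha^-1] and
   [P = alpha rho^-1 alpha^-1]; put [Y = s s P].  The surfaces [f + s^-1] and
   [g + s P] have the rotated differentials of a CMC surface and its dual, with
   normals [- s^-1 N s] and [s P N P^-1 s^-1]; so [f + s^-1] is CMC as soon as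
   their difference is the normal, that is, as soon as [s N + N s + Y = 1].

   Conversely, assume that [f + s^-1] is CMC.  Its left and right normals are
   then opposite, so [Y] commutes with [N]; differentiating this relation shows
   that [B = 1 - (s N + N s) - Y] is real.  The deviation [s^-1 B]
   from the dual satisfies a first order equation which at a point with [B <> 0]
   forces first [s N + N s = 0] and then [dg = 0].  Since the zeros of [df] and
   [dg] are isolated, [B = 0] everywhere.

   In terms of [sigma = alpha^-1 (2 beta - N alpha (a - 1))] the identity [B = 0]
   says exactly that [sigma] is constant; [sigma] commutes with [a - 1], because
   otherwise [alpha^-1 N alpha] would be constant, and squares to [1 - a^2].  So
   [sigma] is conjugate, by a quaternion commuting with [a - 1], to a complex
   number [b], and multiplying [alpha] by that quaternion makes it parallel for
   [d^N_mu].  Without [B = 0], adding and subtracting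
   [delta = (2 beta - N alpha (a - 1)) b^-1] splits [alpha] into its two parallel
   components.

   The zeros of [dg] are isolated because they are zeros of the holomorphic
   Hopf differential, which vanishes identically only if [dg = 0], that is, on
   round spheres. *)
Require Import Defs.
From HB Require Import structures.
From mathcomp Require Import all_boot all_order all_algebra.
From mathcomp Require Import complex ring lra.
From mathcomp Require Import all_classical all_reals all_analysis.
Import Order.TTheory GRing.Theory Num.Theory.
Import numFieldNormedType.Exports.
Local Open Scope classical_set_scope.
Local Open Scope ring_scope.

Set Implicit Arguments.
Unset Strict Implicit.
Unset Printing Implicit Defensive.

(* Keeps unification from unfolding the choice operator behind ['d]. *)
#[global] Opaque diff.

(** * Differential calculus of smooth maps *)

(** The recurring device is separation by rotation: [df] is rotated by [N] and [dg] by [- N], so a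
    relation [a dg + b df = 0] whose coefficients commute with [N], taken at [X] and at [J X],
    splits into its two parts. This needs tangent vectors on which both differentials are nonzero,
    so such identities are proved off isolated points and extended by continuity; hence the
    isolation of the zeros of [dg] is indispensable to the argument. The Hopf differential is only
    given as a smooth solution of the Cauchy-Riemann equations, so its zeros are studied without
    power series: at a zero of finite order a leading term is obtained by integration, and a zero of
    infinite order forces local vanishing by the maximum principle for |q / z^(n+1)|^2 plus a
    strictly subharmonic term. All transforms live on the universal cover, to which the CMC
    structure is pulled back beforehand; branch points stay isolated there because the covering is
    locally injective and its derivative is nonzero off isolated points. *)

Section CkCalculus.
Context {R : realType}.
Implicit Types V W : normedModType R.

(** Only the germ at [x] enters the little-o expansion, and [diff_unique] then identifies the
    differentials. *)
Lemma near_eq_differentiable V W (u u' : V -> W) (x : V) :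
  (\forall y \near x, u y = u' y) -> differentiable u x ->
  differentiable u' x /\ 'd u' x = 'd u x :> (V -> W).
Proof.
move=> e du.
have ex : u x = u' x by exact: nbhs_singleton e.
have H : u' \o shift x = cst (u' x) + 'd u x +o_ 0 id.
  have /diff_locallyP[_] := du; move=> /eqaddoP h; apply/eqaddoP => eps eps0.
  have := h eps eps0; rewrite !near_simpl.
  have : \forall y \near 0, u (y + x) = u' (y + x).
    have c : (y + x) @[y --> (0 : V)] --> 0 + x.
      by apply: cvgD; [exact: cvg_id|exact: cvg_cst].
    by rewrite add0r in c; exact: (c _ e).
  by apply: filterS2 => y /= E; rewrite !fctE /= ex E.
have dE := diff_unique (diff_continuous du) H.
split=> //; apply/diff_locallyP; rewrite dE; split=> //.
exact: diff_continuous.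
Qed.

Lemma eq_on_differentiable V W (U : set V) (u u' : V -> W) x : open U ->
  {in U, u =1 u'} -> U x -> differentiable u x ->
  differentiable u' x /\ 'd u' x = 'd u x :> (V -> W).
Proof.
move=> oU e Ux; apply: near_eq_differentiable.
by near=> y; apply: e; rewrite inE; near: y; exact: open_nbhs_nbhs.
Unshelve. all: by end_near. Qed.

Lemma Ck_ext V W k (U : set V) (u u' : V -> W) : open U ->
  {in U, u =1 u'} -> Ck k U u -> Ck k U u'.
Proof.
move=> oU; elim: k u u' => [|k IH] u u' e /=.
  move=> c x Ux; have cx := c x Ux.
  rewrite /prop_for /continuous_at -(e x) ?inE//.
  apply: cvg_trans cx; apply: near_eq_cvg.
  by near=> y; apply: e; rewrite inE; near: y; exact: open_nbhs_nbhs.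
move=> [du cu]; split=> [x Ux|v].
  by have [] := eq_on_differentiable oU e Ux (du x Ux).
apply: IH (cu v) => x; rewrite inE => Ux.
by case: (eq_on_differentiable oU e Ux (du x Ux)) => _ ->.
Unshelve. all: by end_near. Qed.

Lemma Ck_local V W k (U : set V) (u : V -> W) :
  (forall x, U x -> exists2 U', U' x & Ck k U' u) -> Ck k U u.
Proof.
elim: k u => [|k IH] u h /=; first by move=> x /h[U' U'x c]; exact: c.
split=> [x /h[U' U'x [d _]]|v]; first exact: d.
apply: IH => x /h[U' U'x [_ c]]; exists U' => //; exact: c.
Qed.

Lemma Ck_sub V W k (U U' : set V) (u : V -> W) : U' `<=` U -> Ck k U u -> Ck k U' u.
Proof. by move=> s c; apply: Ck_local => x /s Ux; exists U. Qed.

Lemma CkW V W k (U : set V) (u : V -> W) : Ck k.+1 U u -> Ck k U u.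
Proof.
elim: k u => [|k IH] u; first by move=> [d _] x /d/differentiable_continuous.
by move=> [d c]; split=> // v; apply: IH.
Qed.

Lemma Ck_cst V W k (U : set V) (c : W) : Ck k U (fun=> c).
Proof.
elim: k c => [|k IH] c /=; first by move=> x _; exact: cvg_cst.
split=> [x _|v]; first exact: differentiable_cst.
rewrite (_ : (fun x => _) = fun=> 0) //.
by apply/funext => x; rewrite (diff_cst c x).
Qed.

Lemma CkD V W k (U : set V) (u v : V -> W) : open U ->
  Ck k U u -> Ck k U v -> Ck k U (fun x => u x + v x).
Proof.
move=> oU; elim: k u v => [|k IH] u v /=.
  by move=> cu cv x Ux; apply: cvgD; [exact: cu|exact: cv].
move=> [du cu] [dv cv]; split=> [x Ux|w].
  by apply: differentiableD; [exact: du|exact: dv].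
apply: (Ck_ext _ _ (IH _ _ (cu w) (cv w))) => // x; rewrite inE => Ux.
exact: (esym (congr1 (@^~ w) (diffD (du x Ux) (dv x Ux)))).
Qed.

Lemma CkN V W k (U : set V) (u : V -> W) : open U ->
  Ck k U u -> Ck k U (fun x => - u x).
Proof.
move=> oU; elim: k u => [|k IH] u /=.
  by move=> cu x Ux; apply: cvgN; exact: cu.
move=> [du cu]; split=> [x Ux|w].
  by apply: differentiableN; exact: du.
apply: (Ck_ext _ _ (IH _ (cu w))) => // x; rewrite inE => Ux.
exact: (esym (congr1 (@^~ w) (diffN (du x Ux)))).
Qed.

Lemma Ck_lin V V' W k (U : set V) (u : V -> V') (L : {linear V' -> W}) : open U ->
  continuous L -> Ck k U u -> Ck k U (fun x => L (u x)).
Proof.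
move=> oU cL; elim: k u => [|k IH] u /=.
  by move=> cu x Ux; apply: continuous_comp; [exact: cu|exact: cL].
move=> [du cu]; split=> [x Ux|w].
  by apply: differentiable_comp; [exact: du|exact: linear_differentiable].
apply: (Ck_ext _ _ (IH _ (cu w))) => // x; rewrite inE => Ux.
have cL' := @linear_differentiable _ _ _ L (u x) cL.
rewrite (diff_comp (du x Ux) cL') /=.
by rewrite (diff_lin _ cL).
Qed.

(** The common source of the product rules for the quaternion product, real scaling and [qdot]. *)
Lemma diff_bilin_comp V V1 V2 W (B : {bilinear V1 -> V2 -> W}) (u : V -> V1)
    (v : V -> V2) x : continuous (fun p => B p.1 p.2) ->
  differentiable u x -> differentiable v x ->
  differentiable (fun y => B (u y) (v y)) x /\
  'd (fun y => B (u y) (v y)) x = (fun w => B (u x) ('d v x w) + B ('d u x w) (v x))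
    :> (V -> W).
Proof.
move=> cB du dv.
have dp := differentiable_pair du dv.
have dB := differentiable_bilin (u x, v x) cB.
split; first exact: (differentiable_comp dp dB).
have := diff_comp dp dB; rewrite /comp /= => ->.
by apply/funext => w; rewrite (diff_pair du dv) (diff_bilin _ cB).
Qed.

Lemma Ck_bilin V V1 V2 W (B : {bilinear V1 -> V2 -> W}) k (U : set V)
    (u : V -> V1) (v : V -> V2) : open U -> continuous (fun p => B p.1 p.2) ->
  Ck k U u -> Ck k U v -> Ck k U (fun x => B (u x) (v x)).
Proof.
move=> oU cB; elim: k u v => [|k IH] u v.
  move=> /= cu cv x Ux; apply: (@continuous_comp _ _ _ (fun y => (u y, v y)) (fun p => B p.1 p.2)); last exact: cB.
  by apply: cvg_pair; [exact: cu|exact: cv].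
move=> cu cv; have [du cu'] := cu; have [dv cv'] := cv; split=> [x Ux|w].
  by case: (diff_bilin_comp cB (du x Ux) (dv x Ux)).
(* In each term of the product rule one factor is still of class k+1 and is lowered to k before the
   induction hypothesis applies. *)
apply: (Ck_ext oU _ (CkD oU (IH _ _ (CkW cu) (cv' w)) (IH _ _ (cu' w) (CkW cv)))).
move=> x; rewrite inE => Ux.
by case: (diff_bilin_comp cB (du x Ux) (dv x Ux)) => _ ->.
Qed.

End CkCalculus.

(** * Quaternion algebra and the smoothness of its operations *)

Section QuatAlgebra.
Context {R : realType}.
Implicit Types x y z : quat R.

Lemma quatP x y : x.1.1.1 = y.1.1.1 -> x.1.1.2 = y.1.1.2 -> x.1.2 = y.1.2 ->
  x.2 = y.2 -> x = y.
Proof. by case: x y => [[[? ?] ?] ?] [[[? ?] ?] ?] /= -> -> -> ->. Qed.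

Lemma qaddE x y : x + y = (x.1.1.1 + y.1.1.1, x.1.1.2 + y.1.1.2, x.1.2 + y.1.2, x.2 + y.2).
Proof. by []. Qed.

Lemma qoppE x : - x = (- x.1.1.1, - x.1.1.2, - x.1.2, - x.2).
Proof. by []. Qed.

Lemma qscaleE (k : R) x : k *: x = (k * x.1.1.1, k * x.1.1.2, k * x.1.2, k * x.2).
Proof. by []. Qed.

Lemma qmulE x y : x * y =
  (x.1.1.1 * y.1.1.1 - x.1.1.2 * y.1.1.2 - x.1.2 * y.1.2 - x.2 * y.2,
   x.1.1.1 * y.1.1.2 + x.1.1.2 * y.1.1.1 + x.1.2 * y.2 - x.2 * y.1.2,
   x.1.1.1 * y.1.2 - x.1.1.2 * y.2 + x.1.2 * y.1.1.1 + x.2 * y.1.1.2,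
   x.1.1.1 * y.2 + x.1.1.2 * y.1.2 - x.1.2 * y.1.1.2 + x.2 * y.1.1.1).
Proof. by case: x y => [[[? ?] ?] ?] [[[? ?] ?] ?]. Qed.

Lemma qone1 : 1 = (1, 0, 0, 0) :> quat R. Proof. by []. Qed.
Lemma qzero0 : 0 = (0, 0, 0, 0) :> quat R. Proof. by []. Qed.

Definition qconj x : quat R := (x.1.1.1, - x.1.1.2, - x.1.2, - x.2).

Lemma qconjE x : qconj x = (x.1.1.1, - x.1.1.2, - x.1.2, - x.2).
Proof. by []. Qed.

Definition qE := (qaddE, qoppE, qscaleE, qmulE, qone1, qzero0, qconjE).

End QuatAlgebra.

(** Expands into four real coordinates, so it is kept for identities with few products; longer ones
    go to [qabel]. *)
Ltac qring := intros; rewrite /qre /qnormsq; apply: quatP; rewrite ?qE /=; ring.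

Section QuatAlgebra2.
Context {R : realType}.
Implicit Types x y z : quat R.

Lemma qscalerAl (k : R) x y : k *: (x * y) = ((k *: x : quat R) * y).
Proof. qring. Qed.
Lemma qscalerAr (k : R) x y : k *: (x * y) = x * (k *: y).
Proof. qring. Qed.

HB.instance Definition _ := GRing.LSemiModule_isLSemiAlgebra.Build R (quat R) qscalerAl.
HB.instance Definition _ := GRing.LSemiAlgebra_isSemiAlgebra.Build R (quat R) qscalerAr.
Lemma qmulM x y : qmul x y = x * y. Proof. by []. Qed.

Lemma qmul_is_bilinear : bilinear_for
    (GRing.Scale.Law.clone _ _ *:%R _) (GRing.Scale.Law.clone _ _ *:%R _)
    (@qmul R).
Proof.
split=> [z|z] a x y.
  by rewrite -[LHS]/((a *: x + y) * z) mulrDl -scalerAl.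
by rewrite -[LHS]/(z * (a *: x + y)) mulrDr -scalerAr.
Qed.
HB.instance Definition _ := bilinear_isBilinear.Build R (quat R) (quat R) (quat R)
  _ _ (@qmul R) qmul_is_bilinear.

(** Scaling as a function of both arguments, under a name that can carry a bilinear structure. *)
Definition rscale (W : normedModType R) (k : R) (w : W) : W := k *: w.

Lemma rscale_is_bilinear (W : normedModType R) : bilinear_for
    (GRing.Scale.Law.clone _ _ *:%R _) (GRing.Scale.Law.clone _ _ *:%R _)
    (@rscale W).
Proof.
split=> [z|z] a x y; rewrite /rscale /=; first by rewrite scalerDl scalerA.
by rewrite scalerDr !scalerA mulrC.
Qed.
HB.instance Definition _ (W : normedModType R) := bilinear_isBilinear.Build R R W W
  _ _ (@rscale W) (@rscale_is_bilinear W).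

Lemma rscale_continuous (W : normedModType R) :
  continuous (fun p : R * W => rscale p.1 p.2).
Proof. exact: scale_continuous. Qed.

Lemma quat_cvg (T : Type) (F : set_system T) {FF : Filter F} (u : T -> quat R) x :
  u @ F --> x <->
  [/\ (fun t => (u t).1.1.1) @ F --> x.1.1.1, (fun t => (u t).1.1.2) @ F --> x.1.1.2,
     (fun t => (u t).1.2) @ F --> x.1.2 & (fun t => (u t).2) @ F --> x.2].
Proof.
split=> [h|[h1 h2 h3 h4]]; last first.
  rewrite (_ : u = fun t => ((u t).1.1.1, (u t).1.1.2, (u t).1.2, (u t).2)).
    case: x h1 h2 h3 h4 => [[[a b] c] d] /= h1 h2 h3 h4.
    exact: (cvg_pair (cvg_pair (cvg_pair h1 h2) h3) h4).
  by apply/funext => t; case: (u t) => [[[? ?] ?] ?].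
have fc (A B : topologicalType) (p : A * B) : fst @ p --> p.1 by exact: cvg_fst.
have sc (A B : topologicalType) (p : A * B) : snd @ p --> p.2 by exact: cvg_snd.
have h1 : (fun t => (u t).1) @ F --> x.1.
  exact: (cvg_comp u fst h (fc (R * R * R)%type R x)).
have h2 : (fun t => (u t).1.1) @ F --> x.1.1.
  exact: (cvg_comp _ fst h1 (fc (R * R)%type R x.1)).
split.
- exact: (cvg_comp _ fst h2 (fc R R x.1.1)).
- exact: (cvg_comp _ snd h2 (sc R R x.1.1)).
- exact: (cvg_comp _ snd h1 (sc (R * R)%type R x.1)).
- exact: (cvg_comp _ snd h (sc (R * R * R)%type R x)).
Qed.

Lemma qmul_cvg (T : Type) (F : set_system T) {FF : Filter F} (u v : T -> quat R) x y :
  u @ F --> x -> v @ F --> y -> (fun t => qmul (u t) (v t)) @ F --> x * y.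
Proof.
move=> /quat_cvg[u1 u2 u3 u4] /quat_cvg[v1 v2 v3 v4]; apply/quat_cvg.
split; under eq_fun do rewrite qmulM qmulE /=; rewrite qmulE /=.
- by apply: cvgB; [apply: cvgB; [apply: cvgB|]|]; exact: cvgM.
- by apply: cvgB; [apply: cvgD; [apply: cvgD|]|]; exact: cvgM.
- by apply: cvgD; [apply: cvgD; [apply: cvgB|]|]; exact: cvgM.
- by apply: cvgD; [apply: cvgB; [apply: cvgD|]|]; exact: cvgM.
Qed.

Lemma qmul_continuous : continuous (fun p : quat R * quat R => qmul p.1 p.2).
Proof. by move=> p; apply: qmul_cvg; [exact: cvg_fst|exact: cvg_snd]. Qed.

Lemma qconj_is_linear : linear (@qconj R).
Proof. by move=> k x y; qring. Qed.
HB.instance Definition _ := GRing.isLinear.Build R (quat R) (quat R) _ (@qconj R)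
  qconj_is_linear.

Lemma qre_is_linear : linear (@qre R : quat R -> R^o).
Proof. by move=> k x y; rewrite /qre. Qed.
HB.instance Definition _ := GRing.isLinear.Build R (quat R) R^o _ (@qre R)
  qre_is_linear.

Lemma qconj_continuous : continuous (@qconj R).
Proof.
move=> x; have /quat_cvg[h1 h2 h3 h4] : (id : quat R -> quat R) @ x --> x by exact: cvg_id.
by apply/quat_cvg; split=> //=; exact: cvgN.
Qed.

Lemma qre_continuous : continuous (@qre R).
Proof.
by move=> x; have /quat_cvg[h1 h2 h3 h4] : (id : quat R -> quat R) @ x --> x by exact: cvg_id.
Qed.

End QuatAlgebra2.

Section QuatCalculus.
Context {R : realType}.
Implicit Types V : normedModType R.

Lemma diff_qmul V (u v : V -> quat R) x :
  differentiable u x -> differentiable v x ->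
  differentiable (fun y => u y * v y) x /\
  'd (fun y => u y * v y) x = (fun w => u x * 'd v x w + 'd u x w * v x) :> (V -> quat R).
Proof. exact: (diff_bilin_comp qmul_continuous). Qed.

Lemma Ck_qmul V k (U : set V) (u v : V -> quat R) : open U ->
  Ck k U u -> Ck k U v -> Ck k U (fun x => u x * v x).
Proof. by move=> oU; apply: (Ck_bilin oU qmul_continuous). Qed.

Lemma diff_rscale V (W : normedModType R) (u : V -> R) (v : V -> W) x :
  differentiable u x -> differentiable v x ->
  differentiable (fun y => u y *: v y) x /\
  'd (fun y => u y *: v y) x = (fun w => u x *: 'd v x w + 'd u x w *: v x) :> (V -> W).
Proof. exact: (diff_bilin_comp (@rscale_continuous _ W)). Qed.

Lemma Ck_rscale V (W : normedModType R) k (U : set V) (u : V -> R) (v : V -> W) : open U ->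
  Ck k U u -> Ck k U v -> Ck k U (fun x => u x *: v x).
Proof. by move=> oU; apply: (Ck_bilin oU (@rscale_continuous _ W)). Qed.

Lemma Ck_qconj V k (U : set V) (u : V -> quat R) : open U ->
  Ck k U u -> Ck k U (fun x => qconj (u x)).
Proof. by move=> oU; apply: (Ck_lin oU qconj_continuous). Qed.

Lemma diff_linc V (V' W : normedModType R) (u : V -> V') (L : {linear V' -> W}) x :
  continuous L -> differentiable u x ->
  differentiable (fun y => L (u y)) x /\
  'd (fun y => L (u y)) x = (fun w => L ('d u x w)) :> (V -> W).
Proof.
move=> cL du; have dL := @linear_differentiable _ _ _ L (u x) cL.
split; first exact: differentiable_comp.
by rewrite (diff_comp du dL) (diff_lin _ cL).
Qed.

Lemma qnormsqE (x : quat R) : qnormsq x = qre (qconj x * x).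
Proof. by rewrite /qnormsq /qre qmulE qconjE /=; ring. Qed.

Lemma differentiable_qinv V (u : V -> quat R) x :
  differentiable u x -> u x != 0 -> differentiable (fun y => (u y)^-1) x.
Proof.
move=> du u0.
have [dc _] := diff_linc qconj_continuous du.
have [dn _] := diff_qmul dc du.
have [dr _] := @diff_linc _ _ _ _ (@qre R : {linear quat R -> R^o}) _ qre_continuous dn.
have eqn : (fun y => qnormsq (u y)) = (fun y => qre (qconj (u y) * u y)).
  by apply/funext => y; rewrite qnormsqE.
have dv : differentiable (fun y => (qnormsq (u y))^-1) x.
  by apply: differentiableV; [rewrite eqn; exact: dr|rewrite qnormsq_eq0].
by have [] := diff_rscale dv dc.
Qed.

Lemma near_cvg_neq (T : Type) (F : set_system T) {FF : Filter F} (W : normedModType R)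
    (u : T -> W) (a b : W) : u @ F --> a -> a != b -> \forall t \near F, u t != b.
Proof.
move=> cu ab; have oB : open (~` [set b]).
  apply: closed_openC; apply: accessible_closed_set1; apply: hausdorff_accessible.
  exact: norm_hausdorff.
have h : F (u @^-1` (~` [set b])).
  by apply: cu; apply: open_nbhs_nbhs; split=> //; exact/eqP.
by apply: filterS h => t /= /eqP.
Qed.

(** Differentiate [u y * (u y)^-1 = 1], which holds near [x] because [u] stays nonzero there. *)
Lemma diff_qinv V (u : V -> quat R) x :
  differentiable u x -> u x != 0 ->
  'd (fun y => (u y)^-1) x = (fun w => - ((u x)^-1 * 'd u x w * (u x)^-1)) :> (V -> quat R).
Proof.
move=> du u0; have di := differentiable_qinv du u0.
have [_ E] := diff_qmul du di.
have : 'd (fun y => u y * (u y)^-1) x = (fun=> 0) :> (V -> quat R).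
  have [|_ ->] := @near_eq_differentiable _ _ _ (fun=> (1 : quat R)) (fun y => u y * (u y)^-1) x _ (differentiable_cst _ _).
    have h : \forall y \near x, u y != 0.
      by apply: near_cvg_neq u0; exact: differentiable_continuous.
    by apply: filterS h => y y0; rewrite mulrV.
  by apply/funext => w; rewrite (diff_cst (1 : quat R) x).
move=> d0; apply/funext => w.
have e : u x * 'd (fun y => (u y)^-1) x w = - ('d u x w * (u x)^-1).
  by apply/eqP; rewrite -addr_eq0; apply/eqP; exact: (congr1 (fun f => f w) (etrans (esym E) d0)).
have uu : u x \is a GRing.unit by [].
by apply: (mulrI uu); rewrite e mulrN !mulrA mulrV // mul1r.
Qed.

Lemma Ck_qinv V k (U : set V) (u : V -> quat R) : open U ->
  (forall x, U x -> u x != 0) -> Ck k U u -> Ck k U (fun x => (u x)^-1).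
Proof.
move=> oU u0; elim: k => [|k IH].
  move=> cu x Ux; have /quat_cvg[u1 u2 u3 u4] := cu x Ux.
  have cc : qconj (u y) @[y --> x] --> qconj (u x).
    exact: (cvg_comp u (@qconj R) (cu x Ux) (@qconj_continuous R (u x))).
  have cn : (qconj (u y) * u y) @[y --> x] --> qconj (u x) * u x.
    exact: (qmul_cvg cc (cu x Ux)).
  have cr : qre (qconj (u y) * u y) @[y --> x] --> qre (qconj (u x) * u x).
    exact: (cvg_comp _ (@qre R) cn (@qre_continuous R _)).
  apply: cvgZ; last exact: cc.
  apply: cvgV; first by rewrite qnormsq_eq0 u0.
  by rewrite qnormsqE; under eq_fun do rewrite qnormsqE; exact: cr.
move=> cu; have [du cu'] := cu; have ci := IH (CkW cu).
split=> [x Ux|w]; first exact: (differentiable_qinv (du x Ux) (u0 x Ux)).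
have c := Ck_qmul oU (Ck_qmul oU ci (cu' w)) ci.
apply: (Ck_ext oU _ (CkN oU c)) => x; rewrite inE => Ux.
exact: (esym (congr1 (@^~ w) (diff_qinv (du x Ux) (u0 x Ux)))).
Qed.

End QuatCalculus.

(** * Mean value theorems and symmetry of second derivatives *)

Section MeanValue.
Context {R : realType}.
Implicit Types V : normedModType R.

Lemma diff_shift V (W : normedModType R) (u : V -> W) a x :
  differentiable u (x + a) ->
  differentiable (fun y => u (y + a)) x /\
  'd (fun y => u (y + a)) x = 'd u (x + a) :> (V -> W).
Proof.
move=> du; have ds : is_diff x (fun y : V => y + a) (id + 0).
  exact: (is_diffD (is_diff_id x) (is_diff_cst a x)).
have exd : differentiable (fun y : V => y + a) x by exact: ex_diff.
split; first exact: (@differentiable_comp _ _ _ _ (fun y => y + a) u x exd du).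
rewrite (@diff_comp _ _ _ _ (fun y => y + a) u x exd du) diff_val.
by apply/funext => w /=; rewrite !fctE addr0.
Qed.

Lemma is_derive_line V (u : V -> R) x v (t : R) :
  differentiable u (x + t *: v) ->
  is_derive t 1 (fun s => u (x + s *: v)) ('d u (x + t *: v) v).
Proof.
move=> du; have ds : is_diff t (fun s : R => x + s *: v) (0 + ( *:%R ^~ v)).
  exact: (is_diffD (is_diff_cst x t) (is_diff_scalel t v)).
have exd : differentiable (fun s : R => x + s *: v) t by exact: ex_diff.
have dc : differentiable (fun s : R => u (x + s *: v)) t.
  exact: (@differentiable_comp R R V R (fun s : R => x + s *: v) u t exd du).
apply: DeriveDef; first exact: diff_derivable.
rewrite (deriveE _ dc) (@diff_comp R R V R (fun s : R => x + s *: v) u t exd du) diff_val /=.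
by rewrite fctE /= add0r scale1r.
Qed.

Lemma mvt_line V (u : V -> R) x v :
  (forall t, 0 <= t <= 1 -> differentiable u (x + t *: v)) ->
  exists2 t, 0 < t < 1 & u (x + v) - u x = 'd u (x + t *: v) v.
Proof.
move=> du; pose phi s := u (x + s *: v).
have [||c c01 E] := @MVT R phi (fun t => 'd u (x + t *: v) v) 0 1 ltr01.
- by move=> t; rewrite in_itv /= => /andP[t0 t1]; apply: is_derive_line; apply: du; rewrite !ltW.
- apply: derivable_within_continuous => t; rewrite in_itv /= => t01.
  by have [] := is_derive_line (du t t01).
exists c; first by move: c01; rewrite in_itv.
by move: E; rewrite /phi scale1r scale0r addr0 subr0 mulr1.
Qed.

(** The second difference of [u] over the parallelogram with sides [t v] and [t w] is t^2 times a
    mixed derivative at some nearby point, for either order of differentiation. Continuity of both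
    mixed derivatives then bounds their difference at [x] by less than itself. *)
Lemma clairaut_real V (U : set V) (u : V -> R) x v w : open U -> Ck 2 U u -> U x ->
  'd (fun y => 'd u y v) x w = 'd (fun y => 'd u y w) x v.
Proof.
move=> oU cu Ux; apply: contrapT => /eqP ne.
pose A v w y := 'd (fun y => 'd u y v) y w.
have cA v' w' : {for x, continuous (A v' w')}.
  by case: cu => _ /(_ v')[_ /(_ w')]; apply.
set e := `|A v w x - A w v x| / 2.
have e0 : 0 < e by rewrite divr_gt0 // normr_gt0 subr_eq0.
have /nbhs_ballP[r /= r0 hr] : \forall y \near x, [/\ U y, `|A v w x - A v w y| < e & `|A w v x - A w v y| < e].
  near=> y; split; near: y; first exact: open_nbhs_nbhs.
  - exact: (@cvgr_dist_lt _ _ _ _ _ _ _ (cA v w)).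
  - exact: (@cvgr_dist_lt _ _ _ _ _ _ _ (cA w v)).
have [t t0 tr] : exists2 t : R, 0 < t & t * (`|v| + `|w|) < r.
  have s0 : 0 < `|v| + `|w| + 1 by rewrite ltr_wpDl // addr_ge0.
  exists (r / (`|v| + `|w| + 1)); first by rewrite divr_gt0.
  by rewrite mulrAC ltr_pdivrMr // ltr_pM2l // ltrDl.
have inb a b : 0 <= a <= 1 -> 0 <= b <= 1 -> forall v' w', (v' = v /\ w' = w) \/ (v' = w /\ w' = v) ->
    ball x r (x + a *: (t *: v') + b *: (t *: w')).
  move=> /andP[a0 a1] /andP[b0 b1] v' w' h.
  rewrite -ball_normE /= -addrA opprD addNKr normrN.
  have le : `|a *: (t *: v') + b *: (t *: w')| <= t * (`|v| + `|w|).
    rewrite (le_trans (ler_normD _ _)) // !normrZ (ger0_norm a0) (ger0_norm b0) (gtr0_norm t0).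
    have tn (z : V) c : 0 <= c <= 1 -> c * (t * `|z|) <= t * `|z|.
      by move=> /andP[c0 c1]; rewrite ler_piMl // mulr_ge0 // ltW.
    have := lerD (tn v' a _) (tn w' b _); rewrite a0 a1 b0 b1 => /(_ isT isT) /le_trans; apply.
    by rewrite mulrDr; case: h => -[-> ->] //; rewrite addrC.
  exact: le_lt_trans le tr.
have lZ (L : {linear V -> R}) z : L (t *: z) = t * L z by rewrite linearZ.
have key v' w' : (v' = v /\ w' = w) \/ (v' = w /\ w' = v) ->
    exists2 y, ball x r y & u (x + t *: v' + t *: w') - u (x + t *: v') - (u (x + t *: w') - u x) = t * t * A v' w' y.
  move=> vw.
  have inU a b : 0 <= a <= 1 -> 0 <= b <= 1 -> U (x + a *: (t *: v') + b *: (t *: w')).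
    by move=> a1 b1; have [] := hr _ (inb a b a1 b1 v' w' vw).
  have [du du2] := cu.
  have one01 : 0 <= (1 : R) <= 1 by rewrite ler01 lexx.
  have zero01 : 0 <= (0 : R) <= 1 by rewrite ler01 lexx.
  have d1 a : 0 <= a <= 1 -> differentiable u (x + a *: (t *: v')).
    by move=> a01; apply: du; have := inU a 0 a01 zero01; rewrite scale0r addr0.
  have d2 a : 0 <= a <= 1 -> differentiable u (x + a *: (t *: v') + t *: w').
    by move=> a01; apply: du; have := inU a 1 a01 one01; rewrite scale1r.
  (* The second difference is the increment of [psi] along [t v']: one mean value point for [psi],
     then another for ['d u _ v'] along [t w']. *)
  pose psi y := u (y + t *: w') - u y.
  have dpsi a : 0 <= a <= 1 -> differentiable psi (x + a *: (t *: v')) /\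
     'd psi (x + a *: (t *: v')) = (fun z => 'd u (x + a *: (t *: v') + t *: w') z - 'd u (x + a *: (t *: v')) z) :> (V -> R).
    move=> a01; have [ds Es] := diff_shift (d2 a a01).
    have dd := differentiableB ds (d1 a a01); split; first exact: dd.
    apply/funext => z; apply: etrans (congr1 (@^~ z) (diffB ds (d1 a a01))) _.
    exact: (congr1 (fun f => f z - 'd u (x + a *: (t *: v')) z) Es).
  have [a a01 Ea] := @mvt_line V psi x (t *: v') (fun a h => (dpsi a h).1).
  have a01' : 0 <= a <= 1 by case/andP: a01 => *; rewrite !ltW.
  have [b b01 Eb] := @mvt_line V (fun y => 'd u y v') (x + a *: (t *: v')) (t *: w')
     (fun b h => (du2 v').1 _ (inU a b a01' h)).
  have b01' : 0 <= b <= 1 by case/andP: b01 => *; rewrite !ltW.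
  exists (x + a *: (t *: v') + b *: (t *: w')); first exact: (inb a b a01' b01' v' w' vw).
  rewrite -[LHS]/(psi (x + t *: v') - psi x) Ea (dpsi a a01').2 !lZ -mulrBr.
  by rewrite Eb lZ /A -mulrA.
have [y yb Ey] := key v w (or_introl (conj erefl erefl)).
have [z zb Ez] := key w v (or_intror (conj erefl erefl)).
have yz : A v w y = A w v z.
  have tt0 : t * t != 0 by rewrite mulf_neq0 // gt_eqF.
  apply: (mulfI tt0); rewrite -Ey -Ez addrAC [x + t *: w + _]addrAC; ring.
have [_ h1 _] := hr _ yb; have [_ _ h2] := hr _ zb.
have : `|A v w x - A w v x| < e + e.
  have -> : A v w x - A w v x = (A v w x - A v w y) - (A w v x - A w v z) by rewrite yz; ring.
  by apply: le_lt_trans (ler_normB _ _) _; apply: ltrD.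
by rewrite /e -splitr ltxx.
Unshelve. all: by end_near. Qed.

End MeanValue.

Section QuatMeanValue.
Context {R : realType}.
Implicit Types V : normedModType R.

Definition qi : quat R := (0, 1, 0, 0).
Definition qj : quat R := (0, 0, 1, 0).
Definition qk : quat R := (0, 0, 0, 1).

(** For [e] among 1, i, j, k these are the coordinates up to sign; they carry results on real
    functions over to quaternion-valued ones. *)
Definition qform (e x : quat R) : R^o := qre (e * x).

Lemma qform_is_linear e : linear (qform e).
Proof. by move=> k x y; rewrite /qform mulrDr -scalerAr linearP. Qed.
HB.instance Definition _ e := GRing.isLinear.Build R (quat R) R^o _ (qform e)
  (qform_is_linear e).

Lemma qform_continuous e : continuous (qform e).
Proof.
move=> x; apply: (cvg_comp _ (@qre R) _ (@qre_continuous R _)).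
by apply: qmul_cvg; [exact: cvg_cst|exact: cvg_id].
Qed.

Lemma qformE (x : quat R) : (qform 1 x, - qform qi x, - qform qj x, - qform qk x) = x.
Proof. by rewrite /qform /qre !qmulE qone1 /=; apply: quatP => /=; ring. Qed.

Lemma qnorm_le (x : quat R) (M : R) : `|x| <= M <->
  [/\ `|x.1.1.1| <= M, `|x.1.1.2| <= M, `|x.1.2| <= M & `|x.2| <= M].
Proof.
rewrite -[`|x|]/(Num.max (Num.max (Num.max `|x.1.1.1| `|x.1.1.2|) `|x.1.2|) `|x.2|).
rewrite !ge_max /=; split=> [/andP[/andP[/andP[]]]|[-> -> ->]] //.
Qed.

Lemma qcoordE (x : quat R) : [/\ x.1.1.1 = qform 1 x, x.1.1.2 = - qform qi x,
  x.1.2 = - qform qj x & x.2 = - qform qk x].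
Proof. by split; rewrite -[in LHS](qformE x). Qed.

Lemma qform_le (x : quat R) (M : R) :
  (forall e, e \in [:: 1; qi; qj; qk] -> `|qform e x| <= M) -> `|x| <= M.
Proof.
move=> h; apply/qnorm_le; have [-> -> -> ->] := qcoordE x; rewrite !normrN.
by split; apply: h; rewrite !inE eqxx ?orbT.
Qed.

Lemma normr_qform (x : quat R) e : e \in [:: 1; qi; qj; qk] -> `|qform e x| <= `|x|.
Proof.
have /qnorm_le := lexx `|x|; have [-> -> -> ->] := qcoordE x.
by rewrite !normrN !inE => -[h1 h2 h3 h4] /or4P[] /eqP ->.
Qed.

Lemma qnormM_qi (x : quat R) : `|qi * x| = `|x|.
Proof.
have le (y : quat R) : `|qi * y| <= `|y|.
  have /qnorm_le[h1 h2 h3 h4] := lexx `|y|.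
  apply/qnorm_le; rewrite qmulE /=.
  by split; rewrite !(mul0r, mul1r, add0r, addr0, subr0, sub0r) ?normrN.
apply/eqP; rewrite eq_le le /= -[X in `| X | <= _]opprK normrN.
suff -> : - x = qi * (qi * x) by exact: le.
by rewrite !qmulE /=; apply: quatP; rewrite ?qE /=; ring.
Qed.

(** The norm is the sup norm, so the real mean value theorem applies to each coordinate with the
    same bound, although the intermediate point depends on the coordinate. *)
Lemma mvt_norm V (u : V -> quat R) x v (M : R) :
  (forall t, 0 <= t <= 1 -> differentiable u (x + t *: v)) ->
  (forall t, 0 <= t <= 1 -> `|'d u (x + t *: v) v| <= M) ->
  `|u (x + v) - u x| <= M.
Proof.
move=> du le; apply: qform_le => e eB.
have dl y := @diff_linc R V (quat R) R^o u (qform e) y (@qform_continuous e).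
have [t t01 E] := @mvt_line R V (fun y => qform e (u y)) x v (fun t h => (dl _ (du t h)).1).
have t01' : 0 <= t <= 1 by case/andP: t01 => *; rewrite !ltW.
rewrite linearB /= E (congr1 (@^~ v) (dl _ (du t t01')).2) /=.
exact: le_trans (normr_qform _ eB) (le t t01').
Qed.

Lemma clairaut V (U : set V) (u : V -> quat R) x v w : open U -> Ck 2 U u -> U x ->
  'd (fun y => 'd u y v) x w = 'd (fun y => 'd u y w) x v.
Proof.
move=> oU cu Ux; rewrite -[LHS]qformE -[RHS]qformE.
have E e : qform e ('d (fun y => 'd u y v) x w) = qform e ('d (fun y => 'd u y w) x v).
  have dl f y := @diff_linc R V (quat R) R^o f (qform e) y (@qform_continuous e).
  have [du cu1] := cu.
  have S a b : 'd (fun y => 'd (fun z => qform e (u z)) y a) x b = qform e ('d (fun y => 'd u y a) x b).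
    have [d1 _] := cu1 a.
    have [_ E1] := dl _ _ (d1 x Ux).
    apply: etrans (congr1 (@^~ b) E1).
    have [|_ E2] := @eq_on_differentiable _ _ _ U (fun y => qform e ('d u y a))
      (fun y => 'd (fun z => qform e (u z)) y a) x oU _ Ux (dl _ _ (d1 x Ux)).1.
      by move=> y; rewrite inE => Uy; exact: (esym (congr1 (@^~ a) (dl _ _ (du y Uy)).2)).
    exact: (congr1 (@^~ b) E2).
  rewrite -!S; apply: (clairaut_real _ _ oU _ Ux).
  exact: (@Ck_lin R V (quat R) R^o 2 U u (qform e) oU (@qform_continuous e) cu).
by rewrite !E.
Qed.

(* The bound [|u| <= 2^-n] near [x] improves itself from [n] to [n + 1]. *)
Lemma linear_ode_zero V (U : set V) (u : V -> quat R) x (C : R) : open U -> U x ->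
  (forall y, U y -> differentiable u y) ->
  (forall y v, U y -> `|'d u y v| <= C * `|v| * `|u y|) ->
  u x = 0 -> \forall y \near x, u y = 0.
Proof.
move=> oU Ux du le ux0.
have [C0|C0] := ltP C 0; last first.
  have cux := differentiable_continuous (du x Ux).
  have /nbhs_ballP[r0 /= r00 hr] : \forall y \near x, U y /\ `|u y| <= 1.
    near=> y; split; near: y; first exact: open_nbhs_nbhs.
    have : \forall y \near x, `|u x - u y| < 1 by exact: (@cvgr_dist_lt _ _ _ _ _ _ _ cux).
    by apply: filterS => y; rewrite ux0 sub0r normrN => /ltW.
  (* Makes [C * r <= 1/2], so that each use of the mean value inequality halves the bound; [C + 1]
     keeps the denominator positive when [C = 0]. *)
  pose r := Num.min r0 (1 / (2 * (C + 1))).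
  have C1 : 0 < C + 1 by rewrite ltr_wpDl.
  have r1 : 0 < r by rewrite lt_min r00 divr_gt0 // mulr_gt0.
  have Cr : C * r <= 2^-1.
    apply: (@le_trans _ _ ((C + 1) * (1 / (2 * (C + 1))))).
      apply: ler_pM; rewrite ?lerDl //; first exact: ltW.
      by rewrite ge_min lexx orbT.
    by rewrite mul1r invfM mulrCA mulfV ?gt_eqF // mulr1.
  have key n v : `|v| < r -> `|u (x + v)| <= 2^-1 ^+ n.
    elim: n v => [|n IH] v vr.
      rewrite expr0; apply: (hr _ _).2; rewrite -ball_normE /= opprD addNKr normrN.
      by apply: lt_le_trans vr _; rewrite ge_min lexx.
    rewrite -[u (x + v)]subr0 -ux0; 
    have tv t : 0 <= t <= 1 -> `|t *: v| < r.
      move=> /andP[t0 t1]; rewrite normrZ (ger0_norm t0); apply: le_lt_trans vr.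
      by rewrite ler_piMl.
    have Ut t : 0 <= t <= 1 -> U (x + t *: v).
      move=> t01; apply: (hr _ _).1; rewrite -ball_normE /= opprD addNKr normrN.
      by apply: lt_le_trans (tv t t01) _; rewrite ge_min lexx.
    apply: mvt_norm => t t01; first by apply: du; exact: Ut.
    apply: le_trans (le _ _ (Ut t t01)) _; rewrite exprS.
    apply: ler_pM => //; first by rewrite mulr_ge0.
      by apply: le_trans Cr; rewrite ler_wpM2l // ltW.
    by apply: IH; exact: tv.
  apply/nbhs_ballP; exists r => //= y; rewrite -ball_normE /= distrC => yr.
  have hk n := key n (y - x) yr.
  apply/eqP; rewrite -normr_le0 leNgt; apply/negP => p.
  have cg : (fun n => 2^-1 ^+ n : R) @ \oo --> 0.
    by apply: cvg_expr; rewrite ger0_norm ?invr_ge0 // invf_lt1 // ltr1n.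
  have [n _ /(_ n (leqnn n)) /=] := @cvgr_dist_lt _ _ _ _ _ _ _ cg _ p.
  rewrite sub0r normrN ger0_norm ?exprn_ge0 ?invr_ge0 // => h.
  by have := hk n; rewrite addrC subrK leNgt h.
(* For [C < 0] the inequality in the direction [y - x] bounds a norm by a negative multiple of
   [|u y|]. *)
near=> y; have Uy : U y by near: y; exact: open_nbhs_nbhs.
apply/eqP; rewrite -normr_le0.
have [n|n] := pselect (y = x); first by rewrite n ux0 normr0.
have yx : 0 < `|y - x| by rewrite normr_gt0 subr_eq0; apply/eqP.
have := le_trans (normr_ge0 _) (le y (y - x) Uy).
by rewrite nmulr_rge0 // nmulr_rlt0.
Unshelve. all: by end_near. Qed.

(** Replacing [v] by [- v] makes the first derivative at [x] nonnegative and keeps the second. If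
    the second were positive, it would be so near [x], and two uses of the mean value theorem would
    make [phi] larger at a point [x + t v]. *)
Lemma second_derivative_at_max V (U : set V) (phi : V -> R) x v : open U -> U x ->
  Ck 2 U phi -> (forall y, U y -> phi y <= phi x) ->
  'd (fun y => 'd phi y v) x v <= 0.
Proof.
move=> oU Ux c mx; rewrite leNgt; apply/negP => p.
wlog d0 : v p / 0 <= 'd phi x v.
  move=> h; have [|n] := leP 0 ('d phi x v); first exact: h.
  apply: (h (- v)); last by rewrite linearN oppr_ge0 ltW.
  have E : 'd (fun y => 'd phi y (- v)) x (- v) = 'd (fun y => 'd phi y v) x v.
    have e : (fun y => 'd phi y (- v)) = - (fun y => 'd phi y v).
      by apply/funext => y; rewrite linearN.
    have [d1 _] := c.2 v.
    rewrite e; apply: etrans (congr1 (@^~ (- v)) (diffN (d1 x Ux))) _.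
    by rewrite -[LHS]/(- ('d (fun y => 'd phi y v) x (- v))) linearN opprK.
  by rewrite E.
have [d1 c1] := c; have [d2 c2] := c1 v.
have cx : {for x, continuous (fun y => 'd (fun y => 'd phi y v) y v)}.
  by have := c2 v; apply.
have /nbhs_ballP[r /= r0 hr] : \forall y \near x, U y /\ 0 < 'd (fun y => 'd phi y v) y v.
  near=> y; split; near: y; first exact: open_nbhs_nbhs.
  exact: (@cvgr_gt _ _ _ _ _ _ cx).
have [t t0 tr] : exists2 t : R, 0 < t & t * `|v| < r.
  have s0 : 0 < `|v| + 1 by rewrite ltr_wpDl.
  exists (r / (`|v| + 1)); first by rewrite divr_gt0.
  by rewrite mulrAC ltr_pdivrMr // ltr_pM2l // ltrDl.
have inb a : 0 <= a <= 1 -> ball x r (x + a *: (t *: v)).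
  move=> /andP[a0 a1]; rewrite -ball_normE /= opprD addNKr normrN !normrZ.
  rewrite (ger0_norm a0) (gtr0_norm t0); apply: le_lt_trans tr.
  by rewrite ler_piMl // mulr_ge0 // ltW.
have [a a01 Ea] := @mvt_line R V phi x (t *: v) (fun a h => d1 _ (hr _ (inb a h)).1).
have a01' : 0 <= a <= 1 by case/andP: a01 => *; rewrite !ltW.
have sm b : 0 <= b <= 1 -> 0 <= b * a <= 1.
  move=> /andP[b0 b1]; case/andP: a01' => *.
  by rewrite mulr_ge0 //= mulr_ile1.
have inb2 b : 0 <= b <= 1 -> ball x r (x + b *: (a *: (t *: v))).
  by move=> b01; rewrite scalerA; apply: inb; exact: sm.
have [b b01 Eb] := @mvt_line R V (fun y => 'd phi y v) x (a *: (t *: v)) (fun b h => d2 _ (hr _ (inb2 b h)).1).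
have b01' : 0 <= b <= 1 by case/andP: b01 => *; rewrite !ltW.
have lZ (L : {linear V -> R}) k z : L (k *: z) = k * L z by rewrite linearZ.
have h1 : 0 < 'd phi (x + a *: (t *: v)) v.
  rewrite -[X in _ < X](subrK ('d phi x v)) Eb !lZ ltr_wpDr //.
  case/andP: a01 => a0 _; rewrite mulr_gt0 // mulr_gt0 //.
  exact: (hr _ (inb2 b b01')).2.
have h2 : 0 < phi (x + t *: v) - phi x by rewrite Ea lZ mulr_gt0.
have := mx (x + t *: v); rewrite -subr_le0 leNgt h2 => h; apply: notF; apply: h.
by have := inb 1; rewrite scale1r ler01 lexx => /(_ isT) /hr[].
Unshelve. all: by end_near. Qed.

End QuatMeanValue.

(* The value of the differential as a sealed constant: unifying ['d u x v] with
   ['d w x v] is very slow. *)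
HB.lock Definition dif (R : realType) (V W : normedModType R) (u : V -> W) (x v : V) : W :=
  'd u x v.

Section DiffAt.
Context {R : realType}.

Lemma difE (V W : normedModType R) (u : V -> W) (x v : V) : dif u x v = 'd u x v.
Proof. by rewrite dif.unlock. Qed.

Lemma dif_fun (V W : normedModType R) (u : V -> W) (v : V) :
  (fun y => dif u y v) = (fun y => 'd u y v).
Proof. by apply/funext => y; rewrite difE. Qed.

Lemma smooth_diff (V W : normedModType R) (U : set V) (u : V -> W) x :
  smooth_on U u -> U x -> differentiable u x.
Proof. by move=> /(_ 1) [d _] /d. Qed.

Lemma diffM_at (V : normedModType R) (u w : V -> quat R) x v :
  differentiable u x -> differentiable w x ->
  dif (fun y => u y * w y) x v = u x * dif w x v + dif u x v * w x.
Proof. by move=> du dw; rewrite !difE; exact: (congr1 (@^~ v) (diff_qmul du dw).2). Qed.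

Lemma diffD_at (V W : normedModType R) (u w : V -> W) x v :
  differentiable u x -> differentiable w x ->
  dif (fun y => u y + w y) x v = dif u x v + dif w x v.
Proof. by move=> du dw; rewrite !difE; exact: (congr1 (@^~ v) (diffD du dw)). Qed.

Lemma diffN_at (V W : normedModType R) (u : V -> W) x v :
  differentiable u x -> dif (fun y => - u y) x v = - dif u x v.
Proof. by move=> du; rewrite !difE; exact: (congr1 (@^~ v) (diffN du)). Qed.

Lemma diff_cst_at (V W : normedModType R) (c : W) (x v : V) : dif (fun=> c) x v = 0.
Proof. by rewrite difE; exact: (congr1 (@^~ v) (diff_cst c x)). Qed.

Lemma diff_id_at (V : normedModType R) (x v : V) : dif (fun y => y) x v = v.
Proof. by rewrite difE; exact: (congr1 (@^~ v) (diff_val (is_diff_def := is_diff_id x))). Qed.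

Lemma diff_qinv_at (V : normedModType R) (u : V -> quat R) x v :
  differentiable u x -> u x != 0 ->
  dif (fun y => (u y)^-1) x v = - ((u x)^-1 * dif u x v * (u x)^-1).
Proof. by move=> du u0; rewrite !difE; exact: (congr1 (@^~ v) (diff_qinv du u0)). Qed.

Lemma smooth_dif (V W : normedModType R) (U : set V) (u : V -> W) v :
  smooth_on U u -> smooth_on U (fun y => dif u y v).
Proof. by move=> su k; rewrite dif_fun; have [_ h] := su k.+1; exact: h. Qed.

Lemma diff_lin_at (V V' W : normedModType R) (u : V -> V') (L : {linear V' -> W}) x v :
  continuous L -> differentiable u x ->
  dif (fun y => L (u y)) x v = L (dif u x v).
Proof. by move=> cL du; rewrite !difE; exact: (congr1 (@^~ v) (diff_linc cL du).2). Qed.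

Lemma dif_comm (V : normedModType R) (U : set V) (u : V -> quat R) x v w : open U ->
  smooth_on U u -> U x ->
  dif (fun y => dif u y v) x w = dif (fun y => dif u y w) x v.
Proof. by move=> oU su Ux; rewrite !dif_fun !difE; exact: (clairaut v w oU (su 2) Ux). Qed.

Lemma eq_on_diff (V W : normedModType R) (U : set V) (u u' : V -> W) x v : open U ->
  {in U, u =1 u'} -> U x -> differentiable u x -> dif u' x v = dif u x v.
Proof.
by move=> oU e Ux du; rewrite !difE; exact: (congr1 (@^~ v) (eq_on_differentiable oU e Ux du).2).
Qed.

Lemma Ck_id (V : normedModType R) k (U : set V) : Ck k U (id : V -> V).
Proof.
case: k => [|k] /=; first by move=> x _; exact: cvg_id.
split=> [x _|v]; first exact: ex_diff.
rewrite (_ : (fun x => _) = fun=> v); first exact: Ck_cst.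
by apply/funext => x; exact: (congr1 (@^~ v) (diff_val (is_diff_def := is_diff_id x))).
Qed.

End DiffAt.

(** * Quaternion-valued holomorphic maps of the plane *)

Section CauchyRiemann.
Context {R : realType}.
Implicit Types (U : set (R * R)) (q : R * R -> quat R) (x y v : R * R).

Definition dir1 : R * R := (1, 0).
Definition dir2 : R * R := (0, 1).

Lemma rotJ_dir1 : rotJ dir1 = dir2.
Proof. by rewrite /rotJ /dir1 /dir2 /= oppr0. Qed.

Lemma plane_dirs (W : normedModType R) (u : R * R -> W) x v :
  dif u x v = v.1 *: dif u x dir1 + v.2 *: dif u x dir2.
Proof.
rewrite !difE; have {1}-> : v = v.1 *: dir1 + v.2 *: dir2.
  case: v => a b; rewrite -[RHS]/(a * 1 + b * 0, a * 0 + b * 1).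
  by rewrite !(mulr1, mulr0, addr0, add0r).
by rewrite linearD !linearZ.
Qed.

(** The complex structure on H is left multiplication by [qi], so these are the holomorphic maps
    into H = C^2, and [dir1] gives the complex derivative. *)
Definition cauchy_riemann U q : Prop :=
  smooth_on U q /\ forall x, U x -> dif q x dir2 = qi * dif q x dir1.

Definition dxn n q := iter n (fun p y => dif p y dir1) q.

Lemma cauchy_riemann_dx U q : open U -> cauchy_riemann U q ->
  cauchy_riemann U (fun y => dif q y dir1).
Proof.
move=> oU [sq cr]; split=> [k|x Ux]; first exact: smooth_dif.
rewrite (dif_comm dir1 dir2 oU sq Ux).
have dx : differentiable (fun y => dif q y dir1) x.
  exact: smooth_diff (smooth_dif dir1 sq) Ux.
have dM := (diff_qmul (differentiable_cst qi x) dx).1.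
have e : {in U, (fun y => qi * dif q y dir1) =1 (fun y => dif q y dir2)}.
  by move=> y; rewrite inE => Uy; rewrite cr.
rewrite (eq_on_diff dir1 oU e Ux dM) (diffM_at dir1 (differentiable_cst qi x) dx).
by rewrite diff_cst_at mul0r addr0.
Qed.

Lemma cauchy_riemann_bound U q x v : cauchy_riemann U q -> U x ->
  `|dif q x v| <= 2 * `|v| * `|dif q x dir1|.
Proof.
move=> [_ cr] Ux; rewrite plane_dirs cr //.
apply: le_trans (ler_normD _ _) _; rewrite !normrZ qnormM_qi -mulrDl.
apply: ler_wpM2r => //; rewrite mulr_natl mulr2n.
by apply: lerD; rewrite -[`|v|]/(Num.max `|v.1| `|v.2|) le_max lexx ?orbT.
Qed.

Lemma cauchy_riemannD U p q : open U -> cauchy_riemann U p -> cauchy_riemann U q ->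
  cauchy_riemann U (fun y => p y + q y).
Proof.
move=> oU [sp crp] [sq crq]; split=> [k|x Ux]; first exact: CkD.
have dp := smooth_diff sp Ux; have dq := smooth_diff sq Ux.
by rewrite !diffD_at // crp // crq // mulrDr.
Qed.

Lemma cauchy_riemannN U q : open U -> cauchy_riemann U q ->
  cauchy_riemann U (fun y => - q y).
Proof.
move=> oU [sq crq]; split=> [k|x Ux]; first exact: CkN.
by rewrite !diffN_at ?crq ?mulrN //; exact: smooth_diff sq Ux.
Qed.

Lemma cauchy_riemann_cst U (c : quat R) : cauchy_riemann U (fun=> c).
Proof.
by split=> [k|x Ux]; [exact: Ck_cst|rewrite !diff_cst_at mulr0].
Qed.

(** In [p dq] the factor [qi] has to pass [p], whence the commutation hypothesis on the left factor
    only. *)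
Lemma cauchy_riemannM U p q : open U -> cauchy_riemann U p ->
  (forall x, U x -> p x * qi = qi * p x) -> cauchy_riemann U q ->
  cauchy_riemann U (fun y => p y * q y).
Proof.
move=> oU [sp crp] cp [sq crq]; split=> [k|x Ux]; first exact: Ck_qmul.
have dp := smooth_diff sp Ux; have dq := smooth_diff sq Ux.
by rewrite !diffM_at // crp // crq // mulrDr !mulrA cp.
Qed.

Definition qplane v : quat R := (v.1, v.2, 0, 0).

Lemma qplane_is_linear : linear qplane.
Proof.
move=> k x y; rewrite /qplane; apply: quatP; rewrite ?qE /= ?(mulr0, addr0) //.
Qed.
HB.instance Definition _ := GRing.isLinear.Build R (R * R)%type (quat R) _ qplane
  qplane_is_linear.

Lemma qplane_continuous : continuous qplane.
Proof.
move=> x; apply/quat_cvg; split=> /=; [exact: cvg_fst|exact: cvg_snd|exact: cvg_cst|exact: cvg_cst].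
Qed.

Lemma qplane_comm v w : qplane v * qplane w = qplane w * qplane v.
Proof. by rewrite !qmulE /qplane /=; apply: quatP => /=; ring. Qed.

Lemma qplane_qi : qplane dir2 = qi. Proof. by []. Qed.
Lemma qplane_1 : qplane dir1 = 1. Proof. by []. Qed.

Section Centered.
Variable x0 : R * R.
Definition zq y := qplane (y - x0).

Lemma diff_zq x : differentiable zq x /\ forall v, dif zq x v = qplane v.
Proof.
have d1 : differentiable (fun y => y - x0) x by exact: ex_diff.
have [d2 _] := @diff_linc _ _ _ _ _ qplane x qplane_continuous d1.
split=> // v; apply: etrans (diff_lin_at v qplane_continuous d1) _; congr qplane.
apply: etrans (diffD_at v (ex_diff : differentiable id x) (differentiable_cst (- x0) x)) _.
by rewrite diff_cst_at addr0 diff_id_at.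
Qed.

Lemma cauchy_riemann_zq U : open U -> cauchy_riemann U zq.
Proof.
move=> oU; split=> [k|x Ux].
  by apply: (Ck_lin oU qplane_continuous); apply: CkD => //; [exact: Ck_id|exact: Ck_cst].
by rewrite !(diff_zq x).2 qplane_qi qplane_1 mulr1.
Qed.

Lemma zq_comm y v : zq y * qplane v = qplane v * zq y.
Proof. exact: qplane_comm. Qed.

Lemma cauchy_riemann_zqX U n : open U -> cauchy_riemann U (fun y => zq y ^+ n).
Proof.
move=> oU; elim: n => [|n IH].
  by rewrite (_ : (fun y => _) = fun=> 1) //; exact: cauchy_riemann_cst.
rewrite (_ : (fun y => _) = fun y => zq y * zq y ^+ n); last by apply/funext => y; rewrite exprS.
apply: (cauchy_riemannM oU (cauchy_riemann_zq oU) _ IH) => x _.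
exact: (zq_comm x dir2).
Qed.

Lemma dx_zqX n y : dif (fun y => zq y ^+ n.+1) y dir1 = n.+1%:R *: (zq y ^+ n).
Proof.
elim: n => [|n IH].
  rewrite (_ : (fun y => _) = zq); last by apply/funext => z; rewrite expr1.
  by rewrite (diff_zq y).2 qplane_1 expr0 scale1r.
rewrite (_ : (fun y => _) = fun y => zq y * zq y ^+ n.+1); last by apply/funext => z; rewrite exprS.
have dX : differentiable (fun y => zq y ^+ n.+1) y.
  by have [s _] := @cauchy_riemann_zqX setT n.+1 openT; exact: smooth_diff s _.
rewrite (diffM_at _ (diff_zq y).1 dX) IH (diff_zq y).2 qplane_1 mul1r -scalerAr -exprS.
by rewrite -[X in _ + X]scale1r -scalerDl natr1.
Qed.

End Centered.

End CauchyRiemann.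

(* Comparing [1] with [0] in an abstract [realType] by unfolding is very slow. *)
#[global] Opaque dir1 dir2.

(** * Isolated zeros of Cauchy-Riemann maps *)

Section IsolatedZeros.
Context {R : realType}.
Variable U : set (R * R).
Hypothesis oU : open U.
Variable x0 : R * R.
Hypothesis Ux0 : U x0.
Implicit Types (q : R * R -> quat R) (y v : R * R).

Lemma near_bounded (V W : normedModType R) (u : V -> W) (x : V) : {for x, continuous u} ->
  exists2 M, 0 <= M & \forall y \near x, `|u y| <= M.
Proof.
move=> c; exists (`|u x| + 1); first by rewrite addr_ge0.
have h : \forall y \near x, `|u x - u y| < 1 by exact: (@cvgr_dist_lt _ _ _ _ _ _ _ c 1 ltr01).
apply: filterS h => y h.
rewrite -[u y](subrK (u x)) addrC; apply: le_trans (ler_normD _ _) _.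
by rewrite lerD2l distrC ltW.
Qed.

Lemma smooth_near_bounded q : smooth_on U q ->
  exists2 M, 0 <= M & \forall y \near x0, `|q y| <= M.
Proof. by move=> s; exact: (near_bounded (s 0 x0 Ux0)). Qed.

(** Integrating the bound on the derivative along the segment from [x0] gains one order; the 2 comes
    from [cauchy_riemann_bound]. *)
Lemma near_pow_bound q M n : cauchy_riemann U q -> 0 <= M ->
  (\forall y \near x0, `|dif q y dir1| <= M * `|y - x0| ^+ n) -> q x0 = 0 ->
  \forall y \near x0, `|q y| <= 2 * M * `|y - x0| ^+ n.+1.
Proof.
move=> crq M0 nb q0.
have /nbhs_ballP[r /= r0 hr] : \forall y \near x0, U y /\ `|dif q y dir1| <= M * `|y - x0| ^+ n.
  have nU : \forall y \near x0, U y by exact: open_nbhs_nbhs.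
  by apply: filterS2 nU nb.
apply/nbhs_ballP; exists r => //= y; rewrite -ball_normE /= distrC => yr.
set v := y - x0 in yr *.
have -> : y = x0 + v by rewrite /v addrC subrK.
rewrite -[q _]subr0 -q0.
have tv (t : R) : 0 <= t <= 1 -> `|t *: v| <= `|v|.
  by move=> /andP[t0 t1]; rewrite normrZ (ger0_norm t0) ler_piMl.
have inb (t : R) : 0 <= t <= 1 -> ball x0 r (x0 + t *: v).
  move=> t01; rewrite -ball_normE /= opprD addNKr normrN.
  exact: le_lt_trans (tv t t01) yr.
apply: (@mvt_norm R _ q x0 v) => t t01.
  by apply: smooth_diff crq.1 _; exact: (hr _ (inb t t01)).1.
have [Ut bt] := hr _ (inb t t01).
rewrite -difE; apply: le_trans (cauchy_riemann_bound v crq Ut) _.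
rewrite exprS -!mulrA ler_pM2l // mulrCA ler_wpM2l //.
apply: le_trans bt _; rewrite ler_wpM2l //; apply: lerXn2r; rewrite ?nnegrE //.
by rewrite addrAC subrr add0r tv.
Qed.

Lemma dxnS n q : dxn n.+1 q = dxn n (fun y => dif q y dir1).
Proof. exact: iterSr. Qed.

Lemma vanishing_order_bound n q : cauchy_riemann U q ->
  (forall j, (j < n)%N -> dxn j q x0 = 0) ->
  exists2 M, 0 <= M & \forall y \near x0, `|q y| <= M * `|y - x0| ^+ n.
Proof.
elim: n q => [|n IH] q crq h.
  have [M M0 hM] := smooth_near_bounded crq.1; exists M => //.
  by apply: filterS hM => y; rewrite expr0 mulr1.
have [j jn|M M0 hM] := IH _ (cauchy_riemann_dx oU crq).
  by rewrite -dxnS h.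
exists (2 * M); first by rewrite mulr_ge0.
by apply: near_pow_bound => //; exact: (h 0).
Qed.

(** The expansion of the complex derivative is integrated: [near_pow_bound] applies to [q] minus the
    candidate leading term, which vanishes at [x0]. *)
Lemma leading_term n q : cauchy_riemann U q ->
  (forall j, (j < n)%N -> dxn j q x0 = 0) -> dxn n q x0 != 0 ->
  exists2 c : quat R, c != 0 & exists2 M, 0 <= M &
    \forall y \near x0, `|q y - zq x0 y ^+ n * c| <= M * `|y - x0| ^+ n.+1.
Proof.
elim: n q => [|n IH] q crq h qn.
  exists (q x0) => //.
  have crq' := cauchy_riemannD oU crq (cauchy_riemann_cst U (- q x0)).
  have [M M0 hM] := smooth_near_bounded (cauchy_riemann_dx oU crq').1.
  exists (2 * M); first by rewrite mulr_ge0.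
  have := near_pow_bound (n := 0) crq' M0 _ (subrr _).
  have hM' : \forall y \near x0, `|dif (fun y => q y + - q x0) y dir1| <= M * `|y - x0| ^+ 0.
    by apply: filterS hM => y; rewrite expr0 mulr1.
  by move=> /(_ hM'); apply: filterS => y; rewrite expr0 mul1r.
have [j jn||c c0 [M M0 hM]] := IH _ (cauchy_riemann_dx oU crq).
- by rewrite -dxnS h.
- by rewrite -dxnS.
have n0 : n.+1%:R != 0 :> R by rewrite pnatr_eq0.
(* The coefficient of the primitive of [z^n c]. *)
pose c' := n.+1%:R^-1 *: c.
exists c'; first by rewrite scaler_eq0 invr_eq0 negb_or n0.
exists (2 * M); first by rewrite mulr_ge0.
have crZ := cauchy_riemannM oU (cauchy_riemann_zqX x0 n.+1 oU) _ (cauchy_riemann_cst U c').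
have crZ' : cauchy_riemann U (fun y => zq x0 y ^+ n.+1 * c').
  by apply: crZ => y _; apply: commr_sym; apply: commrX; rewrite /GRing.comm -qplane_qi zq_comm.
have crp := cauchy_riemannD oU crq (cauchy_riemannN oU crZ').
have := near_pow_bound (n := n.+1) crp M0; apply.
- near=> y; have Uy : U y by near: y; exact: open_nbhs_nbhs.
  have dq := smooth_diff crq.1 Uy; have dZ := smooth_diff crZ'.1 Uy.
  have dZ1 : differentiable (fun y => zq x0 y ^+ n.+1) y.
    exact: smooth_diff (cauchy_riemann_zqX x0 n.+1 oU).1 Uy.
  rewrite (diffD_at dir1 dq (differentiableN dZ)) (diffN_at dir1 dZ).
  rewrite (diffM_at dir1 dZ1 (differentiable_cst c' y)) diff_cst_at mulr0 add0r dx_zqX.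
  by rewrite -scalerAl /c' -scalerAr scalerA mulfV // scale1r; near: y.
- have q0 : q x0 = 0 by exact: (h 0).
  rewrite -[LHS]/(q x0 + - (zq x0 x0 ^+ n.+1 * c')).
  by rewrite q0 /zq subrr linear0 expr0n mul0r subr0.
Unshelve. all: by end_near. Qed.

Lemma qnormsqM (x y : quat R) : qnormsq (x * y) = qnormsq x * qnormsq y.
Proof. by rewrite /qnormsq !qmulE /=; ring. Qed.

Lemma qnormsqX (x : quat R) n : qnormsq (x ^+ n) = qnormsq x ^+ n.
Proof.
elim: n => [|n IH]; last by rewrite !exprS qnormsqM IH.
by rewrite !expr0 /qnormsq qone1 /= expr1n !expr0n /= !addr0.
Qed.

Lemma qnormsq_ge0 (x : quat R) : 0 <= qnormsq x.
Proof. by rewrite /qnormsq !addr_ge0 ?sqr_ge0. Qed.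

Lemma qnormsq_le (x : quat R) : qnormsq x <= 4 * `|x| ^+ 2.
Proof.
have /qnorm_le[h1 h2 h3 h4] := lexx `|x|.
have s (t : R) : `|t| <= `|x| -> t ^+ 2 <= `|x| ^+ 2.
  by move=> h; rewrite -[leLHS]ger0_norm ?sqr_ge0 // normrX; apply: lerXn2r; rewrite ?nnegrE.
by rewrite /qnormsq; have := s _ h1; have := s _ h2; have := s _ h3; have := s _ h4; lra.
Qed.

Lemma qnormsq_zq_ge y : `|y - x0| ^+ 2 <= qnormsq (zq x0 y).
Proof.
rewrite /zq /qnormsq /= expr0n /= !addr0.
rewrite -[`|y - x0|]/(Num.max `|(y - x0).1| `|(y - x0).2|) /Num.max.
by case: ifP => _; rewrite -normrX ger0_norm ?sqr_ge0 // ?lerDl ?lerDr sqr_ge0.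
Qed.

(** At a zero of [q] the leading term equals the remainder up to sign, so |z|^n |c| would be
    O(|z|^(n+1)). Euclidean and sup norms are compared by [qnormsq_le] and [qnormsq_zq_ge]. *)
Lemma finite_order_isolated n q : cauchy_riemann U q ->
  (forall j, (j < n)%N -> dxn j q x0 = 0) -> dxn n q x0 != 0 ->
  \forall y \near x0^', q y != 0.
Proof.
move=> crq h qn; have [c c0 [M M0 hM]] := leading_term crq h qn.
have Nc : 0 < qnormsq c by rewrite lt_def qnormsq_ge0 qnormsq_eq0 c0.
have K0 : 0 < 4 * M ^+ 2 + 1 by rewrite ltr_wpDl // mulr_ge0 // sqr_ge0.
have small : \forall y \near x0, (4 * M ^+ 2 + 1) * `|y - x0| ^+ 2 < qnormsq c.
  have cd : (4 * M ^+ 2 + 1) * `|y - x0| ^+ 2 @[y --> x0] --> (4 * M ^+ 2 + 1) * `|x0 - x0| ^+ 2.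
    apply: cvgMr; apply: (@cvg_comp _ _ _ (fun y => `|y - x0|) (fun t => t ^+ 2)); last exact: exprn_continuous.
    by apply: cvg_norm; apply: cvgB; [exact: cvg_id|exact: cvg_cst].
  apply: (cvgr_lt _ cd); by rewrite subrr normr0 expr0n mulr0.
near=> y.
have yx : y != x0 by near: y; exact: nbhs_dnbhs_neq.
have hy : `|q y - zq x0 y ^+ n * c| <= M * `|y - x0| ^+ n.+1.
  by near: y; exact: nbhs_dnbhs.
have sy : (4 * M ^+ 2 + 1) * `|y - x0| ^+ 2 < qnormsq c by near: y; exact: nbhs_dnbhs.
apply/eqP => qy; move: hy; rewrite qy sub0r normrN => hy.
have d0 : 0 < `|y - x0| by rewrite normr_gt0 subr_eq0.
have := qnormsq_le (zq x0 y ^+ n * c); rewrite qnormsqM qnormsqX leNgt => /negP; apply.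
apply: (@le_lt_trans _ _ (4 * (M * `|y - x0| ^+ n.+1) ^+ 2)).
  by rewrite ler_pM2l //; apply: lerXn2r; rewrite ?nnegrE // mulr_ge0 // exprn_ge0.
apply: (@lt_le_trans _ _ ((`|y - x0| ^+ 2) ^+ n * qnormsq c)); last first.
  by rewrite ler_pM2r //; apply: lerXn2r; rewrite ?nnegrE ?sqr_ge0 ?qnormsq_ge0 ?qnormsq_zq_ge.
apply: (@le_lt_trans _ _ ((`|y - x0| ^+ 2) ^+ n * ((4 * M ^+ 2 + 1) * `|y - x0| ^+ 2))); last first.
  by rewrite ltr_pM2l // exprn_gt0 // exprn_gt0.
have -> : (M * `|y - x0| ^+ n.+1) ^+ 2 =
    M ^+ 2 * (`|y - x0| ^+ 2 * (`|y - x0| ^+ 2) ^+ n).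
  by rewrite exprMn -!exprM -exprD mulnC mulnS.
rewrite -subr_ge0 [X in 0 <= X](_ : _ = (`|y - x0| ^+ 2) ^+ n * `|y - x0| ^+ 2); last by ring.
by rewrite mulr_ge0 ?exprn_ge0.
Unshelve. all: by end_near. Qed.

End IsolatedZeros.

Section QuatDot.
Context {R : realType}.
Implicit Types x y z : quat R.

Definition qdot x y : R := qre (qconj x * y).

Lemma qdotE x y : qdot x y =
  x.1.1.1 * y.1.1.1 + x.1.1.2 * y.1.1.2 + x.1.2 * y.1.2 + x.2 * y.2.
Proof. by rewrite /qdot /qre qmulE qconjE /=; ring. Qed.

Lemma qdotC x y : qdot x y = qdot y x.
Proof. by rewrite !qdotE; ring. Qed.

Lemma qdotxx x : qdot x x = qnormsq x.
Proof. by rewrite qnormsqE. Qed.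

Lemma qdot_is_bilinear : bilinear_for
    (GRing.Scale.Law.clone _ _ *:%R _) (GRing.Scale.Law.clone _ _ *:%R _)
    (qdot : quat R -> quat R -> R^o).
Proof.
split=> [z|z] a x y.
  rewrite -[LHS]/(qdot (a *: x + y) z) -[RHS]/(a * qdot x z + qdot y z).
  by rewrite !qdotE !qE /=; ring.
rewrite -[LHS]/(qdot z (a *: x + y)) -[RHS]/(a * qdot z x + qdot z y).
by rewrite !qdotE !qE /=; ring.
Qed.
HB.instance Definition _ := bilinear_isBilinear.Build R (quat R) (quat R) R^o
  _ _ (qdot : quat R -> quat R -> R^o) qdot_is_bilinear.

Lemma qdot_continuous : continuous (fun p : quat R * quat R => qdot p.1 p.2).
Proof.
move=> p; apply: (cvg_comp _ (@qre R) _ (@qre_continuous R _)).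
apply: qmul_cvg; last exact: cvg_snd.
by apply: (cvg_comp _ (@qconj R) _ (@qconj_continuous R _)); exact: cvg_fst.
Qed.

Lemma Ck_qdot (V : normedModType R) k (U : set V) (u v : V -> quat R) : open U ->
  Ck k U u -> Ck k U v -> Ck k U (fun t => qdot (u t) (v t)).
Proof.
by move=> oU; apply: (@Ck_bilin R V (quat R) (quat R) R^o qdot k U u v oU qdot_continuous).
Qed.

Lemma diff_qdot_at (V : normedModType R) (u w : V -> quat R) (x v : V) :
  differentiable u x -> differentiable w x ->
  differentiable (fun t => qdot (u t) (w t)) x /\
  dif (fun t => qdot (u t) (w t)) x v = qdot (u x) (dif w x v) + qdot (dif u x v) (w x).
Proof.
move=> du dw.
have [d E] := @diff_bilin_comp R V (quat R) (quat R) R^o qdot u w x qdot_continuous du dw.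
by split=> //; rewrite !difE; exact: (congr1 (@^~ v) E).
Qed.

End QuatDot.

(** * Zeros of infinite order, by the maximum principle *)

Section InfiniteOrder.
Context {R : realType}.
Implicit Types (U : set (R * R)) (h q : R * R -> quat R).

Lemma second_diff_qnormsq (V : normedModType R) (U : set V) (h : V -> quat R) x v :
  open U -> smooth_on U h -> U x ->
  dif (fun y => dif (fun y => qdot (h y) (h y)) y v) x v =
  2 * qdot (h x) (dif (fun y => dif h y v) x v) + 2 * qnormsq (dif h x v).
Proof.
move=> oU sh Ux.
have dh y : U y -> differentiable h y by exact: smooth_diff.
have dh' : differentiable (fun y => dif h y v) x by exact: smooth_diff (smooth_dif v sh) Ux.
have [d1 E1] := diff_qdot_at v (dh x Ux) dh'.
have [d2 E2] := diff_qdot_at v dh' (dh x Ux).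
have e : {in U, (fun y => qdot (h y) (dif h y v) + qdot (dif h y v) (h y)) =1
    (fun y => dif (fun y => qdot (h y) (h y)) y v)}.
  by move=> y; rewrite inE => Uy; rewrite (diff_qdot_at v (dh y Uy) (dh y Uy)).2.
rewrite (eq_on_diff v oU e Ux (differentiableD d1 d2)) (diffD_at v d1 d2) E1 E2.
have H (a b c : R) : a = c -> (a + b) + (b + c) = 2 * a + 2 * b by move=> <-; ring.
by rewrite -qdotxx; exact: (H _ _ _ (qdotC (h x) _)).
Qed.

Lemma qdotNr (x y : quat R) : qdot x (- y) = - qdot x y.
Proof. by rewrite !qdotE /=; ring. Qed.

Lemma second_diffD (V W : normedModType R) (U : set V) (u w : V -> W) x v : open U ->
  smooth_on U u -> smooth_on U w -> U x ->
  dif (fun y => dif (fun y => u y + w y) y v) x v =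
  dif (fun y => dif u y v) x v + dif (fun y => dif w y v) x v.
Proof.
move=> oU su sw Ux.
have d1 := smooth_diff (smooth_dif v su) Ux; have d2 := smooth_diff (smooth_dif v sw) Ux.
have e : {in U, (fun y => dif u y v + dif w y v) =1 (fun y => dif (fun y => u y + w y) y v)}.
  move=> y; rewrite inE => Uy.
  by rewrite (diffD_at v (smooth_diff su Uy) (smooth_diff sw Uy)).
by rewrite (eq_on_diff v oU e Ux (differentiableD d1 d2)) (diffD_at v d1 d2).
Qed.

(** A Cauchy-Riemann map is harmonic because [qi * qi = -1], so the terms with second derivatives of
    [h] cancel and only squares remain. *)
Lemma laplacian_qnormsq U h x : open U -> cauchy_riemann U h -> U x ->
  dif (fun y => dif (fun y => qdot (h y) (h y)) y dir1) x dir1 +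
  dif (fun y => dif (fun y => qdot (h y) (h y)) y dir2) x dir2 =
  2 * qnormsq (dif h x dir1) + 2 * qnormsq (dif h x dir2).
Proof.
move=> oU crh Ux; have [sh cr] := crh.
rewrite !(second_diff_qnormsq _ oU sh Ux).
have -> : dif (fun y => dif h y dir2) x dir2 = - dif (fun y => dif h y dir1) x dir1.
  have dx : differentiable (fun y => dif h y dir1) x.
    exact: smooth_diff (smooth_dif dir1 sh) Ux.
  have dM := (diff_qmul (differentiable_cst qi x) dx).1.
  have e : {in U, (fun y => qi * dif h y dir1) =1 (fun y => dif h y dir2)}.
    by move=> y; rewrite inE => Uy; rewrite cr.
  rewrite (eq_on_diff dir2 oU e Ux dM) (diffM_at dir2 (differentiable_cst qi x) dx).
  rewrite diff_cst_at mul0r addr0 (cauchy_riemann_dx oU crh).2 // mulrA.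
  rewrite [qi * qi](_ : _ = -1) ?mulN1r //.
  by apply: quatP; rewrite ?qE /qi /=; ring.
by rewrite qdotNr; ring.
Qed.

Lemma qnormsqV (x : quat R) : qnormsq x^-1 = (qnormsq x)^-1.
Proof.
have [->|x0] := eqVneq x 0.
  by rewrite invr0 /qnormsq /= expr0n /= !addr0 invr0.
have n0 : qnormsq x != 0 by rewrite qnormsq_eq0.
apply: (mulIf n0); rewrite -qnormsqM mulVr // mulVf //.
by rewrite /qnormsq qone1 /= expr1n !expr0n /= !addr0.
Qed.

Lemma cauchy_riemannX U p n : open U -> cauchy_riemann U p ->
  (forall x, U x -> p x * qi = qi * p x) -> cauchy_riemann U (fun y => p y ^+ n).
Proof.
move=> oU crp cp; elim: n => [|n IH].
  have -> : (fun y => p y ^+ 0) = (fun=> 1 : quat R) by apply/funext => y; rewrite expr0.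
  exact: cauchy_riemann_cst.
have -> : (fun y => p y ^+ n.+1) = (fun y => p y * p y ^+ n).
  by apply/funext => y; rewrite exprS.
exact: (cauchy_riemannM oU crp cp IH).
Qed.

Lemma cauchy_riemannV U p : open U -> cauchy_riemann U p ->
  (forall x, U x -> p x * qi = qi * p x) -> (forall x, U x -> p x != 0) ->
  cauchy_riemann U (fun y => (p y)^-1).
Proof.
move=> oU [sp crp] cp p0; split=> [k|x Ux]; first exact: Ck_qinv.
have dp := smooth_diff sp Ux; have px := p0 x Ux.
rewrite !diff_qinv_at // crp // mulrN; congr (- _).
have : GRing.comm qi (p x)^-1 by apply: commrV; rewrite /GRing.comm cp.
by rewrite /GRing.comm !mulrA => ->.
Qed.

(** Here [x1], [x2] are the pure second derivatives of |h|^2 and [x3], [x4] those of |w|^2; the two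
    equations are their Laplacians, and [x8] is the strictly positive contribution of [w]. *)
Lemma subharmonic_contra (x1 x2 x3 x4 x5 x6 x7 x8 : R) : x1 + x3 <= 0 -> x2 + x4 <= 0 ->
  x1 + x2 = 2 * x5 + 2 * x6 -> x3 + x4 = 2 * x8 + 2 * x7 ->
  0 <= x5 -> 0 <= x6 -> 0 <= x7 -> 0 < x8 -> False.
Proof. by lra. Qed.

(** For each [n], maximize |q / z^(n+1)|^2 + |k z|^2 over a closed square [K] of half-side [r]
    around [x0]; the first term extends continuously by 0 to [x0] thanks to the infinite order. An
    interior maximum away from [x0] is impossible since the Laplacian is positive there, so the
    boundary values bound the function. This yields |q|^2 <= (Q + 4) (|z| / r)^(2n+2), which tends
    to 0 with [n] on a smaller square. *)
Lemma infinite_order_zero U q x0 : open U -> U x0 -> cauchy_riemann U q ->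
  (forall n, dxn n q x0 = 0) -> \forall y \near x0, q y = 0.
Proof.
move=> oU Ux0 crq hq.
have [r r0 KU] : exists2 r, 0 < r & forall y, `|y - x0| <= r -> U y.
  have /nbhs_ballP[e /= e0 he] : nbhs x0 U by exact: open_nbhs_nbhs.
  exists (e / 2); first by rewrite divr_gt0.
  move=> y h; apply: he; rewrite -ball_normE /= distrC.
  by apply: le_lt_trans h _; rewrite ltr_pdivrMr // ltr_pMr // ltr1n.
pose K := [set y : R * R | `|y - x0| <= r].
have cK : compact K.
  have -> : K = `[x0.1 - r, x0.1 + r]%classic `*` `[x0.2 - r, x0.2 + r]%classic.
    apply/seteqP; split=> -[a b]; rewrite /K /=.
      rewrite -[`|(a, b) - x0|]/(Num.max `|a - x0.1| `|b - x0.2|) ge_max.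
      by move=> /andP[]; rewrite !ler_distl !in_itv.
    rewrite !in_itv /= => -[h1 h2].
    rewrite -[`|(a, b) - x0|]/(Num.max `|a - x0.1| `|b - x0.2|) ge_max.
    by rewrite !ler_distl h1 h2.
  by apply: compact_setX; exact: segment_compact.
have Kx0 : K x0 by rewrite /K /= subrr normr0 ltW.
have cont_dot (u : R * R -> quat R) y : {for y, continuous u} ->
    {for y, continuous (fun y => qdot (u y) (u y))}.
  move=> c; apply: (@continuous_comp _ _ _ (fun y => (u y, u y)) (fun p => qdot p.1 p.2)).
    exact: (cvg_pair c c).
  exact: qdot_continuous.
have cNq : {within K, continuous (fun y => qdot (q y) (q y))}.
  apply: continuous_in_subspaceT => y; rewrite inE => Ky.
  by apply: cont_dot; exact: (crq.1 0 y (KU _ Ky)).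
have [yQ _ hQ] := compact_EVT_max (ex_intro _ x0 Kx0) cK cNq.
set Q := qdot (q yQ) (q yQ) in hQ.
have q0 : q x0 = 0 := hq 0.
have Z0 : zq x0 x0 = 0 by rewrite /zq subrr linear0.
have rr0 : 0 < r ^+ 2 by rewrite exprn_gt0.
have key n : (forall y, K y -> q y = 0) \/
   (forall y, K y -> (qnormsq (zq x0 y))^-1 ^+ n.+1 * qnormsq (q y) <= (Q + 4) * (r ^+ 2)^-1 ^+ n.+1).
  pose h y := (zq x0 y)^-1 ^+ n.+1 * q y.
  have Nh y : qdot (h y) (h y) = (qnormsq (zq x0 y))^-1 ^+ n.+1 * qnormsq (q y).
    by rewrite qdotxx /h qnormsqM qnormsqX qnormsqV.
  (* Chosen so that on the boundary |k z|^2 is at most 4 r^-(2n+2), the same power of [r] as in the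
     bound on the first term; this is the 4 in [Q + 4]. *)
  pose k := r^-1 ^+ n.+2.
  have k0 : 0 < k by rewrite exprn_gt0 // invr_gt0.
  have k2 : k ^+ 2 * r ^+ 2 = (r ^+ 2)^-1 ^+ n.+1.
    have -> : k ^+ 2 = (r ^+ 2)^-1 ^+ n.+2 by rewrite /k -exprM mulnC exprM exprVn.
    by rewrite exprSr -mulrA mulVf ?mulr1 // gt_eqF.
  pose w y := zq x0 y * (k *: 1).
  have Nw y : qdot (w y) (w y) = k ^+ 2 * qnormsq (zq x0 y).
    by rewrite qdotxx qnormsqM mulrC; congr (_ * _); rewrite /qnormsq qone1 qscaleE /=; ring.
  pose phi y := qdot (h y) (h y) + qdot (w y) (w y).
  pose U' := U `&` ~` [set x0].
  have oU' : open U'.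
    apply: openI => //; apply: closed_openC; apply: accessible_closed_set1.
    by apply: hausdorff_accessible; exact: norm_hausdorff.
  have zn0 y : U' y -> zq x0 y != 0.
    move=> [_ yx]; rewrite -qnormsq_eq0 gt_eqF //.
    apply: lt_le_trans (qnormsq_zq_ge x0 y).
    by rewrite exprn_gt0 // normr_gt0 subr_eq0; apply/eqP.
  have crz := cauchy_riemann_zq x0 oU'.
  have czi y : zq x0 y * qi = qi * zq x0 y := zq_comm x0 y dir2.
  have crzV := cauchy_riemannV oU' crz (fun y _ => czi y) zn0.
  have cziV y : (zq x0 y)^-1 * qi = qi * (zq x0 y)^-1.
    by apply/esym/commrV; rewrite /GRing.comm czi.
  have cq' : cauchy_riemann U' q.
    split=> [j|y [Uy _]]; last exact: crq.2.
    by apply: Ck_sub (crq.1 j); exact: subIsetl.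
  have crh : cauchy_riemann U' h.
    apply: (cauchy_riemannM oU' (cauchy_riemannX n.+1 oU' crzV (fun y _ => cziV y)) _ cq') => y _.
    by apply/esym/commrX; rewrite /GRing.comm cziV.
  have crw : cauchy_riemann U w.
    exact: (cauchy_riemannM oU (cauchy_riemann_zq x0 oU) (fun y _ => czi y) (cauchy_riemann_cst U _)).
  have cphi : {within K, continuous phi}.
    apply: continuous_in_subspaceT => y; rewrite inE => Ky.
    apply: cvgD; last by apply: cont_dot; exact: (crw.1 0 y (KU _ Ky)).
    have [->|yx] := eqVneq y x0; last first.
      by apply: cont_dot; apply: (crh.1 0); split; [exact: KU|exact/eqP].
    (* One order more than the division by z^(n+1) consumes, so that [h] is O(|z|) and tends to
       0. *)
    have [M M0 hM] := vanishing_order_bound oU Ux0 (n := n.+2) crq (fun j _ => hq j).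
    have -> : qdot (h x0) (h x0) = 0.
      by rewrite /h q0 mulr0 qdotE /= !mulr0 !addr0.
    have up : \forall y \near x0, 0 <= qdot (h y) (h y) <= 4 * M ^+ 2 * `|y - x0| ^+ 2.
      apply: filterS hM => z hz; rewrite qdotxx qnormsq_ge0 /= -qdotxx Nh.
      have [->|zx] := eqVneq z x0.
        by rewrite q0 subrr normr0 expr0n mulr0 /qnormsq /= expr0n /= !addr0 mulr0.
      have d0 : 0 < `|z - x0| ^+ 2 by rewrite exprn_gt0 // normr_gt0 subr_eq0.
      have b1 : qnormsq (q z) <= 4 * M ^+ 2 * (`|z - x0| ^+ 2) ^+ n.+2.
        apply: le_trans (qnormsq_le _) _; rewrite -mulrA ler_pM2l //.
        have -> : M ^+ 2 * (`|z - x0| ^+ 2) ^+ n.+2 = (M * `|z - x0| ^+ n.+2) ^+ 2.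
          by rewrite [in RHS]exprMn -!exprM [in RHS]mulnC.
        by apply: lerXn2r; rewrite ?nnegrE // mulr_ge0 // exprn_ge0.
      have b2 : (qnormsq (zq x0 z))^-1 ^+ n.+1 <= (`|z - x0| ^+ 2)^-1 ^+ n.+1.
        apply: lerXn2r; rewrite ?nnegrE ?invr_ge0 ?qnormsq_ge0 ?(ltW d0) //.
        rewrite lef_pV2 ?posrE //; first exact: qnormsq_zq_ge.
        exact: lt_le_trans d0 (qnormsq_zq_ge x0 z).
      apply: le_trans (ler_pM _ _ b2 b1) _; rewrite ?qnormsq_ge0 ?exprn_ge0 ?invr_ge0 ?qnormsq_ge0 //.
      rewrite mulrCA ler_wpM2l // ?mulr_ge0 ?sqr_ge0 //.
      by rewrite exprVn [_ ^+ n.+2]exprSr mulrA mulVf ?mul1r // expf_neq0 // gt_eqF.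
    apply: (squeeze_cvgr up); first exact: cvg_cst.
    have -> : 0 = 4 * M ^+ 2 * `|x0 - x0| ^+ 2 by rewrite subrr normr0 expr0n mulr0.
    apply: cvgMr; apply: (@cvg_comp _ _ _ (fun y => `|y - x0|) (fun t => t ^+ 2)); last exact: exprn_continuous.
    by apply: cvg_norm; apply: cvgB; [exact: cvg_id|exact: cvg_cst].
  have [ys Ks hs] := compact_EVT_max (ex_intro _ x0 Kx0) cK cphi.
  rewrite inE in Ks.
  have {}hs y : K y -> phi y <= phi ys by move=> Ky; apply: hs; rewrite inE.
  have [E|ysx] := eqVneq ys x0.
    left=> y Ky; have := hs y Ky.
    rewrite E /phi !Nh !Nw q0 Z0.
    have -> : qnormsq (0 : quat R) = 0 by rewrite /qnormsq /= expr0n /= !addr0.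
    rewrite !mulr0 addr0.
    have [->//|yx] := eqVneq y x0.
    rewrite leNgt => /negP[]; rewrite ltr_wpDl ?mulr_ge0 ?exprn_ge0 ?invr_ge0 ?qnormsq_ge0 //.
    apply: mulr_gt0; first exact: exprn_gt0.
    apply: lt_le_trans (qnormsq_zq_ge x0 y).
    by rewrite exprn_gt0 // normr_gt0 subr_eq0.
  right.
  have hb : phi ys <= (Q + 4) * (r ^+ 2)^-1 ^+ n.+1.
    have [lt|ge] := ltP `|ys - x0| r.
      exfalso.
      pose V := U' `&` ball x0 r.
      have oV : open V by apply: openI => //; exact: ball_open.
      have Vs : V ys.
        split; first by split; [exact: KU|exact/eqP].
        by rewrite -ball_normE /= distrC.
      have crhV : cauchy_riemann V h.
        split=> [j|y [Uy _]]; last exact: crh.2.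
        by apply: Ck_sub (crh.1 j); exact: subIsetl.
      have crwV : cauchy_riemann V w.
        split=> [j|y [[Uy _] _]]; last exact: crw.2.
        by apply: Ck_sub (crw.1 j) => y [[]].
      have KV y : V y -> K y.
        by move=> [_]; rewrite -ball_normE /K /= distrC => /ltW.
      have sh : smooth_on V (fun y => qdot (h y) (h y)) by move=> j; exact: (Ck_qdot oV (crhV.1 j) (crhV.1 j)).
      have sw : smooth_on V (fun y => qdot (w y) (w y)) by move=> j; exact: (Ck_qdot oV (crwV.1 j) (crwV.1 j)).
      have cphi2 : Ck 2 V phi by exact: (CkD oV (sh 2) (sw 2)).
      have mx y : V y -> phi y <= phi ys by move=> /KV; exact: hs.
      have L v : dif (fun y => dif phi y v) ys v <= 0.
        by rewrite dif_fun difE; exact: (second_derivative_at_max v oV Vs cphi2 mx).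
      have SD v : dif (fun y => dif phi y v) ys v =
          dif (fun y => dif (fun z => qdot (h z) (h z)) y v) ys v +
          dif (fun y => dif (fun z => qdot (w z) (w z)) y v) ys v.
        exact: (second_diffD v oV sh sw Vs).
      have A1 := L dir1; rewrite SD in A1.
      have A2 := L dir2; rewrite SD in A2.
      have LW := laplacian_qnormsq oV crwV Vs.
      have w1 : qnormsq (dif w ys dir1) = k ^+ 2.
        rewrite (diffM_at dir1 (diff_zq x0 ys).1 (differentiable_cst (k *: 1 : quat R) ys)).
        rewrite diff_cst_at mulr0 add0r (diff_zq x0 ys).2 qplane_1 mul1r.
        by rewrite /qnormsq qone1 qscaleE /=; ring.
      rewrite w1 in LW.
      apply: (subharmonic_contra A1 A2 (laplacian_qnormsq oV crhV Vs) LW) => //; try exact: qnormsq_ge0.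
      exact: exprn_gt0.
    have dr : `|ys - x0| = r by apply/eqP; rewrite eq_le ge andbT.
    have Zr : r ^+ 2 <= qnormsq (zq x0 ys) by rewrite -dr qnormsq_zq_ge.
    have Zr4 : qnormsq (zq x0 ys) <= 4 * r ^+ 2.
      apply: le_trans (qnormsq_le _) _; rewrite ler_pM2l //.
      apply: lerXn2r; rewrite ?nnegrE ?(ltW r0) // -dr.
      apply/qnorm_le; split; rewrite /= ?normr0 //.
      - by rewrite -[leRHS]/(Num.max `|(ys - x0).1| `|(ys - x0).2|) le_max lexx.
      - by rewrite -[leRHS]/(Num.max `|(ys - x0).1| `|(ys - x0).2|) le_max lexx orbT.
    rewrite /phi Nh Nw mulrDl; apply: lerD; last first.
      apply: (@le_trans _ _ (k ^+ 2 * (4 * r ^+ 2))); first by rewrite ler_wpM2l // sqr_ge0.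
      by rewrite mulrCA k2.
    rewrite mulrC; apply: ler_pM.
    - exact: qnormsq_ge0.
    - by rewrite exprn_ge0 // invr_ge0 qnormsq_ge0.
    - by rewrite -qdotxx; apply: hQ; rewrite inE.
    - apply: lerXn2r; rewrite ?nnegrE ?invr_ge0 ?qnormsq_ge0 ?(ltW rr0) //.
      by rewrite lef_pV2 ?posrE // (lt_le_trans rr0 Zr).
  move=> y Ky; apply: le_trans hb; apply: le_trans (hs y Ky).
  by rewrite /phi Nh lerDl qdotxx qnormsq_ge0.
(* On the square of half-side [r / 3] one has |z|^2 <= 4 (r / 3)^2, hence |z|^2 / r^2 <= 4/9 < 1/2
   and geometric decay in [n]. *)
have r3 : r / 3 <= r by rewrite ler_pdivrMr // ler_pMr // ler1n.
have nK : \forall y \near x0, `|y - x0| <= r / 3.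
  apply/nbhs_ballP; exists (r / 3); first by rewrite /= divr_gt0.
  by move=> y; rewrite -ball_normE /= distrC => /ltW.
have [[n hn]|hn] := pselect (exists n : nat, forall y, K y -> q y = 0).
  apply: filterS nK => y hy; apply: hn; exact: le_trans hy r3.
apply: filterS nK => y hy.
have Ky : K y by exact: le_trans hy r3.
have [->//|yx] := eqVneq y x0.
have Z0' : 0 < qnormsq (zq x0 y).
  apply: lt_le_trans (qnormsq_zq_ge x0 y).
  by rewrite exprn_gt0 // normr_gt0 subr_eq0.
have Q0 : 0 <= Q + 4 by rewrite addr_ge0 // /Q qdotxx qnormsq_ge0.
have Zle : qnormsq (zq x0 y) / r ^+ 2 <= 2^-1.
  rewrite ler_pdivrMr //; apply: le_trans (qnormsq_le _) _.
  have hz : `|zq x0 y| <= r / 3.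
    apply/qnorm_le; move: hy; rewrite -[`|y - x0|]/(Num.max `|(y - x0).1| `|(y - x0).2|) ge_max => /andP[h1 h2].
    by split; [exact: h1|exact: h2| |]; rewrite -[leLHS]/(`|0 : R|) normr0 divr_ge0 ?(ltW r0).
  have : `|zq x0 y| ^+ 2 <= (r / 3) ^+ 2 by apply: lerXn2r; rewrite ?nnegrE ?divr_ge0 ?(ltW r0).
  rewrite expr_div_n => h3; apply: le_trans (ler_wpM2l _ h3) _ => //.
  by have := rr0; lra.
have bnd n : qnormsq (q y) <= (Q + 4) * 2^-1 ^+ n.+1.
  case: (key n) => [h|/(_ y Ky) h]; first by case: hn; exists n.
  have : qnormsq (q y) <= (Q + 4) * (qnormsq (zq x0 y) / r ^+ 2) ^+ n.+1.
    rewrite exprMn -exprVn in h *; rewrite mulrCA -ler_pdivrMl ?exprn_gt0 //.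
    by rewrite -exprVn.
  move=> /le_trans; apply; rewrite ler_wpM2l //.
  by apply: lerXn2r; rewrite ?nnegrE ?divr_ge0 ?invr_ge0 ?(ltW rr0) ?(ltW Z0').
apply/eqP; rewrite -qnormsq_eq0 eq_le qnormsq_ge0 andbT.
have cg : (fun n => (Q + 4) * 2^-1 ^+ n.+1 : R) @ \oo --> (Q + 4) * 0.
  have : (fun n => 2^-1 ^+ n : R) @ \oo --> 0.
    by apply: cvg_expr; rewrite ger0_norm ?invr_ge0 // invf_lt1 // ltr1n.
  by rewrite -cvg_shiftS => cg; exact: (cvgMr cg).
rewrite leNgt; apply/negP => p.
have : \forall n \near \oo, (Q + 4) * 2^-1 ^+ n.+1 < qnormsq (q y).
  by apply: (cvgr_lt _ cg); rewrite mulr0.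
by case=> n _ /(_ n (leqnn n)) /=; rewrite ltNge bnd.
Qed.

End InfiniteOrder.

(** * Calculus on Riemann surfaces *)

Section PlaneMaps.
Context {R : realType}.

Lemma cauchy_riemann_dichotomy (U : set (R * R)) q x0 : open U -> U x0 ->
  cauchy_riemann U q ->
  (\forall y \near x0, q y = 0) \/ (\forall y \near x0^', q y != 0).
Proof.
move=> oU Ux0 crq.
have [h|h] := pselect (forall n, dxn n q x0 = 0).
  by left; exact: infinite_order_zero crq h.
right; have ex : exists n, dxn n q x0 != 0.
  by apply: contrapT => h'; apply: h => n; apply: contrapT => /eqP e; apply: h'; exists n.
have [n qn mn] := ex_minnP ex.
apply: (finite_order_isolated oU Ux0 crq) qn => j jn; apply: contrapT => /eqP /mn.
by rewrite leqNgt jn.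
Qed.

Lemma fst_is_linear : linear (fst : R * R -> R^o). Proof. by []. Qed.
HB.instance Definition _ := GRing.isLinear.Build R (R * R)%type R^o _ (fst : R * R -> R^o) fst_is_linear.
Lemma snd_is_linear : linear (snd : R * R -> R^o). Proof. by []. Qed.
HB.instance Definition _ := GRing.isLinear.Build R (R * R)%type R^o _ (snd : R * R -> R^o) snd_is_linear.

Lemma Ck_fst (V : normedModType R) k (U : set V) (u : V -> R * R) : open U ->
  Ck k U u -> Ck k U (fun x => (u x).1).
Proof.
move=> oU; apply: (@Ck_lin R V (R * R)%type R^o k U u (fst : R * R -> R^o) oU).
by move=> x; exact: cvg_fst.
Qed.

Lemma Ck_snd (V : normedModType R) k (U : set V) (u : V -> R * R) : open U ->
  Ck k U u -> Ck k U (fun x => (u x).2).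
Proof.
move=> oU; apply: (@Ck_lin R V (R * R)%type R^o k U u (snd : R * R -> R^o) oU).
by move=> x; exact: cvg_snd.
Qed.

Lemma diff_comp_at (V V' W : normedModType R) (h : V -> V') (u : V' -> W) x v :
  differentiable h x -> differentiable u (h x) ->
  dif (fun y => u (h y)) x v = dif u (h x) (dif h x v).
Proof. by move=> dh du; rewrite !difE; exact: (congr1 (@^~ v) (diff_comp dh du)). Qed.

(** Expanding the outer derivative in [dir1] and [dir2] writes the derivative of the composite as
    real multiples of composites of one order less, so the induction never meets maps into spaces of
    linear maps. *)
Lemma Ck_comp (W : normedModType R) k (U V : set (R * R)) (h : R * R -> R * R)
    (u : R * R -> W) : open U -> open V -> (forall x, U x -> V (h x)) ->
  Ck k U h -> Ck k V u -> Ck k U (fun x => u (h x)).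
Proof.
move=> oU oV hUV; elim: k u => [|k IH] u.
  move=> ch cu x Ux; apply: (@continuous_comp _ _ _ h u); first exact: ch.
  by apply: cu; exact: hUV.
move=> ch cu; have [dh ch'] := ch; have [du cu'] := cu; split=> [x Ux|w].
  exact: (@differentiable_comp _ _ _ _ h u x (dh x Ux) (du _ (hUV x Ux))).
have c1 := Ck_rscale oU (Ck_fst oU (ch' w)) (IH _ (CkW ch) (cu' dir1)).
have c2 := Ck_rscale oU (Ck_snd oU (ch' w)) (IH _ (CkW ch) (cu' dir2)).
apply: (Ck_ext oU _ (CkD oU c1 c2)) => x; rewrite inE => Ux.
apply: etrans _ (difE (fun y => u (h y)) x w).
by rewrite (diff_comp_at w (dh x Ux) (du _ (hUV x Ux))) [RHS]plane_dirs !difE.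
Qed.

End PlaneMaps.

Section Charts.
Context {R : realType} {T : topologicalType}.
Variable phi : chart R T.
Let Uphi := phi @` chart_dom phi.

Lemma chart_img p : chart_dom phi p -> Uphi (phi p).
Proof. by exists p. Qed.

Lemma chart_invK x : Uphi x -> phi (chart_inv phi x) = x.
Proof. by move=> [p dp <-]; rewrite chart_mapK. Qed.

Lemma chart_inv_cvg p : chart_dom phi p -> chart_inv phi x @[x --> phi p] --> p.
Proof.
move=> dp; have := @chart_inv_continuous _ _ phi.
rewrite continuous_open_subspace; last exact: chart_img_open.
move=> /(_ (phi p)); rewrite inE => /(_ (chart_img dp)).
by rewrite /continuous_at chart_mapK.
Qed.

Lemma chart_map_cvg p : chart_dom phi p -> phi q @[q --> p] --> phi p.
Proof.
move=> dp; have := @chart_map_continuous _ _ phi.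
rewrite continuous_open_subspace; last exact: chart_dom_open.
by move=> /(_ p); rewrite inE => /(_ dp).
Qed.

Lemma near_chart p : chart_dom phi p -> \forall q \near p, chart_dom phi q.
Proof. by move=> dp; apply: open_nbhs_nbhs; split=> //; exact: chart_dom_open. Qed.

Lemma near_chart_img p : chart_dom phi p -> \forall x \near phi p, Uphi x.
Proof.
move=> dp; apply: open_nbhs_nbhs; split; [exact: chart_img_open|exact: chart_img].
Qed.

Lemma near_chart_inv (P : set T) p : chart_dom phi p ->
  (\forall q \near p, P q) <-> (\forall x \near phi p, P (chart_inv phi x)).
Proof.
move=> dp; split=> [h|h]; first exact: (chart_inv_cvg dp h).
have := chart_map_cvg dp h; apply: filterS2 (near_chart dp) => q dq /=.
by rewrite chart_mapK.
Qed.

Lemma near_punctured (X : topologicalType) (P : set X) (x : X) :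
  (\forall y \near x^', P y) = (\forall y \near x, y != x -> P y).
Proof. by []. Qed.

Lemma near_chart_inv_punctured (P : set T) p : chart_dom phi p ->
  (\forall q \near p^', P q) <-> (\forall x \near (phi p)^', P (chart_inv phi x)).
Proof.
move=> dp; rewrite !near_punctured.
have hp := near_chart_inv (fun q => q != p -> P q) dp.
split=> [/hp|] h; [|apply/hp]; apply: filterS2 (near_chart_img dp) h => x Ux h xp; apply: h.
  by apply: contraNN xp => /eqP <-; rewrite chart_invK.
by apply: contraNN xp => /eqP ->; rewrite chart_mapK.
Qed.

(** A surface has no isolated point: moving by [e / 2] in the first coordinate of the chart leaves
    [p]. *)
Lemma punctured_ex (P : set T) p : chart_dom phi p ->
  (\forall q \near p^', P q) -> exists2 q, P q & q != p.
Proof.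
move=> dp; rewrite near_punctured => h.
have : \forall x \near phi p, Uphi x /\ (chart_inv phi x != p -> P (chart_inv phi x)).
  by apply: filterI; [exact: near_chart_img|exact/(near_chart_inv (fun q => q != p -> P q) dp)].
move=> /nbhs_ballP[e /= e0 he].
pose x := phi p + ((e / 2, 0) : R * R).
have bx : ball (phi p) e x.
  rewrite -ball_normE /= opprD addNKr normrN.
  rewrite -[`|_|]/(Num.max `|e / 2| `|0 : R|) normr0 gt_max e0 andbT.
  by rewrite gtr0_norm ?divr_gt0 // ltr_pdivrMr // ltr_pMr // ltr1n.
have [Ux Px] := he x bx.
have ne : chart_inv phi x != p.
  apply/eqP => E; have := chart_invK Ux; rewrite E => /esym/eqP.
  rewrite -subr_eq0 /x addrAC subrr add0r => /eqP[] /eqP.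
  by rewrite mulf_eq0 invr_eq0 pnatr_eq0 orbF gt_eqF.
by exists (chart_inv phi x) => //; exact: Px.
Qed.

Lemma open_chart_img (A : set T) : open A -> open (phi @` (chart_dom phi `&` A)).
Proof.
move=> oA; have -> : phi @` (chart_dom phi `&` A) = Uphi `&` [set x | A (chart_inv phi x)].
  apply/seteqP; split=> [x [p [dp Ap] <-]|x [[p dp <-] /= h]].
    by split; [exact: chart_img|rewrite /= chart_mapK].
  by exists p => //; split=> //; rewrite chart_mapK in h.
rewrite openE => x [[p dp <-] /= Ap]; apply: filterI; first exact: near_chart_img.
apply/(near_chart_inv A dp); rewrite chart_mapK // in Ap.
by apply: open_nbhs_nbhs.
Qed.

End Charts.

(* Sealed like [dif], for the same reason. *)
HB.lock Definition sdif (R : realType) (S : riemann_surface R) (f : S -> quat R)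
    (X : tangent S) : quat R := D f X.

Section SurfaceCalculus.
Context {R : realType} {S : riemann_surface R}.
Implicit Types (f g : S -> quat R) (X : tangent S) (phi : chart R S).

Lemma sdifE f X : sdif f X = D f X.
Proof. by rewrite sdif.unlock. Qed.

Lemma sdif_dif f X :
  sdif f X = dif (f \o chart_inv (tchart X)) (tchart X (base X)) (tcoord X).
Proof. by rewrite sdifE difE. Qed.

Lemma smooth_chart_diff f X : smooth f ->
  differentiable (f \o chart_inv (tchart X)) (tchart X (base X)).
Proof.
move=> sf; have := sf _ (tchart_atlas X) => /smooth_diff; apply.
exact: chart_img (tchart_dom X).
Qed.

Lemma smooth_cst (c : quat R) : smooth ((fun=> c) : S -> quat R).
Proof. by move=> phi _ k; exact: Ck_cst. Qed.

Lemma smoothD f g : smooth f -> smooth g -> smooth (fun p => f p + g p).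
Proof. by move=> sf sg phi a k; exact: (CkD (@chart_img_open _ _ phi) (sf _ a k) (sg _ a k)). Qed.

Lemma smoothN f : smooth f -> smooth (fun p => - f p).
Proof. by move=> sf phi a k; exact: (CkN (@chart_img_open _ _ phi) (sf _ a k)). Qed.

Lemma smoothM f g : smooth f -> smooth g -> smooth (fun p => f p * g p).
Proof. by move=> sf sg phi a k; exact: (Ck_qmul (@chart_img_open _ _ phi) (sf _ a k) (sg _ a k)). Qed.

Lemma smoothZ (k : R) f : smooth f -> smooth (fun p => k *: f p).
Proof.
move=> sf phi a j; exact: (Ck_rscale (@chart_img_open _ _ phi) (Ck_cst j _ k) (sf _ a j)).
Qed.

Lemma smoothV f : smooth f -> (forall p, f p != 0) -> smooth (fun p => (f p)^-1).
Proof.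
move=> sf f0 phi a k; exact: (Ck_qinv (@chart_img_open _ _ phi) (fun x _ => f0 _) (sf _ a k)).
Qed.

Lemma smooth_qconj f : smooth f -> smooth (fun p => qconj (f p)).
Proof. by move=> sf phi a k; exact: (Ck_qconj (@chart_img_open _ _ phi) (sf _ a k)). Qed.

Lemma sdif_cst (c : quat R) X : sdif ((fun=> c) : S -> quat R) X = 0.
Proof. by rewrite sdif_dif; exact: diff_cst_at. Qed.

Lemma sdif_add f g X : smooth f -> smooth g -> sdif (fun p => f p + g p) X = sdif f X + sdif g X.
Proof.
by move=> sf sg; rewrite !sdif_dif; exact: (diffD_at (tcoord X) (smooth_chart_diff X sf) (smooth_chart_diff X sg)).
Qed.

Lemma sdif_opp f X : smooth f -> sdif (fun p => - f p) X = - sdif f X.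
Proof. by move=> sf; rewrite !sdif_dif; exact: (diffN_at _ (smooth_chart_diff X sf)). Qed.

Lemma sdif_mul f g X : smooth f -> smooth g ->
  sdif (fun p => f p * g p) X = f (base X) * sdif g X + sdif f X * g (base X).
Proof.
move=> sf sg; rewrite !sdif_dif.
have := diffM_at (tcoord X) (smooth_chart_diff X sf) (smooth_chart_diff X sg).
by rewrite /= (chart_mapK (tchart_dom X)).
Qed.

Lemma sdif_scale (k : R) f X : smooth f -> sdif (fun p => k *: f p) X = k *: sdif f X.
Proof.
move=> sf; rewrite !sdifE; exact: (congr1 (@^~ (tcoord X)) (diffZ k (smooth_chart_diff X sf))).
Qed.

Lemma sdif_inv f X : smooth f -> (forall p, f p != 0) ->
  sdif (fun p => (f p)^-1) X = - ((f (base X))^-1 * sdif f X * (f (base X))^-1).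
Proof.
move=> sf f0; rewrite !sdif_dif.
have := diff_qinv_at (tcoord X) (smooth_chart_diff X sf) (f0 _).
by rewrite /= (chart_mapK (tchart_dom X)).
Qed.

Lemma sdif_qconj f X : smooth f -> sdif (fun p => qconj (f p)) X = qconj (sdif f X).
Proof.
move=> sf; rewrite !sdif_dif.
exact: (diff_lin_at (tcoord X) (@qconj_continuous R) (smooth_chart_diff X sf)).
Qed.

Lemma sdif_near f g X : smooth f -> (\forall q \near base X, f q = g q) -> sdif g X = sdif f X.
Proof.
move=> sf /(near_chart_inv (fun q => f q = g q) (tchart_dom X)) e.
rewrite !sdifE; exact: (congr1 (@^~ (tcoord X)) (near_eq_differentiable e (smooth_chart_diff X sf)).2).
Qed.

Lemma sdif_J2 f X : sdif f (tangentJ (tangentJ X)) = - sdif f X.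
Proof.
rewrite !sdifE /D /= -linearN; congr ('d _ _ _).
Qed.

Lemma smooth_cvg f p : smooth f -> f q @[q --> p] --> f p.
Proof.
move=> sf; have [phi a dp] := rs_atlas_cover p.
have c := sf phi a 0 _ (chart_img dp).
have := cvg_comp _ _ (chart_map_cvg dp) c.
rewrite /= chart_mapK // => h; apply: cvg_trans h; apply: near_eq_cvg.
by apply: filterS (near_chart dp) => q dq /=; rewrite chart_mapK.
Qed.

(** The zero set is open by [linear_ode_zero] and closed by continuity, hence everything by
    connectedness. The constant [C] may depend on the point. *)
Lemma linear_ode_dichotomy f : smooth f ->
  (forall p, exists phi U C, [/\ rs_atlas phi, chart_dom phi p, open U, U (phi p) &
     forall x v, U x -> (phi @` chart_dom phi) x ->
       `|dif (f \o chart_inv phi) x v| <= C * `|v| * `|f (chart_inv phi x)|]) ->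
  (exists p, f p = 0) -> forall p, f p = 0.
Proof.
move=> sf le [p0 fp0] p.
have op : open [set p | f p = 0].
  rewrite openE => q /= fq; have [phi [U [C [a dq oU Uq h]]]] := le q.
  apply/(near_chart_inv (fun q => f q = 0) dq).
  pose V := U `&` phi @` chart_dom phi.
  have oV : open V by apply: openI => //; exact: chart_img_open.
  have Vq : V (phi q) by split=> //; exact: chart_img.
  have dV y : V y -> differentiable (f \o chart_inv phi) y.
    by move=> [_ Vy]; exact: smooth_diff (sf phi a) Vy.
  have h' y v : V y -> `|'d (f \o chart_inv phi) y v| <= C * `|v| * `|(f \o chart_inv phi) y|.
    by move=> Vy; have := h y v Vy.1 Vy.2; rewrite difE.
  apply: (linear_ode_zero oV Vq dV h').
  by rewrite /= chart_mapK.
have cl : closed [set p | f p = 0].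
  rewrite -openC openE => q /= /eqP fq.
  have h : \forall r \near q, f r != 0 by apply: near_cvg_neq fq; exact: smooth_cvg.
  by apply: filterS h => r /eqP.
have := @rs_connected _ S [set p | f p = 0].
move=> /(_ (ex_intro _ p0 fp0)) H.
have : [set p | f p = 0] = setT.
  by apply: H; [exists [set p | f p = 0] => //; rewrite setTI|exists [set p | f p = 0] => //; rewrite setTI].
by move=> /seteqP[_ /(_ p I)].
Qed.

Lemma D0_constant f : smooth f -> (forall X, sdif f X = 0) -> forall p q, f p = f q.
Proof.
move=> sf d0 p q; apply/eqP; rewrite -subr_eq0; apply/eqP.
have sg : smooth (fun p => f p + - f q) by apply: smoothD => //; exact: smooth_cst.
apply: (linear_ode_dichotomy sg); last by exists q; rewrite subrr.
move=> r; have [phi a dr] := rs_atlas_cover r.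
exists phi, setT, 0; split=> //; first exact: openT.
move=> x v _ [s ds <-]; rewrite !mul0r normr_le0; apply/eqP.
pose X := Tangent v a ds.
have := sdif_dif (fun p => f p + - f q) X; rewrite /= => <-.
by rewrite (sdif_add _ sf (smooth_cst _)) sdif_cst d0 addr0.
Qed.

End SurfaceCalculus.

Section Pushforward.
Context {R : realType} {S S' : riemann_surface R}.
Variable F : S -> S'.
Hypothesis hF : holomorphic F.
Implicit Types (f : S' -> quat R) (X : tangent S) (psi : chart R S').

Let hrep (phi : chart R S) psi : R * R -> R * R := psi \o F \o chart_inv phi.
Let Urep (phi : chart R S) psi := phi @` (chart_dom phi `&` F @^-1` chart_dom psi).

Lemma open_rep_dom phi psi : open (Urep phi psi).
Proof.
apply: open_chart_img; apply: open_comp => [x _|]; first exact: hF.1.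
exact: chart_dom_open.
Qed.

Lemma rep_smooth phi psi : rs_atlas phi -> rs_atlas psi -> smooth_on (Urep phi psi) (hrep phi psi).
Proof. by move=> a a'; have [] := hF.2 phi psi a a'. Qed.

Lemma rep_factor (W : Type) (f : S' -> W) phi psi :
  {in Urep phi psi, (f \o chart_inv psi) \o hrep phi psi =1 (f \o F) \o chart_inv phi}.
Proof.
move=> x; rewrite inE => -[p [dp dFp] <-]; rewrite /hrep /= chart_mapK //.
by rewrite chart_mapK.
Qed.

Lemma smooth_comp f : smooth f -> smooth (f \o F).
Proof.
move=> sf phi a k; apply: Ck_local => x [p dp <-].
have [psi a' dFp] := rs_atlas_cover (F p).
exists (Urep phi psi); first by exists p.
have c := rep_smooth a a' k; have cf := sf psi a' k.
apply: (Ck_ext (@open_rep_dom phi psi) (@rep_factor _ f phi psi)).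
apply: (Ck_comp (@open_rep_dom phi psi) (@chart_img_open _ _ psi) _ c cf) => y [q [dq dFq] <-].
by rewrite /hrep /= chart_mapK //; exact: chart_img.
Qed.

(** The target chart is an argument because presentations of one tangent vector in two charts are
    distinct terms. *)
Definition pushforward X psi (a : rs_atlas psi) (d : chart_dom psi (F (base X))) : tangent S' :=
  Tangent (dif (hrep (tchart X) psi) (tchart X (base X)) (tcoord X)) a d.

Lemma base_rep X psi : chart_dom psi (F (base X)) -> Urep (tchart X) psi (tchart X (base X)).
Proof. by move=> d; exists (base X) => //; split=> //; exact: tchart_dom. Qed.

Lemma sdif_comp f X psi (a : rs_atlas psi) (d : chart_dom psi (F (base X))) : smooth f ->
  sdif (f \o F) X = sdif f (pushforward a d).
Proof.
move=> sf; rewrite !sdif_dif; have aX := tchart_atlas X; have dX := tchart_dom X.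
have dh := smooth_diff (rep_smooth aX a) (base_rep d).
have E : hrep (tchart X) psi (tchart X (base X)) = psi (F (base X)).
  by rewrite /hrep /= chart_mapK.
have df : differentiable (f \o chart_inv psi) (hrep (tchart X) psi (tchart X (base X))).
  by rewrite E; apply: smooth_diff (sf psi a) _; exact: chart_img.
have dc : differentiable ((f \o chart_inv psi) \o hrep (tchart X) psi) (tchart X (base X)).
  exact: differentiable_comp.
apply: etrans (eq_on_diff (tcoord X) (@open_rep_dom _ psi) (@rep_factor _ f _ psi) (base_rep d) dc) _.
apply: etrans (diff_comp_at (tcoord X) dh df) _.
by rewrite E.
Qed.

Lemma pushforward_J X psi (a : rs_atlas psi) (d : chart_dom psi (F (base X))) :
  @pushforward (tangentJ X) psi a d = tangentJ (pushforward a d).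
Proof.
rewrite /pushforward /tangentJ /=; congr Tangent.
by have [_ h] := hF.2 _ _ (tchart_atlas X) a; rewrite !difE; exact: h (base_rep d).
Qed.

Lemma sdifJ_comp f X psi (a : rs_atlas psi) (d : chart_dom psi (F (base X))) : smooth f ->
  sdif (f \o F) (tangentJ X) = sdif f (tangentJ (pushforward a d)).
Proof.
by move=> sf; rewrite -pushforward_J; exact: (@sdif_comp f (tangentJ X)).
Qed.

Lemma pushforward_ex X : exists psi (a : rs_atlas psi) (d : chart_dom psi (F (base X))), True.
Proof. by have [psi a d] := rs_atlas_cover (F (base X)); exists psi, a, d. Qed.

(* The coordinate expression of [F], read in [C] inside the quaternions. *)
Lemma rep_cauchy_riemann phi psi : rs_atlas phi -> rs_atlas psi ->
  cauchy_riemann (Urep phi psi) (fun x => qplane (hrep phi psi x)).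
Proof.
move=> a a'; have s := rep_smooth a a'; split=> [k|x Ux].
  exact: (Ck_lin (@open_rep_dom phi psi) qplane_continuous (s k)).
have dh := smooth_diff s Ux.
have E v : dif (fun x => qplane (hrep phi psi x)) x v = qplane (dif (hrep phi psi) x v).
  exact: (diff_lin_at _ qplane_continuous dh).
rewrite !E -rotJ_dir1.
have [_ h] := hF.2 _ _ a a'.
have -> : dif (hrep phi psi) x (rotJ dir1) = rotJ (dif (hrep phi psi) x dir1).
  by rewrite !difE; exact: h.
by rewrite qmulE /rotJ /qplane /qi /=; apply: quatP => /=; ring.
Qed.

Lemma rep_onto phi psi x v : rs_atlas phi -> rs_atlas psi -> Urep phi psi x ->
  dif (fun x => qplane (hrep phi psi x)) x dir1 != 0 ->
  exists w, dif (hrep phi psi) x w = v.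
Proof.
move=> a a' Ux; have dh := smooth_diff (rep_smooth a a') Ux.
have -> : dif (fun x => qplane (hrep phi psi x)) x dir1 = qplane (dif (hrep phi psi) x dir1).
  exact: (diff_lin_at _ qplane_continuous dh).
have J : dif (hrep phi psi) x dir2 = rotJ (dif (hrep phi psi) x dir1).
  rewrite -rotJ_dir1.
  by have [_ h] := hF.2 _ _ a a'; rewrite !difE; exact: h.
have L w : dif (hrep phi psi) x w = w.1 *: dif (hrep phi psi) x dir1 + w.2 *: dif (hrep phi psi) x dir2.
  exact: plane_dirs.
rewrite J in L; move: (dif (hrep phi psi) x dir1) L => [c d] L; case: v => v1 v2.
rewrite -qnormsq_eq0 /qnormsq /qplane /= expr0n /= !addr0 => n0.
(* The derivative is multiplication by the complex number c + i d; the witness is v / (c + i d). *)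
exists ((c * v1 + d * v2) / (c ^+ 2 + d ^+ 2), (c * v2 - d * v1) / (c ^+ 2 + d ^+ 2)).
rewrite L /rotJ /=.
rewrite -[LHS]/((c * v1 + d * v2) / (c ^+ 2 + d ^+ 2) * c + (c * v2 - d * v1) / (c ^+ 2 + d ^+ 2) * - d,
  (c * v1 + d * v2) / (c ^+ 2 + d ^+ 2) * d + (c * v2 - d * v1) / (c ^+ 2 + d ^+ 2) * c).
by congr (_, _); field.
Qed.

End Pushforward.

Section Rechart.
Context {R : realType} {S : riemann_surface R}.
Implicit Types (X : tangent S).

Lemma holomorphic_id : holomorphic (@id S).
Proof. by split=> [x|phi psi a a']; [exact: cvg_id|exact: rs_atlas_holomorphic]. Qed.

(** A change of chart is the pushforward along the identity, which is holomorphic by the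
    compatibility of the atlas. The vector [v] serves all [f] at once. *)
Lemma rechart X phi (a : rs_atlas phi) (d : chart_dom phi (base X)) :
  exists v, forall f : S -> quat R, smooth f -> sdif f X = sdif f (Tangent v a d).
Proof.
by eexists => f sf; exact: (sdif_comp holomorphic_id a d sf).
Qed.

End Rechart.

(** * CMC data and their pull-back to the universal cover *)

Section CmcData.
Context {R : realType} {S : riemann_surface R}.
Implicit Types (X : tangent S) (f N : S -> quat R).

Definition immersed_off_points f : Prop :=
  forall p : S, \forall q \near p^', exists2 X : tangent S, base X = q & sdif f X != 0.

(** [cmc_surface] flattened for rewriting: the two normals are merged, [n ^+ 2] becomes a product,
    and [D] is replaced by the sealed [sdif]. *)
Record cmc_data f N : Prop := CmcData {
  cmc_im : forall p, qre (f p) = 0;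
  cmc_smooth : smooth f;
  cmc_smoothN : smooth N;
  cmc_N2 : forall p, N p * N p = -1;
  cmc_N0 : forall p, qre (N p) = 0;
  cmc_left : forall X, sdif f (tangentJ X) = N (base X) * sdif f X;
  cmc_right : forall X, sdif f (tangentJ X) = - (sdif f X * N (base X));
  cmc_branch : immersed_off_points f;
  cmc_H1 : forall X,
    sdif f X = - (2^-1 *: (sdif N X - N (base X) * sdif N (tangentJ X)));
  cmc_nosphere : ~ round_sphere f }.

Lemma cmc_surfaceP f N : cmc_surface f N <-> cmc_data f N.
Proof.
split=> [[re [[sf sN _] S2N l r br] H ns]|[re sf sN N2 N0 l r br H ns]].
- split=> //.
  + by move=> p; have [[_]] := S2N p.
  + by move=> p; have [[]] := S2N p.
  + by move=> X; rewrite !sdifE; exact: l.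
  + by move=> X; rewrite !sdifE; exact: r.
  + move=> p; apply: filterS (br p) => q [X bX h]; exists X => //; rewrite sdifE //.
  + by move=> X; rewrite !sdifE; exact: H.
- split=> //; last by move=> X; have := H X; rewrite !sdifE.
  split=> //.
  + by move=> p; split; split; [exact: N0|exact: N2|exact: N0|exact: N2].
  + by move=> X; have := l X; rewrite !sdifE.
  + by move=> X; have := r X; rewrite !sdifE.
  + by move=> p; apply: filterS (br p) => q [X bX h]; exists X => //; rewrite -sdifE.
Qed.

End CmcData.

Section Pullback.
Context {R : realType} {M Mt : riemann_surface R}.
Variable pr : Mt -> M.
Hypothesis hpr : universal_cover pr.

Let hol : holomorphic pr. Proof. by case: hpr. Qed.

Lemma covering_surj p : exists q, pr q = p.
Proof.
have [_ [_ /(_ p)[U [oU Up [sheets [[V sV] _ _ hV]]]]] _] := hpr.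
have [_ [VU _]] := hV V sV.
by have := Up; rewrite -VU => -[q _ <-]; exists q.
Qed.

Lemma covering_locally_injective q : \forall r \near q, pr r = pr q -> r = q.
Proof.
have [_ [_ /(_ (pr q))[U [oU Uq [sheets [_ E _ hV]]]]] _] := hpr.
have : (pr @^-1` U) q by [].
rewrite E => -[V sV Vq]; have [oV [_ [s [_ sK]]]] := hV V sV.
have : \forall r \near q, V r by exact: open_nbhs_nbhs.
by apply: filterS => r Vr e; rewrite -(sK r Vr) e sK.
Qed.

(** By the dichotomy for the complex derivative of the coordinate expression, the alternative is
    that it vanishes near [q]. The covering would then be constant near [q], against local
    injectivity, as [q] is not isolated. *)
Lemma covering_unramified q : \forall r \near q^', exists phi psi,
  [/\ rs_atlas phi, rs_atlas psi, chart_dom phi r, chart_dom psi (pr r) &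
   dif (fun x => qplane ((psi \o pr \o chart_inv phi) x)) (phi r) dir1 != 0].
Proof.
have [phi a dq] := rs_atlas_cover q; have [psi a' dFq] := rs_atlas_cover (pr q).
pose h := psi \o pr \o chart_inv phi; pose u x := qplane (h x).
set U := phi @` (chart_dom phi `&` pr @^-1` chart_dom psi).
have oU : open U by exact: (open_rep_dom hol).
have Uq : U (phi q) by exists q.
have cru : cauchy_riemann U u by exact: rep_cauchy_riemann.
have [h0|h1] := cauchy_riemann_dichotomy oU Uq (cauchy_riemann_dx oU cru); last first.
  have n1 : \forall r \near q^', dif u (phi r) dir1 != 0.
    apply/(near_chart_inv_punctured (fun r => dif u (phi r) dir1 != 0) dq).
    rewrite near_punctured; rewrite near_punctured in h1.
    apply: filterS2 h1 (near_chart_img dq) => x hx Ix xq.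
    by rewrite chart_invK //; exact: hx.
  rewrite near_punctured; rewrite near_punctured in n1.
  have n2 : \forall r \near q, chart_dom psi (pr r).
    have /hol.1 := near_chart dFq; exact.
  apply: filterS3 n1 n2 (near_chart dq) => r hr dr dr' rq.
  by exists phi, psi; split=> //; exact: hr.
exfalso.
have /nbhs_ballP[e /= e0 he] : \forall x \near phi q, U x /\ dif u x dir1 = 0.
  by apply: filterI h0; exact: open_nbhs_nbhs.
pose c := u (phi q).
have nu : \forall x \near phi q, u x - c = 0.
  have ob : open (ball (phi q) e) by exact: ball_open.
  have bq : ball (phi q) e (phi q) by exact: ballxx.
  have du x : ball (phi q) e x -> differentiable u x.
    by move=> /he[Ux _]; exact: smooth_diff cru.1 Ux.
  apply: (linear_ode_zero (C := 0) ob bq) => [x bx|x v bx|]; last by rewrite subrr.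
    by apply: differentiableB; [exact: du|exact: differentiable_cst].
  rewrite -difE !mul0r normr_le0; apply/eqP.
  apply: etrans (diffD_at v (du x bx) (differentiable_cst (- c) x)) _.
  have [Ux d0] := he x bx; rewrite diff_cst_at addr0; apply/eqP.
  rewrite -normr_le0; apply: le_trans (cauchy_riemann_bound v cru Ux) _.
  by rewrite d0 normr0 mulr0.
have hU : \forall x \near phi q, U x by exact: open_nbhs_nbhs.
have nr : \forall x \near phi q, pr (chart_inv phi x) = pr q.
  apply: filterS2 nu hU => x hx [r [dr dFr] xE].
  have {hx} : u x = c by apply/eqP; rewrite -subr_eq0; apply/eqP.
  rewrite -xE /c /u /h /= !chart_mapK // => -[e1 e2].
  have : psi (pr r) = psi (pr q) by move: e1 e2; case: (psi (pr r)) (psi (pr q)) => [? ?] [? ?] /= -> ->.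
  by move=> /(congr1 (chart_inv psi)); rewrite !chart_mapK.
have nr' : \forall r \near q, r = q.
  have := nr => /(near_chart_inv (fun r => pr r = pr q) dq).
  by apply: filterS2 (covering_locally_injective q) => r h1 h2; exact: h1.
have : \forall r \near q^', False by rewrite near_punctured; apply: filterS nr' => r -> /eqP.
by move=> /(punctured_ex dq)[].
Qed.

Lemma cmc_pullback f N : cmc_data f N -> cmc_data (f \o pr) (N \o pr).
Proof.
move=> [re sf sN N2 N0 left right br cmc ns].
apply: CmcData.
- by move=> p; exact: re.
- exact: smooth_comp.
- exact: smooth_comp.
- by move=> p; exact: N2.
- by move=> p; exact: N0.
- move=> X; have [psi [a [d _]]] := pushforward_ex pr X.
  by rewrite (sdifJ_comp hol a d sf) (sdif_comp hol a d sf) left.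
- move=> X; have [psi [a [d _]]] := pushforward_ex pr X.
  by rewrite (sdifJ_comp hol a d sf) (sdif_comp hol a d sf) right.
(* Near [q], local injectivity keeps [pr r] away from [pr q], so [f] is immersed at [pr r]; the
   tangent vector found there lifts because the derivative of the covering at [r] is a nonzero
   complex number. *)
- move=> q.
  have n1 : \forall r \near q, pr r != pr q -> exists2 X : tangent M, base X = pr r & sdif f X != 0.
    by have := br (pr q); rewrite near_punctured => /hol.1.
  have n2 := covering_locally_injective q.
  have n3 := covering_unramified q; rewrite near_punctured; rewrite near_punctured in n3.
  apply: filterS3 n1 n2 n3 => r h1 h2 h3 rq.
  have [phi [psi [a a' dr dFr u0]]] := h3 rq.
  have [|X Xr DX] := h1; first by apply: contraNN rq => /eqP /h2 ->.
  have dX : chart_dom psi (base X) by rewrite Xr.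
  have [v hv] := rechart a' dX.
  have Ur : (phi @` (chart_dom phi `&` pr @^-1` chart_dom psi)) (phi r) by exists r.
  have [w hw] := rep_onto hol v a a' Ur u0.
  exists (Tangent w a dr); first exact: erefl.
  rewrite (sdif_comp hol a' (dFr : chart_dom psi (pr (base (Tangent w a dr)))) sf).
  move: DX; rewrite (hv f sf) !sdif_dif /= Xr.
  by have -> : dif (psi \o pr \o chart_inv phi) (phi r) w = v.
- move=> X; have [psi [a [d _]]] := pushforward_ex pr X.
  by rewrite (sdif_comp hol a d sf) (sdif_comp hol a d sN) (sdifJ_comp hol a d sN) cmc.
- move=> [c [r [rc r0 h]]]; apply: ns; exists c, r; split=> // p.
  by have [q <-] := covering_surj p; exact: h.
Qed.

End Pullback.

(** * The Hopf differential and the dual surface *)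

Section UnitImaginary.
Context {R : realType}.
Implicit Types n x y z w : quat R.

Lemma unit_im_mulK n x : n * n = -1 -> n * (n * x) = - x.
Proof. by move=> nn; rewrite mulrA nn mulN1r. Qed.

Lemma unit_im_mulrK n x : n * n = -1 -> x * n * n = - x.
Proof. by move=> nn; rewrite -mulrA nn mulrN1. Qed.

Lemma unit_im_neq0 n : n * n = -1 -> n != 0.
Proof.
move=> nn; apply/eqP => n0; move: nn; rewrite n0 mul0r => /eqP.
by rewrite eq_sym oppr_eq0 oner_eq0.
Qed.

Lemma qreC x y : qre (x * y) = qre (y * x).
Proof. by rewrite /qre !qmulE /=; ring. Qed.

Lemma qreN x : qre (- x) = - qre x. Proof. by []. Qed.
Lemma qreD x y : qre (x + y) = qre x + qre y. Proof. by []. Qed.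

Lemma oppr_self_eq0 (a : R) : a = - a -> a = 0.
Proof. by move=> h; lra. Qed.

Lemma qopp_self_eq0 x : x = - x -> x = 0.
Proof.
move=> /eqP; rewrite -subr_eq0 opprK -mulr2n -scaler_nat scaler_eq0 pnatr_eq0 /=.
by move/eqP.
Qed.

(** From [x = n x n] and invariance of the real part under cyclic permutation,
    [qre x = qre (x n n) = - qre x]. *)
Lemma qre_anticomm n x : n * n = -1 -> n * x = - (x * n) -> qre x = 0.
Proof.
move=> nn nx; apply: oppr_self_eq0.
rewrite -qreN -(unit_im_mulrK x nn) -[x * n]opprK -nx mulNr qreN -mulrA qreC.
by rewrite -mulrA nn mulrN1 qreN !opprK.
Qed.

Lemma anticommM n x : n * x = - (x * n) -> n * (n * x) = - (n * x * n).
Proof. by move=> nx; rewrite [in LHS]nx mulrN mulrA. Qed.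

Lemma anticommN n x : n * x = - (x * n) -> n * (- x) = - (- x * n).
Proof. by move=> nx; rewrite mulrN mulNr nx. Qed.

Lemma qconj_im x : qre x = 0 -> qconj x = - x.
Proof. by move=> h; apply: quatP; rewrite ?qconjE //= -[x.1.1.1]/(qre x) h oppr0. Qed.

Lemma qconjM x y : qconj (x * y) = qconj y * qconj x.
Proof. by rewrite !qmulE !qconjE /=; apply: quatP => /=; ring. Qed.

Lemma qdot_im x y : qre x = 0 -> qdot x y = - qre (x * y).
Proof. by move=> h; rewrite /qdot qconj_im // mulNr. Qed.

Lemma qdot_anticomm n x : n * n = -1 -> qre n = 0 -> n * x = - (x * n) -> qdot n x = 0.
Proof.
move=> nn n0 nx; rewrite qdot_im //; apply/eqP; rewrite oppr_eq0; apply/eqP.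
by apply: oppr_self_eq0; rewrite {1}nx qreN qreC.
Qed.

Lemma qsqr_im x : qre x = 0 -> x * x = (- qnormsq x) *: 1.
Proof.
case: x => [[[a b] c] d]; rewrite /qre /qnormsq /= => ->.
by apply: quatP; rewrite ?qE /=; ring.
Qed.

Lemma qnormsq_unit n : n * n = -1 -> qre n = 0 -> qnormsq n = 1.
Proof.
move=> nn n0; have := qsqr_im n0; rewrite nn.
move=> /(congr1 (fun q : quat R => q.1.1.1)); rewrite qscaleE qone1 /= mulr1.
by move=> h; apply: oppr_inj.
Qed.

Lemma qdotZl (k : R) x y : qdot (k *: x) y = k * qdot x y.
Proof. by rewrite !qdotE !qE /=; ring. Qed.
Lemma qdotDl x y z : qdot (x + y) z = qdot x z + qdot y z.
Proof. by rewrite !qdotE !qE /=; ring. Qed.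
Lemma qdotNl x y : qdot (- x) y = - qdot x y.
Proof. by rewrite !qdotE !qE /=; ring. Qed.

Lemma qdot_isometry n x y : n * n = -1 -> qre n = 0 -> qdot (n * x) (n * y) = qdot x y.
Proof.
move=> nn n0; rewrite /qdot qconjM (qconj_im n0) mulrN mulNr -mulrA.
by rewrite unit_im_mulK // mulrN opprK.
Qed.

(** The quaternions commuting with [n] form the plane spanned by 1 and [n]; the two real parts are
    the coordinates there, up to sign. *)
Lemma comm_im_eq0 n w : n * n = -1 -> qre n = 0 -> w * n = n * w ->
  qre w = 0 -> qre (n * w) = 0 -> w = 0.
Proof.
move=> nn n0 wn w0 nw0.
have : n * w = 0.
  apply: qopp_self_eq0; rewrite -qconj_im // qconjM (qconj_im w0) (qconj_im n0).
  by rewrite mulrNN.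
by move=> h; rewrite -[w]opprK -(unit_im_mulK w nn) h mulr0 oppr0.
Qed.

Lemma qmul_eq0 x y : x * y = 0 -> x != 0 -> y = 0.
Proof.
move=> xy x0; have xu : x \is a GRing.unit by [].
by apply: (mulrI xu); rewrite xy mulr0.
Qed.

Lemma qmul_neq0 x y : x != 0 -> y != 0 -> x * y != 0.
Proof. by move=> x0; apply: contraNN => /eqP /qmul_eq0 -> //. Qed.

End UnitImaginary.

Section HopfDifferential.
Context {R : realType}.
Implicit Types (U : set (R * R)) (F G n : R * R -> quat R).

(* [n dF] and [- n dG] are the rotated differentials, and [dn = dG - dF]. *)
Record cmc_pair U F G n : Prop := CmcPair {
  cp_open : open U;
  cp_smooth : [/\ smooth_on U F, smooth_on U G & smooth_on U n];
  cp_unit : forall x, U x -> n x * n x = -1 /\ qre (n x) = 0;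
  cp_F : forall x, U x -> dif F x dir2 = n x * dif F x dir1 /\
    n x * dif F x dir1 = - (dif F x dir1 * n x);
  cp_G : forall x, U x -> dif G x dir2 = - (n x * dif G x dir1) /\
    n x * dif G x dir1 = - (dif G x dir1 * n x);
  cp_n : forall x v, U x -> dif n x v = dif G x v - dif F x v }.

(** The parallel CMC surface with opposite normal: statements about [F] transfer to [G]. *)
Lemma cmc_pair_dual U F G n : cmc_pair U F G n -> cmc_pair U G F (fun x => - n x).
Proof.
case=> oU [sF sG sn] hn hF hG dn; apply: CmcPair; first exact: oU.
- by split; [exact: sG|exact: sF|move=> k; exact: CkN].
- by move=> x /hn[n2 n0]; rewrite mulrNN n2 qreN n0 oppr0.
- by move=> x /hG[-> e]; rewrite !mulNr e mulrN.
- by move=> x /hF[-> e]; rewrite !mulNr e mulrN opprK.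
- by move=> x v Ux; rewrite (diffN_at v (smooth_diff sn Ux)) (dn x v Ux) opprB.
Qed.

(** Writing F_x as - n F_y and F_y as n F_x cancels the mixed derivatives and leaves n_y F_x - n_x
    F_y. Substituting dn = dG - dF, the dG terms cancel because G_x anticommutes with [n], and the
    dF terms add up. *)
Lemma cmc_pair_laplacian U F G n x : cmc_pair U F G n -> U x ->
  dif (fun y => dif F y dir1) x dir1 + dif (fun y => dif F y dir2) x dir2 =
  (2 * qnormsq (dif F x dir1)) *: n x.
Proof.
case=> oU [sF sG sn] hn hF hG dn Ux.
have dx v := smooth_diff (smooth_dif v sF) Ux; have nx := smooth_diff sn Ux.
have [nn n0] := hn x Ux; have [Fy Fa] := hF x Ux; have [Gy Ga] := hG x Ux.
have e1 : {in U, (fun y => - (n y * dif F y dir2)) =1 (fun y => dif F y dir1)}.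
  move=> y; rewrite inE => Uy; rewrite (hF y Uy).1 unit_im_mulK ?opprK //.
  by case: (hn y Uy).
have e2 : {in U, (fun y => n y * dif F y dir1) =1 (fun y => dif F y dir2)}.
  by move=> y; rewrite inE => Uy; rewrite (hF y Uy).1.
have m1 := (diff_qmul nx (dx dir2)).1; have m2 := (diff_qmul nx (dx dir1)).1.
rewrite (eq_on_diff dir1 oU e1 Ux (differentiableN m1)) (diffN_at dir1 m1).
rewrite (diffM_at dir1 nx (dx dir2)).
rewrite (eq_on_diff dir2 oU e2 Ux m2) (diffM_at dir2 nx (dx dir1)).
rewrite (dif_comm dir2 dir1 oU sF Ux) !dn // Gy Fy.
move: (dif (fun y => dif F y dir1) x dir2) => Fxy.
move: (dif F x dir1) (dif G x dir1) (n x) nn Fa Ga => f g m mm fa ga.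
have f0 : qre f = 0 by exact: qre_anticomm mm fa.
rewrite opprD addrACA addNr add0r !mulrBl !mulNr !mulrA.
have -> : f * m = - (m * f) by rewrite fa opprK.
have -> : g * m = - (m * g) by rewrite ga opprK.
rewrite !mulNr -!mulrA (qsqr_im f0) -scalerAr mulr1.
move: (m * (g * f)) (qnormsq f) => w c.
by rewrite !scaleNr !opprK opprD !opprK addrACA subrr add0r -scalerDl mulr_natl mulr2n.
Qed.

(** This is -4 <F_z, G_z> for the complex bilinear extension of the inner product. Since dn = dG -
    dF and <F_z, F_z> = 0 by conformality, it is a multiple of the classical Hopf coefficient <F_z,
    n_z>. *)
Definition hopf F G x : quat R :=
  qplane (qdot (dif F x dir2) (dif G x dir2) - qdot (dif F x dir1) (dif G x dir1),
          qdot (dif F x dir1) (dif G x dir2) + qdot (dif F x dir2) (dif G x dir1)).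

(** The Laplacians of [F] and [G] are multiples of [n], hence orthogonal to the tangential dF and
    dG. With the symmetry of mixed derivatives this makes the Cauchy-Riemann equation an identity
    between inner products. *)
Lemma hopf_cauchy_riemann U F G n : cmc_pair U F G n -> cauchy_riemann U (hopf F G).
Proof.
move=> cp; have [oU [sF sG sn] hn hF hG dn] := cp.
pose A i j y := qdot (dif F y i) (dif G y j).
have sA i j : smooth_on U (A i j).
  by move=> k; exact: (Ck_qdot oU (smooth_dif i sF k) (smooth_dif j sG k)).
have hE : hopf F G = fun y => (A dir2 dir2 y + - A dir1 dir1 y) *: 1 +
    (A dir1 dir2 y + A dir2 dir1 y) *: (qi : quat R).
  by apply/funext => y; apply: quatP; rewrite ?qE /hopf /qi /A /=; ring.
have s1 : smooth_on U (fun y => A dir2 dir2 y + - A dir1 dir1 y).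
  by move=> k; exact: (CkD oU (sA dir2 dir2 k) (CkN oU (sA dir1 dir1 k))).
have s2 : smooth_on U (fun y => A dir1 dir2 y + A dir2 dir1 y).
  by move=> k; exact: (CkD oU (sA dir1 dir2 k) (sA dir2 dir1 k)).
rewrite hE; split=> [k|x Ux].
  exact: (CkD oU (Ck_rscale oU (s1 k) (Ck_cst k U (1 : quat R)))
                 (Ck_rscale oU (s2 k) (Ck_cst k U (qi : quat R)))).
have dA i j := smooth_diff (sA i j) Ux.
have d1 := smooth_diff s1 Ux; have d2 := smooth_diff s2 Ux.
have rs (u : R * R -> R) (c : quat R) v : differentiable u x ->
    differentiable (fun y => u y *: c) x /\ dif (fun y => u y *: c) x v = dif u x v *: c.
  move=> du; have [dd E] := diff_rscale du (differentiable_cst c x).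
  split=> //; rewrite !difE; apply: etrans (congr1 (@^~ v) E) _.
  by rewrite -(difE (fun=> c) x v) diff_cst_at scaler0 add0r.
have EE v : dif (fun y => (A dir2 dir2 y + - A dir1 dir1 y) *: 1 +
    (A dir1 dir2 y + A dir2 dir1 y) *: (qi : quat R)) x v =
   (dif (A dir2 dir2) x v - dif (A dir1 dir1) x v) *: 1 +
   (dif (A dir1 dir2) x v + dif (A dir2 dir1) x v) *: (qi : quat R).
  rewrite (diffD_at v (rs _ 1 v d1).1 (rs _ qi v d2).1) (rs _ 1 v d1).2 (rs _ qi v d2).2.
  rewrite (diffD_at v (dA dir2 dir2) (differentiableN (dA dir1 dir1))) (diffN_at v (dA dir1 dir1)).
  by rewrite (diffD_at v (dA dir1 dir2) (dA dir2 dir1)).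
have dAE i j v : dif (A i j) x v = qdot (dif F x i) (dif (fun y => dif G y j) x v) +
    qdot (dif (fun y => dif F y i) x v) (dif G x j).
  exact: (diff_qdot_at v (smooth_diff (smooth_dif i sF) Ux) (smooth_diff (smooth_dif j sG) Ux)).2.
rewrite !EE !dAE (dif_comm dir2 dir1 oU sF Ux) (dif_comm dir2 dir1 oU sG Ux).
have LF := cmc_pair_laplacian cp Ux.
have LG := cmc_pair_laplacian (cmc_pair_dual cp) Ux.
have [nn n0] := hn x Ux; have [Fy Fa] := hF x Ux; have [Gy Ga] := hG x Ux.
have oF v : v = dir1 \/ v = dir2 -> qdot (n x) (dif F x v) = 0.
  case=> ->; apply: (qdot_anticomm nn n0); first exact: Fa.
  by rewrite Fy; exact: anticommM.
have oG v : v = dir1 \/ v = dir2 -> qdot (n x) (dif G x v) = 0.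
  case=> ->; apply: (qdot_anticomm nn n0); first exact: Ga.
  by rewrite Gy; apply: anticommN; exact: anticommM.
have KF v : v = dir1 \/ v = dir2 -> qdot (dif (fun y => dif F y dir1) x dir1) (dif G x v) =
    - qdot (dif (fun y => dif F y dir2) x dir2) (dif G x v).
  by move=> hv; apply/eqP; rewrite -addr_eq0 -qdotDl LF qdotZl oG // mulr0.
have KG v : v = dir1 \/ v = dir2 -> qdot (dif F x v) (dif (fun y => dif G y dir1) x dir1) =
    - qdot (dif F x v) (dif (fun y => dif G y dir2) x dir2).
  move=> hv; rewrite !(qdotC (dif F x v)).
  by apply/eqP; rewrite -addr_eq0 -qdotDl LG qdotZl qdotNl oF // oppr0 mulr0.
have v1 : @dir1 R = dir1 \/ @dir1 R = dir2 by left.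
have v2 : @dir2 R = dir1 \/ @dir2 R = dir2 by right.
rewrite (KF _ v1) (KF _ v2) (KG _ v1) (KG _ v2).
move: (qdot _ _) (qdot _ _) (qdot _ _) (qdot _ _) (qdot _ _) (qdot _ _) (qdot _ _) (qdot _ _) => a b c d e f g h.
by apply: quatP; rewrite ?qE /qi /=; ring.
Qed.

(** A zero of the Hopf coefficient says that G_x is orthogonal to F_x and to n F_x. The product F_x
    G_x commutes with [n], and these inner products are its coordinates in that plane, so it
    vanishes. *)
Lemma hopf_eq0 U F G n x : cmc_pair U F G n -> U x ->
  (dif G x dir1 = 0 -> hopf F G x = 0) /\
  (hopf F G x = 0 -> dif F x dir1 != 0 -> dif G x dir1 = 0).
Proof.
case=> oU [sF sG sn] hn hF hG dn Ux.
have [nn n0] := hn x Ux; have [Fy Fa] := hF x Ux; have [Gy Ga] := hG x Ux.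
rewrite /hopf Fy Gy; move: (dif F x dir1) (dif G x dir1) Fa Ga => f g fa ga.
split=> [->|].
  by rewrite mulr0 oppr0 !qdotE; apply: quatP; rewrite /qplane ?qE /=; ring.
rewrite [qdot (n x * f) (- _)]qdotNr qdot_isometry // [qdot f (- _)]qdotC qdotNl.
move=> h f0; have [h1 h2] : qdot f g = 0 /\ qdot (n x * f) g = 0.
  have E : qdot (n x * g) f = - qdot (n x * f) g.
    rewrite -(qdot_isometry (n x * f) g nn n0) unit_im_mulK // qdotNl opprK.
    by rewrite qdotC.
  have := congr1 (fun q : quat R => q.1.1.1) h; have := congr1 (fun q : quat R => q.1.1.2) h.
  by rewrite /= E => e1 e2; split; lra.
have f_im : qre f = 0 by exact: qre_anticomm nn fa.
have nf_im : qre (n x * f) = 0.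
  by apply: oppr_self_eq0; rewrite {1}fa qreN qreC.
apply: qmul_eq0 f0; apply: (comm_im_eq0 nn n0).
- have gn : g * n x = - (n x * g) by rewrite ga opprK.
  have fn : f * n x = - (n x * f) by rewrite fa opprK.
  by rewrite -mulrA gn mulrN [in LHS]mulrA fn mulNr opprK mulrA.
- by apply/eqP; rewrite -oppr_eq0 -qdot_im // h1.
- by apply/eqP; rewrite mulrA -oppr_eq0 -qdot_im // h2.
Qed.

End HopfDifferential.

Section DualSurface.
Context {R : realType} {S : riemann_surface R}.
Variables f N : S -> quat R.
Hypothesis hf : cmc_data f N.
Implicit Types (X : tangent S) (p : S).
Let g p := f p + N p.

Let sf := cmc_smooth hf.
Let sN := cmc_smoothN hf.

Lemma dual_smooth : smooth g.
Proof. exact: smoothD. Qed.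

Lemma sdif_dual X : sdif g X = sdif f X + sdif N X.
Proof. exact: sdif_add. Qed.

Lemma sdif_normal X : sdif N X = sdif g X - sdif f X.
Proof. by rewrite sdif_dual addrAC subrr add0r. Qed.

Lemma normal_anticomm X : N (base X) * sdif N X = - (sdif N X * N (base X)).
Proof.
apply/eqP; rewrite -addr_eq0; apply/eqP.
have := sdif_mul X sN sN => <-.
have -> : (fun p => N p * N p) = (fun=> -1) by apply/funext => p; exact: cmc_N2 hf p.
exact: sdif_cst.
Qed.

Lemma cmc_anticomm X : N (base X) * sdif f X = - (sdif f X * N (base X)).
Proof. by rewrite -(cmc_left hf) (cmc_right hf). Qed.

Lemma half_sub (b c : quat R) : - (2^-1 *: (b + c)) + b = 2^-1 *: (c + b) - c.
Proof. by apply: quatP; rewrite ?qE /=; field. Qed.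

(** The H = 1 formula gives dg as half the sum of dN and N times the rotated dN, and applying [J] to
    that expression amounts to multiplying it by - N. *)
Lemma sdif_dual_J X : sdif g (tangentJ X) = - (N (base X) * sdif g X).
Proof.
have nn := cmc_N2 hf (base X).
rewrite !sdif_dual !(cmc_H1 hf) sdif_J2 -[base (tangentJ X)]/(base X).
rewrite mulrDr !mulrN -scalerAr mulrBr unit_im_mulK // !opprK.
move: (N (base X) * sdif N X) (sdif N (tangentJ X)) => c b.
by rewrite half_sub opprD opprK.
Qed.

Lemma dual_anticomm X : N (base X) * sdif g X = - (sdif g X * N (base X)).
Proof.
by rewrite sdif_dual mulrDr mulrDl cmc_anticomm normal_anticomm opprD.
Qed.

Lemma sdif_dual_Jr X : sdif g (tangentJ X) = sdif g X * N (base X).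
Proof. by rewrite sdif_dual_J dual_anticomm opprK. Qed.

Lemma chart_cmc_pair (phi : chart R S) : rs_atlas phi ->
  cmc_pair (phi @` chart_dom phi) (f \o chart_inv phi) (g \o chart_inv phi) (N \o chart_inv phi).
Proof.
move=> a.
have T s (ds : chart_dom phi s) v (h : S -> quat R) :
    dif (h \o chart_inv phi) (phi s) v = sdif h (Tangent v a ds) by rewrite sdif_dif.
have TJ s (ds : chart_dom phi s) (h : S -> quat R) :
    dif (h \o chart_inv phi) (phi s) dir2 = sdif h (tangentJ (Tangent dir1 a ds)).
  by rewrite sdif_dif /= rotJ_dir1.
apply: CmcPair.
- exact: chart_img_open.
- by split; [exact: sf|exact: dual_smooth|exact: sN].
- by move=> x _ /=; rewrite (cmc_N2 hf) (cmc_N0 hf).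
- move=> _ [s ds <-]; rewrite (TJ s ds) (T s ds) /= chart_mapK //.
  by rewrite (cmc_left hf); split=> //; exact: (cmc_anticomm (Tangent dir1 a ds)).
- move=> _ [s ds <-]; rewrite (TJ s ds) (T s ds) /= chart_mapK //.
  by rewrite sdif_dual_J; split=> //; exact: (dual_anticomm (Tangent dir1 a ds)).
- by move=> _ v [s ds <-]; rewrite !(T s ds); exact: sdif_normal.
Qed.

(** The rotation rule determines the differential at [J X] from that at [X], so one vanishing
    direction is enough. *)
Lemma sdif_dir1_eq0 (h : S -> quat R) (phi : chart R S) p (a : rs_atlas phi) (d : chart_dom phi p) :
  smooth h -> (forall X, base X = p -> sdif h (tangentJ X) = - (N p * sdif h X) \/
     sdif h (tangentJ X) = N p * sdif h X) ->
  dif (h \o chart_inv phi) (phi p) dir1 = 0 -> forall X, base X = p -> sdif h X = 0.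
Proof.
move=> sh hJ h0 X bX.
have d' : chart_dom phi (base X) by rewrite bX.
have [v ->] := rechart a d' => //.
rewrite sdif_dif /= bX plane_dirs h0 scaler0 add0r.
suff -> : dif (h \o chart_inv phi) (phi p) dir2 = 0 by rewrite scaler0.
have E : dif (h \o chart_inv phi) (phi p) dir2 = sdif h (tangentJ (Tangent dir1 a d)).
  by rewrite sdif_dif /= rotJ_dir1.
have E0 : sdif h (Tangent dir1 a d) = 0 by rewrite sdif_dif.
by rewrite E; have [|->|->] := hJ (Tangent dir1 a d) => //; rewrite E0 mulr0 ?oppr0.
Qed.

(* Zeros of [dg] are zeros of the Hopf differential. *)
Lemma dual_branch_dichotomy p :
  (\forall q \near p, forall X, base X = q -> sdif g X = 0) \/
  (\forall q \near p^', exists2 X, base X = q & sdif g X != 0).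
Proof.
have [phi a dp] := rs_atlas_cover p.
have cp := chart_cmc_pair a; have oU := cp_open cp.
set F := f \o chart_inv phi in cp; set G := g \o chart_inv phi in cp.
have [h0|h1] := cauchy_riemann_dichotomy oU (chart_img dp) (hopf_cauchy_riemann cp); [left|right].
  have nG : \forall q \near p^', dif G (phi q) dir1 = 0.
    have b := cmc_branch hf p; rewrite near_punctured; rewrite near_punctured in b.
    have h0' := chart_map_cvg dp h0.
    apply: filterS3 b h0' (near_chart dp) => q bq /= hq dq qp.
    apply: (hopf_eq0 cp (chart_img dq)).2 hq _.
    apply/eqP => F0; have [X bX /eqP] := bq qp; apply.
    apply: (sdif_dir1_eq0 a dq sf _ F0 bX) => Y bY; right.
    by rewrite (cmc_left hf) bY.
  (* At [p] itself [df] may vanish, so the Hopf differential gives nothing there; continuity of the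
     derivative of [G] is used instead. *)
  have G0 : dif G (phi p) dir1 = 0.
    apply: contrapT => /eqP n0.
    have sG := smooth_dif dir1 (dual_smooth a).
    have cG : dif G x dir1 @[x --> phi p] --> dif G (phi p) dir1 := sG 0 _ (chart_img dp).
    have n0' : \forall x \near phi p, dif G x dir1 != 0 := near_cvg_neq (FF := nbhs_filter (phi p)) cG n0.
    have n1 := chart_map_cvg dp n0'.
    have : \forall q \near p^', False.
      rewrite near_punctured; rewrite near_punctured in nG.
      by apply: filterS2 nG n1 => q h1 /= /eqP h2 qp; apply: h2; exact: h1.
    by move=> /(punctured_ex dp)[].
  rewrite near_punctured in nG; apply: filterS2 nG (near_chart dp) => q h dq X bX.
  apply: (sdif_dir1_eq0 a dq dual_smooth _ _ bX); last first.
    by have [->|/h] := eqVneq q p.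
  by move=> Y bY; left; rewrite sdif_dual_J bY.
rewrite near_punctured.
have h1' : \forall q \near p^', hopf F G (phi q) != 0.
  apply/(near_chart_inv_punctured (fun q => hopf F G (phi q) != 0) dp).
  rewrite near_punctured; rewrite near_punctured in h1.
  apply: filterS2 h1 (near_chart_img dp) => x hx Ix xq.
  by rewrite chart_invK //; exact: hx.
rewrite near_punctured in h1'; apply: filterS2 h1' (near_chart dp) => q hq dq qp.
exists (Tangent dir1 a dq) => //; apply/eqP; rewrite sdif_dif /= => G0.
by have /eqP := hq qp; apply; exact: (hopf_eq0 cp (chart_img dq)).1.
Qed.

(** The interior of the zero set of dg is open and closed. If it were everything, [g] would be
    constant and [f = g - N] would lie on the unit sphere around that constant. *)
Lemma dual_immersed : immersed_off_points g.
Proof.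
pose A : set S := [set p : S | \forall q \near p, forall X, base X = q -> sdif g X = 0].
have oA : open A.
  by rewrite openE => p /= Ap; exact: (nbhs_interior Ap).
have cA : closed A.
  rewrite -openC openE => p /= nAp.
  have [/nAp//|] := dual_branch_dichotomy p; rewrite near_punctured.
  apply: filterS => q h; have [->//|qp] := eqVneq q p.
  by have [X bX /eqP X0] := h qp; move=> /nbhs_singleton /(_ X bX).
have [[p0 Ap0]|A0] := pselect (A !=set0); last first.
  by move=> p; have [h|//] := dual_branch_dichotomy p; case: A0; exists p.
exfalso; have AT : A = setT.
  apply: (@rs_connected _ S A); first by exists p0.
    by exists A => //; rewrite setTI.
  by exists A => //; rewrite setTI.
have g0 X : sdif g X = 0.
  have : A (base X) by rewrite AT.
  by move=> /nbhs_singleton; apply.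
apply: (cmc_nosphere hf); exists (g p0), 1; split=> // [|p].
  by rewrite /g qreD (cmc_im hf) (cmc_N0 hf) addr0.
rewrite (D0_constant dual_smooth g0 p0 p) /g opprD addrA subrr add0r expr1n.
by apply: qnormsq_unit; rewrite ?mulrNN ?(cmc_N2 hf) // qreN (cmc_N0 hf) oppr0.
Qed.

(** For maps satisfying a rotation rule nonvanishing does not depend on the direction, so the single
    vector [dir1] serves [f] and [g] simultaneously. These are the vectors at which separation by
    rotation is applied. *)
Lemma generic_tangent p : \forall q \near p^', exists X,
  [/\ base X = q, sdif f X != 0 & sdif g X != 0].
Proof.
have h1 := cmc_branch hf p; have h2 := dual_immersed p.
rewrite near_punctured; rewrite near_punctured in h1; rewrite near_punctured in h2.
apply: filterS2 h1 h2 => q h1 h2 qp.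
have [X bX X0] := h1 qp; have [Y bY Y0] := h2 qp.
have [phi a dq] := rs_atlas_cover q.
exists (Tangent dir1 a dq); split; first exact: erefl.
  apply: contraNN X0 => /eqP; rewrite sdif_dif => E; apply/eqP.
  by apply: (sdif_dir1_eq0 a dq sf _ E bX) => Z bZ; right; rewrite (cmc_left hf) bZ.
apply: contraNN Y0 => /eqP; rewrite sdif_dif => E; apply/eqP.
by apply: (sdif_dir1_eq0 a dq dual_smooth _ E bY) => Z bZ; left; rewrite sdif_dual_J bZ.
Qed.

End DualSurface.

Section Density.
Context {R : realType} {S : riemann_surface R}.
Implicit Types (p : S) (Q : set S).

Lemma punctured_exists Q p : (\forall q \near p^', Q q) -> exists2 q, Q q & q != p.
Proof. by have [phi a dp] := rs_atlas_cover p; exact: (punctured_ex dp). Qed.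

Lemma punctured_near_exists Q Q' p : (\forall q \near p^', Q q) -> (\forall q \near p, Q' q) ->
  exists q, Q q /\ Q' q.
Proof.
rewrite near_punctured => h h'.
have : \forall q \near p^', Q q /\ Q' q.
  by rewrite near_punctured; apply: filterS2 h h' => q hq hq' qp; split=> //; exact: hq.
by move=> /punctured_exists[q hq _]; exists q.
Qed.

Lemma smooth_density (u : S -> quat R) p : smooth u ->
  (\forall q \near p^', u q = 0) -> u p = 0.
Proof.
move=> su h; apply: contrapT => /eqP n0.
have h' : \forall q \near p, u q != 0.
  by apply: near_cvg_neq n0; exact: smooth_cvg.
by have [q [-> /eqP]] := punctured_near_exists h h'.
Qed.

End Density.

(** * Darboux transforms *)

Section PairAlgebra.
Context {R : realType}.
Variables s t p q n F G : quat R.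
Hypotheses (st : s * t = 1) (ts : t * s = 1) (pq : p * q = 1) (qp : q * p = 1) (nn : n * n = -1).

Let stK x : x * s * t = x. Proof. by rewrite -mulrA st mulr1. Qed.
Let tsK x : x * t * s = x. Proof. by rewrite -mulrA ts mulr1. Qed.
Let pqK x : x * p * q = x. Proof. by rewrite -mulrA pq mulr1. Qed.
Let qpK x : x * q * p = x. Proof. by rewrite -mulrA qp mulr1. Qed.
Let nnK x : x * n * n = - x. Proof. by rewrite -mulrA nn mulrN1. Qed.

Lemma pair_fh_right : t * (G * n) * q * t = t * G * q * t * (s * p * n * q * t).
Proof. by rewrite !mulrA tsK qpK. Qed.

Lemma pair_fh_left : t * - (n * G) * q * t = - (t * n * s) * (t * G * q * t).
Proof. by rewrite !(mulrN, mulNr) !mulrA stK. Qed.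

Lemma pair_gh_left : s * p * (n * F) * s = s * p * n * q * t * (s * p * F * s).
Proof. by rewrite !mulrA tsK qpK. Qed.

Lemma pair_comm : s * s * p * n = n * (s * s * p) <-> s * p * n * q * t = t * n * s.
Proof.
split=> E; last first.
  have := congr1 (fun x => s * x * s * p) E.
  by rewrite !mulrA tsK qpK st mul1r.
have := congr1 (fun x => t * x * q * t) E.
by rewrite !mulrA ts mul1r pqK stK.
Qed.

Lemma pair_squareal2 : - (t * n * s) * - (t * n * s) = -1.
Proof. by rewrite mulrNN !mulrA stK nnK mulNr ts. Qed.

Lemma pair_squareal_re : qre n = 0 -> qre (- (t * n * s)) = 0.
Proof. by move=> n0; rewrite qreN qreC mulrA st mul1r n0 oppr0. Qed.

(** The conclusion is the hypothesis multiplied on the left by the inverse [t] of [s]. *)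
Lemma pair_criterion_normal : s * n + n * s + s * s * p = 1 -> n + s * p - t = - (t * n * s).
Proof.
move=> E.
have h : t * (s * n + n * s + s * s * p) = t by rewrite E mulr1.
rewrite !mulrDr !mulrA ts !mul1r in h.
by rewrite -[in LHS]h opprD addrA [n + _]addrC -addrA;
   rewrite opprD addrACA; move: (s * p) (t * n * s) => a b; qring.
Qed.

Lemma pair_criterion_comm : s * n + n * s + s * s * p = 1 -> s * s * p * n = n * (s * s * p).
Proof.
move=> E; have Y : s * s * p = 1 - (s * n + n * s) by rewrite -E [X in X - _]addrC addrK.
rewrite Y mulrBl mulrBr mul1r mulr1 mulrDl mulrDr !mulrA nnK.
by rewrite nn mulN1r addrC [X in _ = n - X]addrC addrC.
Qed.

Lemma pair_fh_inv : s * (t * G * q * t) * s * p = G.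
Proof. by rewrite !mulrA st mul1r tsK qpK. Qed.

End PairAlgebra.

Section DarbouxPair.
Context {R : realType} {S : riemann_surface R}.
Variables f N : S -> quat R.
Let g p := f p + N p.
Implicit Types (X : tangent S) (p : S).

(* For solutions [alpha], [beta] of the linear system, [s = beta alpha^-1] and
   [P = alpha rho^-1 alpha^-1]; these two functions determine the transform [f + s^-1]. *)
Record darboux_pair (s P : S -> quat R) : Prop := DarbouxPair {
  pair_s_smooth : smooth s;
  pair_P_smooth : smooth P;
  pair_s_neq0 : forall p, s p != 0;
  pair_P_neq0 : forall p, P p != 0;
  pair_sdif_s : forall X, sdif s X =
    s (base X) * sdif f X * s (base X) - sdif g X * (P (base X))^-1;
  pair_sdif_P : forall X, sdif P X =
    P (base X) * sdif f X * s (base X) - sdif f X * s (base X) * P (base X) }.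

Variables s P : S -> quat R.
Hypotheses (hf : cmc_data f N) (hd : darboux_pair s P).
Let sf := cmc_smooth hf.
Let sN := cmc_smoothN hf.
Let sg : smooth g := dual_smooth hf.
Let ss := pair_s_smooth hd.
Let sP := pair_P_smooth hd.
Let s0 := pair_s_neq0 hd.
Let P0 := pair_P_neq0 hd.
Let ds := pair_sdif_s hd.
Let dP := pair_sdif_P hd.

Let T p := (s p)^-1.
Definition darboux_surface p := f p + (s p)^-1.
(** The candidate for the dual surface: in its differential the dg terms cancel, leaving [s P df s],
    which is rotated from the left by [darboux_right_normal]. *)
Definition darboux_dual p := g p + s p * P p.

Let sT : smooth T. Proof. exact: smoothV. Qed.

Lemma smooth_darboux_surface : smooth darboux_surface. Proof. exact: smoothD. Qed.
Lemma smooth_darboux_dual : smooth darboux_dual. Proof. by apply: smoothD => //; exact: smoothM. Qed.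

Let sK x p : x * s p * (s p)^-1 = x. Proof. by rewrite mulrK //; exact: s0. Qed.
Let PVK x p : x * (P p)^-1 * P p = x. Proof. by rewrite mulrVK //; exact: P0. Qed.
Let sV p : s p * (s p)^-1 = 1. Proof. by rewrite mulrV //; exact: s0. Qed.
Let Vs p : (s p)^-1 * s p = 1. Proof. by rewrite mulVr //; exact: s0. Qed.

Lemma sdif_sV X : sdif T X = T (base X) * sdif g X * (P (base X))^-1 * T (base X) - sdif f X.
Proof.
rewrite /T (sdif_inv X ss s0) ds mulrBr mulrBl opprB !mulrA Vs mul1r.
by rewrite sK.
Qed.

Lemma sdif_darboux_surface X : sdif darboux_surface X = T (base X) * sdif g X * (P (base X))^-1 * T (base X).
Proof. by rewrite (sdif_add X sf sT) sdif_sV addrC subrK. Qed.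

Lemma sdif_darboux_dual X : sdif darboux_dual X = s (base X) * P (base X) * sdif f X * s (base X).
Proof.
rewrite (sdif_add X sg (smoothM ss sP)) (sdif_mul X ss sP) ds dP.
rewrite mulrBr mulrBl !mulrA PVK.
move: (s (base X) * P (base X) * _ * _) (s (base X) * sdif f X * _ * _) => a b.
by rewrite subrKA subrKC.
Qed.

Definition pair_square p := s p * s p * P p.

Lemma smooth_pair_square : smooth pair_square. Proof. by apply: smoothM => //; exact: smoothM. Qed.

Lemma sdif_pair_square X : sdif pair_square X =
  s (base X) * sdif f X * pair_square (base X) + pair_square (base X) * sdif f X * s (base X)
  - sdif g X * (P (base X))^-1 * s (base X) * P (base X) - s (base X) * sdif g X.
Proof.
rewrite (sdif_mul X (smoothM ss ss) sP) (sdif_mul X ss ss) ds dP /pair_square.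
rewrite !(mulrBr, mulrBl, mulrDl, mulrDr) !mulrA PVK.
move: (base X) (sdif f X) (sdif g X) => p F G.
move: (s p * s p * P p * F * s p) (s p * s p * F * s p * P p) => a b.
move: (s p * F * s p * s p * P p) (G / P p * s p * P p) (s p * G) => c d e.
by rewrite addrA subrKA addrC addrA [c - d + a]addrAC.
Qed.

Definition darboux_normal p := - ((s p)^-1 * N p * s p).
(** The sign convention is that the rotated differential is the differential times this normal,
    opposite to that of [conformal_branched_immersion]. Equality of left and right normal therefore
    reads [darboux_right_normal = - darboux_normal]. *)
Definition darboux_right_normal p := s p * P p * N p * (P p)^-1 * (s p)^-1.

Lemma smooth_darboux_normal : smooth darboux_normal.
Proof. by apply: smoothN; apply: smoothM => //; exact: smoothM. Qed.

Let PV p : P p * (P p)^-1 = 1. Proof. by rewrite mulrV //; exact: P0. Qed.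
Let VP p : (P p)^-1 * P p = 1. Proof. by rewrite mulVr //; exact: P0. Qed.

Lemma darboux_normal2 p : darboux_normal p * darboux_normal p = -1.
Proof. exact: (pair_squareal2 (sV p) (Vs p) (cmc_N2 hf p)). Qed.

Lemma darboux_normal_re p : qre (darboux_normal p) = 0.
Proof. exact: (pair_squareal_re (sV p) (cmc_N0 hf p)). Qed.

Lemma sdif_darboux_surface_left X : sdif darboux_surface (tangentJ X) = darboux_normal (base X) * sdif darboux_surface X.
Proof.
rewrite !sdif_darboux_surface (sdif_dual_J hf).
exact: (pair_fh_left _ _ _ (sV (base X))).
Qed.

Lemma sdif_darboux_surface_right X : sdif darboux_surface (tangentJ X) = sdif darboux_surface X * darboux_right_normal (base X).
Proof.
rewrite !sdif_darboux_surface (sdif_dual_Jr hf).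
exact: (pair_fh_right _ _ (Vs (base X)) (VP (base X))).
Qed.

Lemma sdif_darboux_dual_left X : sdif darboux_dual (tangentJ X) = darboux_right_normal (base X) * sdif darboux_dual X.
Proof.
rewrite !sdif_darboux_dual (cmc_left hf).
exact: (pair_gh_left _ _ (Vs (base X)) (VP (base X))).
Qed.

Lemma darboux_right_normal_opp p : pair_square p * N p = N p * pair_square p <-> darboux_right_normal p = - darboux_normal p.
Proof.
rewrite /darboux_normal opprK.
exact: (pair_comm _ (sV p) (Vs p) (PV p) (VP p)).
Qed.

Lemma sdif_darboux_surface_eq0 X : sdif darboux_surface X = 0 -> sdif g X = 0.
Proof.
rewrite sdif_darboux_surface => h.
have := pair_fh_inv (sdif g X) (sV (base X)) (Vs (base X)) (VP (base X)).
by rewrite -/(T (base X)) h mulr0 !mul0r => <-.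
Qed.

End DarbouxPair.

Section RealQuat.
Context {R : realType}.
Implicit Types x y n : quat R.

Lemma qconj_real x : qconj x = x -> x = qre x *: 1.
Proof.
move=> h; apply: quatP; rewrite ?qE ?mulr1 ?mulr0 //.
- by have := congr1 (fun q : quat R => q.1.1.2) h; rewrite qconjE /= => /esym/oppr_self_eq0.
- by have := congr1 (fun q : quat R => q.1.2) h; rewrite qconjE /= => /esym/oppr_self_eq0.
- by have := congr1 (fun q : quat R => q.2) h; rewrite qconjE /= => /esym/oppr_self_eq0.
Qed.

Lemma qreal_comm x y : qconj x = x -> x * y = y * x.
Proof. by move/qconj_real ->; rewrite -scalerAl -scalerAr mul1r mulr1. Qed.

Lemma qadd_self_eq0 x : x + x = 0 -> x = 0.
Proof. by move/eqP; rewrite addr_eq0 => /eqP /qopp_self_eq0. Qed.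

Lemma qmulr_eq0 x y : x * y = 0 -> y != 0 -> x = 0.
Proof. by move=> xy y0; have yu : y \is a GRing.unit by []; rewrite -[x](mulrK yu) xy mul0r. Qed.

(** With [x] = dh, [d] = dn and [d'] the rotated dn, the hypothesis says that h + n is rotated by -
    n; solving it for dh gives the H = 1 formula. *)
Lemma dual_rotation (n x d d' : quat R) : n * n = -1 -> d' + n * x = - (n * (d + x)) ->
  x = - (2^-1 *: (d - n * d')).
Proof.
move=> nn E; have -> : d' = - (n * d) - n * x - n * x.
  by rewrite -opprD -mulrDr -E addrK.
rewrite !mulrBr mulrN !(unit_im_mulK _ nn) !opprK.
by apply: quatP; rewrite ?qE /=; field.
Qed.


End RealQuat.

(** * CMC surfaces recovered from a map and its normal *)

Section CmcFromNormal.
Context {R : realType} {S : riemann_surface R}.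
Variables h n : S -> quat R.
Implicit Types (X : tangent S) (p : S).
Hypotheses (sh : smooth h) (sn : smooth n).
Hypotheses (n2 : forall p, n p * n p = -1) (n0 : forall p, qre (n p) = 0).
Hypothesis hl : forall X, sdif h (tangentJ X) = n (base X) * sdif h X.
Hypothesis hr : forall X, sdif h (tangentJ X) = - (sdif h X * n (base X)).
Hypothesis hd : forall X, sdif n (tangentJ X) + sdif h (tangentJ X) =
  - (n (base X) * (sdif n X + sdif h X)).
Hypothesis him : immersed_off_points h.
Hypothesis hgen : exists X, sdif n X + sdif h X != 0.

Let sdif_h_im X : qre (sdif h X) = 0.
Proof. by apply: (qre_anticomm (n2 (base X))); rewrite -hl hr. Qed.

Let H1 X : sdif h X = - (2^-1 *: (sdif n X - n (base X) * sdif n (tangentJ X))).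
Proof. by apply: (dual_rotation (n2 (base X))); rewrite -hl; exact: hd. Qed.

Let sdif_translate (c : quat R) X : sdif (fun p => h p + c) X = sdif h X.
Proof. by rewrite (sdif_add X sh (smooth_cst c)) sdif_cst addr0. Qed.

(** On a sphere the position [w] relative to the centre commutes with [n], both being normal, so
    [w n] is real with constant square and has zero derivative. Differentiating [w n] at [X] and at
    [J X] then makes the rotated dn satisfy [n dn(J X) = - dn(X)], and the H = 1 formula gives dh =
    - dn everywhere, against [hgen]. *)
Lemma not_in_sphere (c : quat R) (r : R) : 0 < r -> (forall p, qre (h p + c) = 0) ->
  ~ forall p, qnormsq (h p + c) = r ^+ 2.
Proof.
move=> r0 wim hc; pose w p := h p + c.
have sw : smooth w by apply: smoothD => //; exact: smooth_cst.
have dw X : sdif w X = sdif h X by exact: sdif_translate.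
have ww p : w p * w p = (- r ^+ 2) *: 1 by rewrite (qsqr_im (wim p)) hc.
have wd X : w (base X) * sdif h X = - (sdif h X * w (base X)).
  apply/eqP; rewrite -addr_eq0 -dw -(sdif_mul X sw sw); apply/eqP.
  have -> : (fun p => w p * w p) = (fun=> (- r ^+ 2) *: 1) by apply/funext.
  exact: sdif_cst.
have wn p : w p * n p = n p * w p.
  apply/eqP; rewrite -subr_eq0; apply/eqP.
  have sW : smooth (fun p => w p * n p + - (n p * w p)).
    by apply: smoothD; [exact: smoothM|apply: smoothN; exact: smoothM].
  apply: (smooth_density sW); apply: filterS (him p) => q [X <- X0].
  apply: qmulr_eq0 X0; have := wd (tangentJ X); rewrite hl -[base (tangentJ X)]/(base X).
  rewrite mulrBl !mulrA => ->; rewrite -[n _ * w _ * _]mulrA wd mulrN opprK mulrA.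
  by rewrite addrC subrr.
have mr p : qconj (w p * n p) = w p * n p.
  by rewrite qconjM (qconj_im (wim p)) (qconj_im (n0 p)) mulrNN wn.
have m2 p : (w p * n p) * (w p * n p) = (r ^+ 2) *: 1.
  rewrite {1}wn -mulrA [w p * _]mulrA ww -scalerAl mul1r -scalerAr n2.
  by rewrite scaleNr scalerN opprK.
have sm : smooth (fun p => w p * n p) by exact: smoothM.
have m0 p : w p * n p != 0.
  apply/eqP => E; have := m2 p; rewrite E mul0r => /esym/eqP.
  by rewrite scaler_eq0 oner_eq0 orbF expf_eq0 /= gt_eqF.
have dm X : sdif (fun p => w p * n p) X = 0.
  have : sdif (fun p => (w p * n p) * (w p * n p)) X = 0.
    have -> : (fun p => w p * n p * (w p * n p)) = (fun=> (r ^+ 2) *: 1) by apply/funext.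
    exact: sdif_cst.
  rewrite (sdif_mul X sm sm) -(qreal_comm _ (mr _)) => /qadd_self_eq0 /qmul_eq0.
  by apply.
have [X] := hgen; apply/negP; rewrite negbK; apply/eqP.
have e Y : w (base Y) * sdif n Y = - (sdif h Y * n (base Y)).
  by apply/eqP; rewrite -addr_eq0 -(dw Y) -(sdif_mul Y sw sn) dm.
have eX := e X; have eJ := e (tangentJ X).
rewrite hl -[base (tangentJ X)]/(base X) in eJ.
have K : w (base X) * (n (base X) * sdif n (tangentJ X)) = - (w (base X) * sdif n X).
  by rewrite mulrA wn -mulrA eJ eX mulrN !mulrA n2 mulN1r !mulNr.
have w0 : w (base X) != 0.
  by apply: contraNN (m0 (base X)) => /eqP ->; rewrite mul0r.
have nJ : n (base X) * sdif n (tangentJ X) = - sdif n X.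
  apply/eqP; rewrite -addr_eq0; apply/eqP; apply: qmul_eq0 w0.
  by rewrite mulrDr K addNr.
by rewrite (H1 X) nJ opprK; apply: quatP; rewrite ?qE /=; field.
Qed.

(** The differential of [h] anticommutes with [n], so it is imaginary and the real part of [h] is
    constant; [c] removes it. *)
Lemma cmc_data_of_normal : exists c : quat R, cmc_data (fun p => h p + c) n.
Proof.
have sh' : smooth (fun p => h p + qconj (h p)).
  by apply: smoothD => //; exact: smooth_qconj.
have d0 X : sdif (fun p => h p + qconj (h p)) X = 0.
  rewrite (sdif_add X sh (smooth_qconj sh)) (sdif_qconj X sh) (qconj_im (sdif_h_im X)).
  by rewrite subrr.
have [p0 _] := @rs_nonempty _ S.
have re p : qre (h p) = qre (h p0).
  have := congr1 (@qre R) (D0_constant sh' d0 p p0).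
  rewrite !qreD /qre !qconjE /=; lra.
pose c : quat R := - (qre (h p0) *: 1).
have im p : qre (h p + c) = 0.
  by rewrite /c qreD qreN re /qre !qE /= mulr1 subrr.
exists c; split.
- exact: im.
- by apply: smoothD => //; exact: smooth_cst.
- exact: sn.
- exact: n2.
- exact: n0.
- by move=> X; rewrite !sdif_translate; exact: hl.
- by move=> X; rewrite !sdif_translate; exact: hr.
- move=> p; apply: filterS (him p) => q [X bX X0].
  by exists X => //; rewrite sdif_translate.
- by move=> X; rewrite sdif_translate; exact: H1.
- move=> [b [r [b0 r0 hb]]]; apply: (@not_in_sphere (c - b) r r0) => p.
    by rewrite addrA qreD im qreN b0 subrr.
  by rewrite addrA hb.
Qed.

End CmcFromNormal.

Section CriterionSufficient.
Context {R : realType} {S : riemann_surface R}.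
Variables f N s P : S -> quat R.
Hypotheses (hf : cmc_data f N) (hd : darboux_pair f N s P).
Implicit Types (X : tangent S) (p : S).

(* Says that the dual of the transform differs from it by [darboux_normal]. *)
Definition cmc_criterion : Prop :=
  forall p, s p * N p + N p * s p + pair_square s P p = 1.

Lemma darboux_surface_immersed : immersed_off_points (darboux_surface f s).
Proof.
move=> p; apply: filterS (dual_immersed hf p) => q [X bX X0].
by exists X => //; apply: contraNN X0 => /eqP /(sdif_darboux_surface_eq0 hf hd) ->.
Qed.

Let sV p : s p * (s p)^-1 = 1. Proof. by rewrite mulrV //; exact: (pair_s_neq0 hd). Qed.
Let Vs p : (s p)^-1 * s p = 1. Proof. by rewrite mulVr //; exact: (pair_s_neq0 hd). Qed.

Lemma criterion_cmc : cmc_criterion -> exists c : quat R,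
  cmc_data (fun p => darboux_surface f s p + c) (darboux_normal N s).
Proof.
move=> star.
have sfh := smooth_darboux_surface hf hd; have sNh := smooth_darboux_normal hf hd.
have Rh p : darboux_right_normal N s P p = - darboux_normal N s p.
  apply: (darboux_right_normal_opp hd p).1; exact: (pair_criterion_comm (cmc_N2 hf p) (star p)).
have E X : sdif (darboux_normal N s) X + sdif (darboux_surface f s) X = sdif (darboux_dual f N s P) X.
  rewrite -(sdif_add X sNh sfh); congr (sdif _ X); apply/funext => p.
  rewrite /darboux_normal -(pair_criterion_normal (Vs p) (star p)) /darboux_surface /darboux_dual [f p + _]addrC.
  by rewrite subrKA addrC addrA.
apply: cmc_data_of_normal => //.
- exact: (darboux_normal2 hf hd).
- exact: (darboux_normal_re hf hd).
- exact: (sdif_darboux_surface_left hf hd).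
- by move=> X; rewrite (sdif_darboux_surface_right hf hd) Rh mulrN.
- by move=> X; rewrite !E (sdif_darboux_dual_left hf hd) Rh mulNr.
- exact: darboux_surface_immersed.
(* Round spheres are excluded by a vector where the sum of the two differentials is nonzero: that
   sum is [s P df s]. *)
have [p _] := @rs_nonempty _ S.
have [q [X [_ X0 _]] _] := punctured_exists (generic_tangent hf p).
exists X; rewrite E (sdif_darboux_dual hf hd).
by rewrite !qmul_neq0 //; [exact: (pair_s_neq0 hd)|exact: (pair_P_neq0 hd)|exact: (pair_s_neq0 hd)].
Qed.

End CriterionSufficient.

(** * Necessity of the criterion *)

Section CommutingPlane.
Context {R : realType}.
Variable n : quat R.
Hypotheses (nn : n * n = -1) (n0 : qre n = 0).
Implicit Types x y F G : quat R.

Lemma plane_decomp x : x * n = n * x -> x = qre x *: 1 - qre (n * x) *: n.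
Proof.
move=> xn; have re_n : n.1.1.1 = 0 by [].
have nE : qre (n * n) = -1 by rewrite nn.
apply/eqP; rewrite -subr_eq0; apply/eqP.
apply: (comm_im_eq0 nn n0).
- rewrite !mulrBr !mulrBl -!scalerAl -!scalerAr xn mul1r mulr1 //.
- by rewrite !(qreD, qreN) /qre !qscaleE /= re_n; ring.
rewrite !mulrBr -!scalerAr mulr1 nn !(qreD, qreN).
by rewrite /qre !qscaleE /= re_n; ring.
Qed.

Lemma plane_comm x y : x * n = n * x -> y * n = n * y -> x * y = y * x.
Proof.
move=> /plane_decomp -> yn; move: (qre x) (qre (n * x)) => a b.
by rewrite mulrBl mulrBr -!scalerAl -!scalerAr mul1r mulr1 yn.
Qed.

Lemma plane_conj x : x * n = n * x -> qconj x * n = n * qconj x.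
Proof.
move=> xn; have := congr1 (@qconj R) xn; rewrite !qconjM (qconj_im n0).
by rewrite mulrN mulNr => /oppr_inj.
Qed.

(** On the plane spanned by 1 and [n], moving a factor past something that anticommutes with [n] is
    conjugation. *)
Lemma plane_anticomm x F : x * n = n * x -> n * F = - (F * n) -> F * x = qconj x * F.
Proof.
move=> /plane_decomp -> nF; move: (qre x) (qre (n * x)) => a b.
have -> : qconj (a *: 1 - b *: n) = a *: 1 + b *: n.
  have re_n : n.1.1.1 = 0 by [].
  by apply: quatP; rewrite ?qconjE ?qE /= ?re_n; ring.
rewrite mulrBr mulrDl -!scalerAl -!scalerAr mul1r mulr1 nF.
by rewrite scalerN.
Qed.

Lemma sum_comm x : (x * n + n * x) * n = n * (x * n + n * x).
Proof. by rewrite mulrDl mulrDr unit_im_mulrK // unit_im_mulK // mulrA addrC. Qed.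

(** Up to a left factor [n], the relation at the rotated vector is the original one with the sign of
    the [G] term changed; the two are subtracted. *)
Lemma rotation_separate a b F G : a * n = n * a -> b * n = n * b ->
  a * G + b * F = 0 -> a * - (n * G) + b * (n * F) = 0 -> G != 0 -> a = 0.
Proof.
move=> an bn E; rewrite mulrN !mulrA an bn -!mulrA -mulrN -mulrDr => E' G0.
have {}E' : - (a * G) + b * F = 0 by exact: qmul_eq0 E' (unit_im_neq0 nn).
apply: qmulr_eq0 G0; apply: qadd_self_eq0.
by rewrite -[RHS](subrr 0) -{1}E -E' opprD opprK addrACA subrr addr0.
Qed.

End CommutingPlane.

(** Lets [ring] decide identities that are additive in opaque quaternion monomials: the images under
    an arbitrary additive map are real atoms, and no product is expanded. *)
Lemma quat_additiveP (R : realType) (x y : quat R) :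
  (forall h : {additive quat R -> R}, h x = h y) -> x = y.
Proof.
move=> E.
pose p1 (z : quat R) := z.1.1.1; pose p2 (z : quat R) := z.1.1.2.
pose p3 (z : quat R) := z.1.2; pose p4 (z : quat R) := z.2.
have a1 : zmod_morphism p1 by [].
have a2 : zmod_morphism p2 by [].
have a3 : zmod_morphism p3 by [].
have a4 : zmod_morphism p4 by [].
pose h1 : {additive quat R -> R} := HB.pack p1 (GRing.isZmodMorphism.Build _ _ p1 a1).
pose h2 : {additive quat R -> R} := HB.pack p2 (GRing.isZmodMorphism.Build _ _ p2 a2).
pose h3 : {additive quat R -> R} := HB.pack p3 (GRing.isZmodMorphism.Build _ _ p3 a3).
pose h4 : {additive quat R -> R} := HB.pack p4 (GRing.isZmodMorphism.Build _ _ p4 a4).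
by apply: quatP; [exact: (E h1)|exact: (E h2)|exact: (E h3)|exact: (E h4)].
Qed.

Ltac qabel := let h := fresh "h" in apply: quat_additiveP => h;
  rewrite ?(raddfD h, raddfN h, raddf0 h); ring.

Section CommutingDerivative.
Context {R : realType}.
Variables s t p q n F G m y : quat R.
Hypotheses (mE : m = s * n + n * s) (yE : y = s * s * p).
Hypotheses (st : s * t = 1) (ts : t * s = 1) (pq : p * q = 1) (qp : q * p = 1).
Hypotheses (nn : n * n = -1) (n0 : qre n = 0).
Hypotheses (nF : n * F = - (F * n)) (nG : n * G = - (G * n)).
Hypothesis yn : y * n = n * y.

Let Fn : F * n = - (n * F). Proof. by rewrite nF opprK. Qed.
Let Gn : G * n = - (n * G). Proof. by rewrite nG opprK. Qed.
Let mn : m * n = n * m. Proof. by rewrite mE; exact: sum_comm. Qed.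

(** Since [y (q s p) = s y], the quaternion [q s p] is a conjugate of [s] by [y]. Both [y] and [m]
    lie in the commutative plane of [n], so the conjugation fixes [m]. *)
Lemma conj_sum : q * s * p * n + n * (q * s * p) = m.
Proof.
have yq : q * t * t * y = 1.
  by rewrite yE !mulrA -[q * t * t * s]mulrA ts mulr1 -[q * t * s]mulrA ts mulr1 qp.
have yk : y * (q * s * p) = s * y.
  by rewrite yE !mulrA -[s * s * p * q]mulrA pq mulr1.
have E : y * (q * s * p * n + n * (q * s * p)) = y * m.
  rewrite mulrDr mulrA yk (mulrA y n) yn -[n * y * _]mulrA yk -[s * y * n]mulrA yn.
  rewrite !mulrA -mulrDl -mE; exact: (plane_comm nn n0 mn yn).
by rewrite -[LHS]mul1r -yq -[LHS]mulrA E mulrA yq mul1r.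
Qed.

Let dy := s * F * y + y * F * s - G * q * s * p - s * G.

(** The left side is the derivative of [Y N - N Y], with G - F for dN and [dy] for dY. The right
    side collects it into one coefficient for dg and one for df, both commuting with [n], which is
    the form that [rotation_separate] needs. *)
Lemma comm_derivative :
  y * (G - F) + dy * n - (n * dy + (G - F) * y) =
  ((m + y) - qconj (m + y)) * G + ((y * qconj m - m * qconj y) - (y - qconj y)) * F.
Proof.
have cj : qconj (m + y) = qconj m + qconj y by apply: quatP; rewrite ?qconjE ?qE //=; ring.
have Fy := plane_anticomm nn n0 yn nF; have Gy := plane_anticomm nn n0 yn nG.
have Fm := plane_anticomm nn n0 mn nF; have Gm := plane_anticomm nn n0 mn nG.
have e1 : s * F * y * n - n * (s * F * y) = - (m * qconj y * F).
  rewrite -[s * F * y * n]mulrA yn !mulrA -[s * F * n]mulrA Fn mulrN mulNr.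
  by rewrite -!mulrA Fy mE mulrDl opprD !mulrA.
have e2 : y * F * s * n - n * (y * F * s) = y * qconj m * F.
  rewrite !mulrA -yn -[y * n * F]mulrA nF mulrN mulNr opprK -!mulrA -!mulrDr.
  by rewrite -mE Fm mulrA.
have e3 : G * q * s * p * n - n * (G * q * s * p) = qconj m * G.
  by rewrite !mulrA nG !mulNr opprK -!mulrA -mulrDr -Gm !mulrA -conj_sum !mulrA.
have e4 : s * G * n - n * (s * G) = - (m * G).
  by rewrite -mulrA Gn mulrN mE mulrDl opprD !mulrA.
have -> : dy * n = s * F * y * n + y * F * s * n - G * q * s * p * n - s * G * n.
  by rewrite /dy !mulrBl !mulrDl.
have -> : n * dy = n * (s * F * y) + n * (y * F * s) - n * (G * q * s * p) - n * (s * G).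
  by rewrite /dy !mulrBr !mulrDr.
have {e1} -> : s * F * y * n = n * (s * F * y) - m * qconj y * F.
  by rewrite -e1 addrC subrK.
have {e2} -> : y * F * s * n = n * (y * F * s) + y * qconj m * F.
  by rewrite -e2 addrC subrK.
have {e3} -> : G * q * s * p * n = n * (G * q * s * p) + qconj m * G.
  by rewrite -e3 addrC subrK.
have {e4} -> : s * G * n = n * (s * G) - m * G.
  by rewrite -e4 addrC subrK.
rewrite cj mulrBr !(mulrBl, mulrDl) Gy Fy.
move: (n * (s * F * y)) (n * (y * F * s)) (n * (G * q * s * p)) (n * (s * G)) => a1 a2 a3 a4.
move: (m * qconj y * F) (y * qconj m * F) (qconj m * G) (m * G) (y * G) (y * F) (qconj y * G) (qconj y * F).
move=> b1 b2 b3 b4 b5 b6 b7 b8; qabel.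
Qed.

End CommutingDerivative.

Section TranslateDefect.
Context {R : realType}.
Variables s t p q n F G y b : quat R.
Hypotheses (yE : y = s * s * p) (st : s * t = 1) (ts : t * s = 1) (pq : p * q = 1) (qp : q * p = 1).
Hypotheses (nn : n * n = -1) (n0 : qre n = 0).
Hypotheses (nF : n * F = - (F * n)) (nG : n * G = - (G * n)).
Hypotheses (yn : y * n = n * y) (b_real : qconj b = b) (b_neq0 : b != 0).

(** The hypothesis is the rotation rule for the differential of [s^-1 B], with [b1] and [b2] the
    derivatives of [B] at [X] and [J X]. Multiplying by [s] isolates the derivatives of [B]. *)
Lemma defect_derivative b1 b2 :
  t * b2 + (t * - (n * G) * q * t - n * F) * b = t * n * s * (t * b1 + (t * G * q * t - F) * b) ->
  b2 - n * b1 = (n * G * q * t + n * G * q * t + (s * n * F - n * s * F)) * b.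
Proof.
move=> /(congr1 (fun x => s * x)); rewrite !(mulrDr, mulrDl, mulrBl, mulrBr) !mulrA.
rewrite !(mulrN, mulNr) !mulrA st !mul1r -[n * s * t]mulrA st mulr1.
move: (s * n * F * b) (n * s * F * b) (n * G * q * t * b) (n * b1) => c d e k E.
have {E} -> : b2 = k + (e - d) + e + c by rewrite -E; qabel.
by qabel.
Qed.

(** As [b1], [b2] and [b] are real, the factor in front of [b] commutes with [n]. Its [F] part does
    so anyway, hence so does [G q t]. Now [q t = z s] with [z] the inverse of [y], which commutes
    with [n], while [G] anticommutes with it; this leaves [G z (s n + n s) = 0]. *)
Lemma defect_sum_eq0 b1 b2 : qconj b1 = b1 -> qconj b2 = b2 -> G != 0 ->
  b2 - n * b1 = (n * G * q * t + n * G * q * t + (s * n * F - n * s * F)) * b ->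
  s * n + n * s = 0.
Proof.
move=> r1 r2 G0 E.
have Wn : (n * G * q * t + n * G * q * t + (s * n * F - n * s * F)) * n =
    n * (n * G * q * t + n * G * q * t + (s * n * F - n * s * F)).
  apply/eqP; rewrite -subr_eq0; apply/eqP; apply: qmulr_eq0 b_neq0.
  rewrite mulrBl -!mulrA -(qreal_comm n b_real) !mulrA -E -[n * _ * b]mulrA -E.
  by rewrite mulrBl mulrBr !mulrA (qreal_comm n r2) -[n * b1 * n]mulrA (qreal_comm n r1) mulrA subrr.
have Vn : (s * n * F - n * s * F) * n = n * (s * n * F - n * s * F).
  have Fn : F * n = - (n * F) by rewrite nF opprK.
  rewrite mulrBl mulrBr -!mulrA Fn !mulrN !mulrA nn -[s * n * n]mulrA nn.
  by rewrite mulrN1 !mulNr mul1r !opprK addrC.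
have Un : n * G * q * t * n = n * (n * G * q * t).
  apply/eqP; rewrite -subr_eq0; apply/eqP; apply: qadd_self_eq0.
  move: Wn; rewrite [LHS]mulrDl [RHS]mulrDr Vn => /addIr.
  by rewrite mulrDl mulrDr addrACA -opprD => ->; rewrite subrr.
have {Un} U : G * q * t * n = n * G * q * t.
  have := congr1 (fun x => n * x) Un; rewrite !mulrA nn !mulN1r !mulNr.
  by move=> /oppr_inj.
pose z := q * t * t.
have zy : z * y = 1.
  by rewrite /z yE !mulrA -[q * t * t * s]mulrA ts mulr1 -[q * t * s]mulrA ts mulr1 qp.
have z0 : z != 0.
  by apply/eqP => z0; have /eqP := zy; rewrite z0 mul0r eq_sym oner_eq0.
have zn : z * n = n * z.
  have yz : y * z = 1 by apply/eqP; rewrite -subr_eq0; apply/eqP; apply: qmul_eq0 z0;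
    rewrite mulrBr mulrA zy mul1r mulr1 subrr.
  by rewrite -[RHS]mul1r -zy -[z * y * _]mulrA [y * (n * z)]mulrA yn -[n * y * z]mulrA yz mulr1.
have qt : q * t = z * s by rewrite /z -mulrA ts mulr1.
clearbody z; apply: (@qmul_eq0 _ (G * z)); last exact: qmul_neq0.
have U' : G * z * s * n = n * G * z * s.
  by rewrite -[G * z * s]mulrA -[n * G * z * s]mulrA -qt !mulrA.
rewrite mulrDr !mulrA U' nG !mulNr -[G * z * n]mulrA zn !mulrA.
by rewrite addNr.
Qed.

End TranslateDefect.

Section VanishingSum.
Context {R : realType}.
Variables s t p q n F G : quat R.
Hypotheses (ts : t * s = 1) (pq : p * q = 1) (qp : q * p = 1).
Hypotheses (nF : n * F = - (F * n)) (nG : n * G = - (G * n)).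
Hypotheses (nn : n * n = -1) (m0 : s * n + n * s = 0).

Let sn : s * n = - (n * s). Proof. by apply/eqP; rewrite -addr_eq0 m0. Qed.

(** The second hypothesis is the derivative of [s n + n s]. When [s] anticommutes with [n], [p] and
    [q] commute with it, so [s F s] and [G q] anticommute with it and drop out. *)
Lemma sum_derivative_eq0 : s * s * p * n = n * (s * s * p) ->
  s * (G - F) + (s * F * s - G * q) * n + (n * (s * F * s - G * q) + (G - F) * s) = 0 ->
  s * G + G * s = s * F + F * s.
Proof.
move=> yn.
have ssn : s * s * n = n * s * s.
  by rewrite -mulrA sn mulrN mulrA sn mulNr opprK.
have pn : p * n = n * p.
  have E : s * (s * (p * n)) = s * (s * (n * p)) by rewrite !mulrA ssn yn !mulrA.
  by have := congr1 (fun x => t * (t * x)) E; rewrite ![t * (s * _)]mulrA !ts !mul1r ![t * (s * _)]mulrA !ts !mul1r.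
have qn : q * n = n * q.
  have := congr1 (fun x => q * x * q) pn; rewrite !mulrA qp mul1r => ->.
  by rewrite -!mulrA pq mulr1.
have e1 : s * F * s * n = - (n * (s * F * s)).
  rewrite -mulrA sn mulrN !mulrA; congr (- _).
  by rewrite -[s * F * n]mulrA -[F * n]opprK -nF mulrN [s * (n * F)]mulrA sn !mulNr opprK.
have e2 : G * q * n = - (n * (G * q)).
  by rewrite -mulrA qn !mulrA nG mulNr opprK.
rewrite !(mulrBl, mulrDl, mulrBr, mulrDr) e1 e2.
move: (n * (s * F * s)) (n * (G * q)) (s * G) (G * s) (s * F) (F * s) => a b c d e k E.
apply/eqP; rewrite -subr_eq0 -[X in _ == X]E; apply/eqP.
by qabel.
Qed.

Lemma real_conj y : qconj y = y -> y = s * s * p -> q * s * p = s.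
Proof.
move=> y_real yE; have yt : q * t * t * y = 1.
  by rewrite yE !mulrA -[q * t * t * s]mulrA ts mulr1 -[q * t * s]mulrA ts mulr1 qp.
have E : y * (q * s * p) = y * s.
  rewrite (qreal_comm s y_real) yE !mulrA -[s * s * p * q]mulrA pq mulr1 //.
by rewrite -[LHS]mul1r -yt -mulrA E mulrA yt mul1r.
Qed.

(** With [y] real, [q s p = s], and the equality of the two anticommutators turns the derivative of
    [B] into [(s F + F s) b], likewise at [J X]. These terms account for the whole [F] part of the
    defect equation, leaving twice [n G q t] equal to 0. *)
Lemma derivative_contradiction y b b1 b2 : qconj y = y -> y = s * s * p -> b = 1 - y -> b != 0 ->
  t != 0 ->
  s * G + G * s = s * F + F * s ->
  s * - (n * G) + - (n * G) * s = s * (n * F) + n * F * s ->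
  b1 = - (s * F * y + y * F * s - G * q * s * p - s * G) ->
  b2 = - (s * (n * F) * y + y * (n * F) * s - (- (n * G)) * q * s * p - s * - (n * G)) ->
  b2 - n * b1 = (n * G * q * t + n * G * q * t + (s * n * F - n * s * F)) * b ->
  G = 0.
Proof.
move=> y_real yE bE b0 t0 E E2.
have k := real_conj y_real yE.
have D H K : s * K + K * s = s * H + H * s ->
    - (s * H * y + y * H * s - K * q * s * p - s * K) = (s * H + H * s) * b.
  move=> E'; rewrite -[K * q * s * p]mulrA -[K * q * _]mulrA [q * _]mulrA k.
  have -> : y * H * s = H * s * y by rewrite -mulrA (qreal_comm _ y_real).
  rewrite -[_ - _ - _]addrA -opprD [K * s + _]addrC E' -mulrDl bE mulrBr mulr1.
  by rewrite opprB.
rewrite (D _ _ E) => ->; rewrite (D _ _ E2) => ->.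
rewrite [n * (_ * b)]mulrA -mulrBl => /eqP; rewrite -subr_eq0 -mulrBl => /eqP /qmulr_eq0 /(_ b0).
rewrite mulrDr !mulrA sn !mulNr.
move: (n * s * F) (n * F * s) => c d E'.
have {}E' : n * G * q * t = 0.
  apply: qadd_self_eq0; rewrite -[RHS]oppr0 -E'; qabel.
have t1 x : x * t = 0 -> x = 0 by move=> h; exact: qmulr_eq0 h t0.
have q0 : q != 0.
  by apply/eqP => q0; have /eqP := qp; rewrite q0 mul0r eq_sym oner_eq0.
have n0 : n != 0 by exact: unit_im_neq0 nn.
have := qmulr_eq0 (t1 _ E') q0 => h; exact: qmul_eq0 h n0.
Qed.

End VanishingSum.

Lemma qconj_one (R : realType) : qconj (1 : quat R) = 1.
Proof. by apply: quatP; rewrite ?qconjE ?qone1 //= oppr0. Qed.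

Section CriterionNecessary.
Context {R : realType} {S : riemann_surface R}.
Variables f N s P : S -> quat R.
Hypotheses (hf : cmc_data f N) (hd : darboux_pair f N s P).
Variables (c0 : quat R) (Nh : S -> quat R).
Hypothesis hh : cmc_data (fun p => darboux_surface f s p + c0) Nh.
Implicit Types (X : tangent S) (p : S).
Let g p := f p + N p.
Let sf := cmc_smooth hf.
Let sN := cmc_smoothN hf.
Let sg : smooth g := dual_smooth hf.
Let ss := pair_s_smooth hd.
Let sP := pair_P_smooth hd.
Let sfh : smooth (darboux_surface f s) := smooth_darboux_surface hf hd.
Let sNh : smooth (darboux_normal N s) := smooth_darboux_normal hf hd.
Let sgh : smooth (darboux_dual f N s P) := smooth_darboux_dual hf hd.
Let sY : smooth (pair_square s P) := smooth_pair_square hd.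
Let sV p : s p * (s p)^-1 = 1. Proof. by rewrite mulrV //; exact: (pair_s_neq0 hd). Qed.
Let Vs p : (s p)^-1 * s p = 1. Proof. by rewrite mulVr //; exact: (pair_s_neq0 hd). Qed.
Let PV p : P p * (P p)^-1 = 1. Proof. by rewrite mulrV //; exact: (pair_P_neq0 hd). Qed.
Let VP p : (P p)^-1 * P p = 1. Proof. by rewrite mulVr //; exact: (pair_P_neq0 hd). Qed.
Let nn := cmc_N2 hf.
Let n0 := cmc_N0 hf.
Let nF := cmc_anticomm hf.
Let nG := dual_anticomm hf.

Let sdif_hh X : sdif (fun p => darboux_surface f s p + c0) X = sdif (darboux_surface f s) X.
Proof. by rewrite (sdif_add X sfh (smooth_cst c0)) sdif_cst addr0. Qed.

Let smooth_eq (u v : S -> quat R) : smooth u -> smooth v ->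
  (forall p, \forall q \near p^', u q = v q) -> u = v.
Proof.
move=> su sv e; apply/funext => p; apply/eqP; rewrite -subr_eq0; apply/eqP.
apply: (@smooth_density _ _ (fun p => u p + - v p)).
  by apply: smoothD => //; exact: smoothN.
by apply: filterS (e p) => q ->; rewrite subrr.
Qed.

(** Both are left normals of the same map; they agree wherever its differential is nonzero, and by
    continuity elsewhere. *)
Let NhE : Nh = darboux_normal N s.
Proof.
apply: smooth_eq => //; first exact: cmc_smoothN hh.
move=> p; apply: filterS (darboux_surface_immersed hf hd p) => q [X <- X0].
apply/eqP; rewrite -subr_eq0; apply/eqP; apply: qmulr_eq0 X0.
by rewrite mulrBl -(sdif_darboux_surface_left hf hd) -sdif_hh -(cmc_left hh) sdif_hh subrr.
Qed.

Let RhE p : darboux_right_normal N s P p = - darboux_normal N s p.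
Proof.
suff : darboux_right_normal N s P = fun p => - darboux_normal N s p by move=> ->.
apply: smooth_eq; last first.
- move=> q; apply: filterS (darboux_surface_immersed hf hd q) => r [X <- X0].
  apply/eqP; rewrite -subr_eq0; apply/eqP; apply: qmul_eq0 X0.
  rewrite mulrBr -(sdif_darboux_surface_right hf hd) mulrN -NhE -[in X in _ - - X]sdif_hh.
  by rewrite -(cmc_right hh) sdif_hh subrr.
- exact: smoothN.
have sVs : smooth (fun p => (s p)^-1) by exact: smoothV ss (pair_s_neq0 hd).
have sPV : smooth (fun p => (P p)^-1) by exact: smoothV sP (pair_P_neq0 hd).
exact: smoothM (smoothM (smoothM (smoothM ss sP) sN) sPV) sVs.
Qed.

Let YN p : pair_square s P p * N p = N p * pair_square s P p.
Proof. exact: (darboux_right_normal_opp hd p).2 (RhE p). Qed.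

Let M p := s p * N p + N p * s p.
Let B p := 1 - (M p + pair_square s P p).

Let sM : smooth M. Proof. by apply: smoothD; exact: smoothM. Qed.
Let sB : smooth B.
Proof. by apply: smoothD; [exact: smooth_cst|apply: smoothN; exact: smoothD]. Qed.
Let MN p : M p * N p = N p * M p. Proof. exact: sum_comm. Qed.

Let derivative_YN X :
  let m := M (base X) in let y := pair_square s P (base X) in
  ((m + y) - qconj (m + y)) * sdif g X
  + ((y * qconj m - m * qconj y) - (y - qconj y)) * sdif f X = 0.
Proof.
move=> m y.
have E := comm_derivative (erefl m) (erefl y) (Vs (base X)) (PV (base X)) (VP (base X))
  (nn (base X)) (n0 (base X)) (nF X) (nG X) (YN (base X)).
rewrite -E -(sdif_normal hf X) -[X in X * N _](sdif_pair_square hd X) -[X in N _ * X](sdif_pair_square hd X).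
rewrite -(sdif_mul X sY sN) -(sdif_mul X sN sY) -(sdif_opp X (smoothM sN sY)).
rewrite -(sdif_add X (smoothM sY sN) (smoothN (smoothM sN sY))).
have -> : (fun p => pair_square s P p * N p + - (N p * pair_square s P p)) = fun=> 0.
  by apply/funext => p; rewrite YN subrr.
exact: sdif_cst.
Qed.

(* The equation [derivative_YN] at [X] and at [J X] separates into its [dg] and [df] parts. *)
Let Bconj p : qconj (B p) = B p.
Proof.
apply: (congr1 (@^~ p) (_ : (fun p => qconj (B p)) = B)); apply: smooth_eq => //.
  exact: smooth_qconj.
move=> q; apply: filterS (generic_tangent hf q) => r [X [<- F0 G0]].
have E1 := derivative_YN X; have E2 := derivative_YN (tangentJ X).
rewrite /= (sdif_dual_J hf X) (cmc_left hf X) in E1 E2.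
have [m y] : M (base X) * N (base X) = N (base X) * M (base X) /\
    pair_square s P (base X) * N (base X) = N (base X) * pair_square s P (base X) by split; [exact: MN|exact: YN].
have cm := plane_conj (n0 (base X)) m; have cy := plane_conj (n0 (base X)) y.
have E := rotation_separate (nn (base X)) _ _ E1 E2 G0.
suff E0 : M (base X) + pair_square s P (base X) - qconj (M (base X) + pair_square s P (base X)) = 0.
  by rewrite /B raddfB /= qconj_one; congr (_ - _); apply/eqP; rewrite eq_sym -subr_eq0 E0.
have D x z : x * N (base X) = N (base X) * x -> z * N (base X) = N (base X) * z ->
    (x + z) * N (base X) = N (base X) * (x + z) by rewrite mulrDl mulrDr => -> ->.
have O x : x * N (base X) = N (base X) * x -> - x * N (base X) = N (base X) * - x.
  by rewrite mulNr mulrN => ->.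
have Q x z : x * N (base X) = N (base X) * x -> z * N (base X) = N (base X) * z ->
    (x * z) * N (base X) = N (base X) * (x * z).
  by move=> hx hz; rewrite -mulrA hz mulrA hx mulrA.
apply: E.
  apply: (D _ _); first exact: (D _ _); apply: (O _); apply: (plane_conj (n0 (base X))); exact: (D _ _).
apply: (D _ _); last by apply: (O _); apply: (D _ _) => //; exact: (O _).
by apply: (D _ _); [exact: (Q _ _)|apply: (O _); exact: (Q _ _)].
Qed.

(** The product [s^-1 B] is the difference between [Nh] plus the transform, which is the actual dual
    up to translation, and the candidate [darboux_dual]. Both have differentials rotated by [- Nh],
    hence so has the difference. *)
Let defect_ode X : sdif B (tangentJ X) - N (base X) * sdif B X =
  (N (base X) * sdif g X * (P (base X))^-1 * (s (base X))^-1 +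
   N (base X) * sdif g X * (P (base X))^-1 * (s (base X))^-1 +
   (s (base X) * N (base X) * sdif f X - N (base X) * s (base X) * sdif f X)) * B (base X).
Proof.
have sT : smooth (fun p => (s p)^-1) by exact: smoothV ss (pair_s_neq0 hd).
have E p : darboux_normal N s p + darboux_surface f s p + - darboux_dual f N s P p = (s p)^-1 * B p.
  rewrite /darboux_normal /darboux_surface /darboux_dual /B !mulrBr !mulrDr mulr1 !mulrA Vs !mul1r.
  by move: ((s p)^-1 * N p * s p) ((s p)^-1) (s p * P p) => a b c; rewrite /g; qabel.
have sL : smooth (fun p => darboux_normal N s p + darboux_surface f s p) by exact: smoothD.
have dL X' : sdif (darboux_normal N s) X' + sdif (darboux_surface f s) X' - sdif (darboux_dual f N s P) X' =
   (s (base X'))^-1 * sdif B X' + ((s (base X'))^-1 * sdif g X' * (P (base X'))^-1 * (s (base X'))^-1 - sdif f X') * B (base X').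
  rewrite -(sdif_sV hd) -(sdif_mul X' sT sB) -(sdif_add X' sNh sfh).
  rewrite -(sdif_opp X' sgh) -(sdif_add X' sL (smoothN sgh)); congr (sdif _ X').
  exact/funext.
apply: (defect_derivative (sV (base X))).
have L1 := dL X; have L2 := dL (tangentJ X).
rewrite (sdif_dual_J hf X) (cmc_left hf X) in L2.
rewrite -[base (tangentJ X)]/(base X) in L2.
rewrite -L1 -[LHS]L2.
have J := sdif_dual_J hh X.
rewrite !(sdif_add _ _ (cmc_smoothN hh)) ?NhE ?sdif_hh in J; last 2 first.
- exact: cmc_smooth hh.
- exact: cmc_smooth hh.
have G' := sdif_darboux_dual_left hf hd X; rewrite RhE in G'.
rewrite G' [X in X - _]addrC J /darboux_normal.
move: (sdif _ X) (sdif _ X) (sdif _ X) ((s (base X))^-1 * N (base X) * s (base X)) => a b c d.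
rewrite !(mulrBr, mulrDr, mulNr) !opprK.
by move: (d * a) (d * b) (d * c) => k l w; qabel.
Qed.

Let sdif_B_conj X : qconj (sdif B X) = sdif B X.
Proof. by rewrite -(sdif_qconj X sB); congr (sdif _ X); exact/funext. Qed.

(* At a point with [B <> 0], [defect_ode] makes [dg s] commute with [N]. *)
Let BM p : B p * M p = 0.
Proof.
apply: (@smooth_density _ _ (fun p => B p * M p)); first exact: smoothM.
apply: filterS (generic_tangent hf p) => q [X [<- F0 G0]].
have [->|B0] := eqVneq (B (base X)) 0; first exact: mul0r.
rewrite [M _](_ : _ = 0) ?mulr0 //.
exact: (@defect_sum_eq0 R (s (base X)) (s (base X))^-1 (P (base X)) (P (base X))^-1
  (N (base X)) (sdif f X) (sdif g X) (pair_square s P (base X)) (B (base X)) erefl (Vs (base X))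
  (VP (base X)) (nn (base X)) (nF X) (nG X) (YN (base X)) (Bconj (base X)) B0
  _ _ (sdif_B_conj X) (sdif_B_conj (tangentJ X)) G0 (defect_ode X)).
Qed.

Lemma cmc_implies_criterion : cmc_criterion N s P.
Proof.
suff B0 p : B p = 0.
  by move=> p; apply/eqP; rewrite eq_sym -subr_eq0 -/(M p) -/(B p) B0.
apply: (@smooth_density _ _ B) => //.
apply: filterS (generic_tangent hf p) => q [X [bX F0 G0]].
have [//|B0] := eqVneq (B q) 0; exfalso; move/eqP: G0; apply.
(* [B] stays nonzero near [q], so [BM] makes [M] vanish on a neighbourhood and not only at [q]; this
   is what gives [sdif M = 0] there. *)
have Mq : \forall r \near q, 0 = M r.
  have c : B r @[r --> q] --> B q by exact: smooth_cvg.
  have h : \forall r \near q, B r != 0 := near_cvg_neq (FF := nbhs_filter q) c B0.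
  by apply: filterS h => r /(qmul_eq0 (BM r)).
have M0 : M (base X) = 0 by rewrite bX -(nbhs_singleton Mq).
have dM Z : base Z = q -> sdif M Z = 0.
  move=> bZ; rewrite (sdif_near (smooth_cst 0)) ?sdif_cst // bZ //.
have B0' : B (base X) != 0 by rewrite bX.
have yE : B (base X) = 1 - pair_square s P (base X) by rewrite /B M0 add0r.
have Yc : qconj (pair_square s P (base X)) = pair_square s P (base X).
  have := Bconj (base X); rewrite yE raddfB /= qconj_one.
  by move/addrI/oppr_inj.
have dB Z : base Z = q -> sdif B Z = - (s (base Z) * sdif f Z * pair_square s P (base Z) +
    pair_square s P (base Z) * sdif f Z * s (base Z) - sdif g Z * (P (base Z))^-1 * s (base Z) * P (base Z)
    - s (base Z) * sdif g Z).
  move=> bZ; rewrite -(sdif_pair_square hd) (sdif_add Z (smooth_cst 1) (smoothN (smoothD sM sY))) sdif_cst add0r.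
  by rewrite (sdif_opp Z (smoothD sM sY)) (sdif_add Z sM sY) dM // add0r.
have sG Z : base Z = q -> s (base Z) * sdif g Z + sdif g Z * s (base Z) =
    s (base Z) * sdif f Z + sdif f Z * s (base Z).
  move=> bZ; have M0' : M (base Z) = 0 by rewrite bZ -bX.
  apply: (@sum_derivative_eq0 R (s (base Z)) (s (base Z))^-1 (P (base Z)) (P (base Z))^-1
    (N (base Z)) (sdif f Z) (sdif g Z) (Vs (base Z)) (PV (base Z)) (VP (base Z)) (nF Z) (nG Z)
    M0' (YN (base Z))).
  rewrite -(sdif_normal hf Z) -(pair_sdif_s hd) -(sdif_mul Z ss sN) -(sdif_mul Z sN ss).
  by rewrite -(sdif_add Z (smoothM ss sN) (smoothM sN ss)); exact: dM.
have T0 : (s (base X))^-1 != 0 by rewrite invr_eq0; exact: (pair_s_neq0 hd).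
have d1 := dB X bX; have d2 := dB (tangentJ X) bX.
have g1 := sG X bX; have g2 := sG (tangentJ X) bX.
rewrite (sdif_dual_J hf X) (cmc_left hf X) in d2 g2.
exact: (@derivative_contradiction R (s (base X)) (s (base X))^-1 (P (base X)) (P (base X))^-1
  (N (base X)) (sdif f X) (sdif g X) (Vs (base X)) (PV (base X)) (VP (base X)) (nn (base X)) M0
  (pair_square s P (base X)) (B (base X)) _ _ Yc erefl yE B0' T0 g1 g2 d1 d2 (defect_ode X)).
Qed.

End CriterionNecessary.

(** * Parallel sections *)

Section ComplexQuat.
Context {R : realType}.
Implicit Types (z w : R[i]) (x y : quat R).

Lemma qCD z w : (z + w)%:H = z%:H + w%:H.
Proof. by case: z w => [a b] [c d]; apply: quatP; rewrite ?qE /= ?addr0. Qed.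

Lemma qCN z : (- z)%:H = - z%:H.
Proof. by case: z => [a b]; apply: quatP; rewrite ?qE /= ?oppr0. Qed.

Lemma qCM z w : (z * w)%:H = z%:H * w%:H.
Proof. by case: z w => [a b] [c d]; apply: quatP; rewrite ?qE /=; ring. Qed.

Lemma qC_comm z w : z%:H * w%:H = w%:H * z%:H.
Proof. by rewrite -!qCM mulrC. Qed.

Lemma qC_eq0 z : (z%:H == 0) = (z == 0).
Proof.
apply/eqP/eqP => [|-> //]; case: z => a b h.
by have [-> ->] : a = 0 /\ b = 0 by case: h.
Qed.


End ComplexQuat.

Section QuatNorm.
Context {R : realType}.
Implicit Types x y : quat R.

Lemma qnorm_le_qnormsq x (M : R) : 0 <= M -> qnormsq x <= M ^+ 2 -> `|x| <= M.
Proof.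
move=> M0 h; have le (t : R) : t ^+ 2 <= qnormsq x -> `|t| <= M.
  move=> tx; rewrite -(@ler_pXn2r _ 2) // ?nnegrE // real_normK ?num_real //.
  exact: le_trans tx h.
apply/qnorm_le; case: x {h} le => [[[a b] c] d]; rewrite /qnormsq /= => le.
have ha := sqr_ge0 a; have hb := sqr_ge0 b; have hc := sqr_ge0 c; have hd := sqr_ge0 d.
by split; apply: le; move: ha hb hc hd; move: (_ ^+ 2) (_ ^+ 2) (_ ^+ 2) (_ ^+ 2) => *; lra.
Qed.

Lemma qnorm_mul x y : `|x * y| <= 4 * `|x| * `|y|.
Proof.
apply: qnorm_le_qnormsq; first by rewrite !mulr_ge0.
rewrite qnormsqM; apply: le_trans (_ : (4 * `|x| ^+ 2) * (4 * `|y| ^+ 2) <= _).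
  by apply: ler_pM; rewrite ?qnormsq_ge0 ?qnormsq_le.
by rewrite le_eqVlt; apply/orP; left; apply/eqP; move: `|x| `|y| => a b; ring.
Qed.

End QuatNorm.

Section LinearSystem.
Context {R : realType} {S : riemann_surface R}.
Variables f N : S -> quat R.
Hypothesis hf : cmc_data f N.
Let g p := f p + N p.
Let sf := cmc_smooth hf.
Let sN := cmc_smoothN hf.
Implicit Types (X : tangent S) (p : S).

Lemma quotient_derivative (r al be e F G : quat R) :
  be * - (e * - (F * be) * e) + - (G * al * r) * e = be * e * F * (be * e) - G * (al * r * e).
Proof. by rewrite !(mulrN, mulNr) opprK !mulrA. Qed.

Lemma conjugate_derivative (q al be e F : quat R) : e * al = 1 ->
  al * q * - (e * - (F * be) * e) + - (F * be) * q * e =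
  al * q * e * F * (be * e) - F * (be * e) * (al * q * e).
Proof.
move=> ea; rewrite !(mulrN, mulNr) opprK !mulrA.
by rewrite -[F * be * e * al]mulrA ea mulr1.
Qed.

Lemma rho_pair (r : quat R) (al be : S -> quat R) : r != 0 -> smooth al -> smooth be ->
  (forall X, sdif al X = - (sdif f X * be (base X))) ->
  (forall X, sdif be X = - (sdif g X * al (base X) * r)) ->
  (forall p, al p != 0 /\ be p != 0) ->
  darboux_pair f N (fun p => be p * (al p)^-1) (fun p => al p * r^-1 * (al p)^-1).
Proof.
move=> r0 sa sb da db nz.
have a0 p : al p != 0 by case: (nz p).
have sV := smoothV sa a0.
have V0 p : (al p)^-1 != 0 by rewrite invr_eq0.
have rV0 : r^-1 != 0 by rewrite invr_eq0.
have ea p : (al p)^-1 * al p = 1 by rewrite mulVr //; exact: a0.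
have sar : smooth (fun p => al p * r^-1) := smoothM sa (smooth_cst r^-1).
have PV p : (al p * r^-1 * (al p)^-1)^-1 = al p * r * (al p)^-1.
  have ua : al p \is a GRing.unit by exact: a0.
  have ur : r \is a GRing.unit by [].
  by rewrite invrM ?unitrMl ?unitrV // invrM ?unitrV // !invrK mulrA.
split.
- exact: smoothM.
- exact: smoothM.
- by move=> p; rewrite qmul_neq0 //; case: (nz p).
- by move=> p; rewrite !qmul_neq0.
- move=> X; rewrite (sdif_mul X sb sV) (sdif_inv X sa a0) da db.
  rewrite PV; exact: (@quotient_derivative r (al (base X)) (be (base X)) (al (base X))^-1 (sdif f X) (sdif g X)).
- move=> X; rewrite (sdif_mul X sar sV) (sdif_inv X sa a0) (sdif_mul X sa (smooth_cst _)) sdif_cst da.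
  by rewrite mulr0 add0r; exact: conjugate_derivative.
Qed.

Lemma rho_transform (al be : S -> quat R) p : al p != 0 -> be p != 0 ->
  f p + al p * (be p)^-1 = darboux_surface f (fun p => be p * (al p)^-1) p.
Proof.
move=> a0 b0; have ua : al p \is a GRing.unit by []; have ub : be p \is a GRing.unit by [].
by rewrite /darboux_surface invrM ?unitrV // invrK.
Qed.

End LinearSystem.

Section ParallelAlgebra.
Context {R : realType}.
Variables n c d : quat R.
Hypotheses (nn : n * n = -1) (cd : c * d = d * c) (cdE : c * c + d * d = - (c + c)).

Lemma qdouble_inj (x y : quat R) : x + x = y + y -> x = y.
Proof.
move=> E; apply/eqP; rewrite -subr_eq0; apply/eqP; apply: qadd_self_eq0.
by rewrite addrACA -opprD E subrr.
Qed.

Lemma qhalf_add (x : quat R) : 2^-1 *: x + 2^-1 *: x = x.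
Proof. by rewrite -scalerDl -div1r -splitr scale1r. Qed.

(** Here [c] stands for a - 1 and [d] for b, so [cdE] is a^2 + b^2 = 1. The formula recovers [al]
    from [be]; it yields both the derivative of [be] and its nonvanishing. *)
Lemma parallel_beta (al be : quat R) : be + be = n * al * c + al * d ->
  n * be * c - be * d = al * c.
Proof.
move=> E; apply: qdouble_inj.
have -> : n * be * c - be * d + (n * be * c - be * d) = n * (be + be) * c - (be + be) * d.
  by rewrite mulrDr !mulrDl opprD addrACA.
rewrite E mulrDr !mulrDl !mulrA nn mulN1r !mulNr -[n * al * c * d]mulrA cd !mulrA.
rewrite opprD addrACA addrA.
have -> : al * c + al * c = - (al * (c * c + d * d)) by rewrite cdE mulrN opprK mulrDr.
rewrite mulrDr !mulrA.
by move: (al * c * c) (n * al * d * c) (al * d * d) => x y z; qabel.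
Qed.

End ParallelAlgebra.

Section Parallel.
Context {R : realType} {S : riemann_surface R}.
Variables f N : S -> quat R.
Hypothesis hf : cmc_data f N.
Let g p := f p + N p.
Let sf := cmc_smooth hf.
Let sN := cmc_smoothN hf.
Implicit Types (X : tangent S) (p : S) (al : S -> quat R) (a b : R[i]).

Definition parallel_with a b al : Prop :=
  smooth al /\ forall X, sdif al X = - (sdif f X * darboux_beta N al a b (base X)).

Lemma cmc_parallelP mu al :
  cmc_parallel f N mu al <-> parallel_with (coef_a mu) (coef_b mu) al.
Proof.
split=> -[sal h]; split=> // X; have := h X; rewrite !sdifE /darboux_beta -scalerAr.
  by move=> /eqP; rewrite addr_eq0 => /eqP.
by move=> ->; rewrite addNr.
Qed.

Lemma darboux_beta_double al a b p : darboux_beta N al a b p + darboux_beta N al a b p =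
  N p * al p * (a - 1)%:H + al p * b%:H.
Proof. exact: qhalf_add. Qed.

Lemma smooth_darboux_beta al a b : smooth al -> smooth (darboux_beta N al a b).
Proof.
move=> sal; apply: smoothZ; apply: smoothD; apply: smoothM => //; try exact: smooth_cst.
exact: smoothM.
Qed.

Lemma coef_quat a b : a ^+ 2 + b ^+ 2 = 1 ->
  (a - 1)%:H * (a - 1)%:H + b%:H * b%:H = - ((a - 1)%:H + (a - 1)%:H) :> quat R.
Proof.
move=> ab; rewrite -!qCM -!qCD -qCN; congr qC.
have -> : b * b = 1 - a ^+ 2 by rewrite -ab addrC addKr expr2.
by ring.
Qed.

(** With dN = dg - df, the df terms cancel by [parallel_beta]. The remaining coefficient of dg is
    what identifies rho as (1 - a) / 2. *)
Lemma parallel_dbeta a b al X : a ^+ 2 + b ^+ 2 = 1 -> parallel_with a b al ->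
  sdif (darboux_beta N al a b) X = - (sdif g X * al (base X) * ((1 - a) / 2)%:H).
Proof.
move=> ab [sal dal].
have sNa : smooth (fun p => N p * al p) := smoothM sN sal.
have s1 : smooth (fun p => N p * al p * (a - 1)%:H) := smoothM sNa (smooth_cst _).
have s2 : smooth (fun p => al p * b%:H) := smoothM sal (smooth_cst _).
rewrite (sdif_scale _ X (smoothD s1 s2)) (sdif_add X s1 s2).
rewrite (sdif_mul X sNa (smooth_cst _)) (sdif_mul X sal (smooth_cst _)) !sdif_cst.
rewrite !mulr0 !add0r (sdif_mul X sN sal) (sdif_normal hf) dal -/g.
have B := parallel_beta (cmc_N2 hf (base X)) (qC_comm (a - 1) b) (coef_quat ab)
  (darboux_beta_double al a b (base X)).
have -> : ((1 - a) / 2)%:H = - (2^-1 *: (a - 1)%:H) :> quat R.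
  apply: qdouble_inj; rewrite -opprD qhalf_add -qCD -qCN; congr qC.
  by rewrite -splitr opprB.
rewrite [in RHS]mulrN [in RHS]opprK -[in RHS]scalerAr. congr (_ *: _).
move: (sdif g X) (sdif f X) (N (base X)) (al (base X)) (darboux_beta N al a b (base X))
  ((a - 1)%:H) (b%:H) B (cmc_anticomm hf X) => G F n x y c d B nF.
rewrite !(mulrN, mulNr, mulrBl, mulrDl) !mulrA nF !(mulrN, mulNr). rewrite !opprK.
have -> : F * x * c = F * n * y * c - F * y * d by rewrite -[F * x * c]mulrA -B mulrBr !mulrA.
by move: (F * n * y * c) (F * y * d) (G * x * c) => u v w; qabel.
Qed.

Lemma parallel_beta_neq0 a b al p : a ^+ 2 + b ^+ 2 = 1 -> a != 1 -> al p != 0 ->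
  darboux_beta N al a b p != 0.
Proof.
move=> ab a1 al0; apply/eqP => B0.
have := parallel_beta (cmc_N2 hf p) (qC_comm (a - 1) b) (coef_quat ab)
  (darboux_beta_double al a b p).
rewrite B0 mulr0 !mul0r subrr => /esym /qmul_eq0 /(_ al0) /eqP.
by rewrite qC_eq0 subr_eq0 (negbTE a1).
Qed.

(** In a chart the parallel equation bounds the derivative by a local constant times [|al|], so a
    single zero would spread over the whole connected surface. *)
Lemma parallel_neq0 a b al : parallel_with a b al -> (exists p, al p != 0) -> forall p, al p != 0.
Proof.
move=> [sal dal] [p0 al0] p; apply/eqP => alp; move/eqP: al0; apply.
apply: (linear_ode_dichotomy sal); last by exists p.
move=> q; have [phi A dq] := rs_atlas_cover q.
have oI : open (phi @` chart_dom phi) := @chart_img_open _ _ phi.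
have Iq := chart_img dq.
have [M1 M10 n1] := smooth_near_bounded Iq (smooth_dif dir1 (sf A)).
have [M2 M20 n2] := smooth_near_bounded Iq (smooth_dif dir2 (sf A)).
have [M3 M30 n3] := smooth_near_bounded Iq (sN A).
pose Q x := [/\ `|dif (f \o chart_inv phi) x dir1| <= M1,
  `|dif (f \o chart_inv phi) x dir2| <= M2 & `|(N \o chart_inv phi) x| <= M3].
have nQ : \forall x \near phi q, Q x.
  by apply: filterS3 n1 n2 n3 => x h1 h2 h3; split.
pose c : quat R := (a - 1)%:H; pose d : quat R := b%:H.
(* Each quaternion product costs a factor 4 by [qnorm_mul]: one for df times beta, two for [N al c],
   one for [al d]. *)
exists phi, (Q^°)%classic, (4 * (M1 + M2) * (2^-1 * (16 * M3 * `|c| + 4 * `|d|))).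
split=> //; first exact: open_interior.
move=> x v /interior_subset [h1 h2 h3] Ix.
have [r dr xr] := Ix; move: h1 h2 h3; rewrite -xr => h1 h2 h3.
have := dal (Tangent v A dr); rewrite !sdif_dif /= => ->.
rewrite normrN chart_mapK //; move: h3; rewrite /= chart_mapK // => h3.
set Fv := dif _ _ v; set be := darboux_beta _ _ _ _ _.
have hF : `|Fv| <= `|v| * (M1 + M2).
  rewrite /Fv plane_dirs; apply: le_trans (ler_normD _ _) _; rewrite !normrZ mulrDr.
  by apply: lerD; apply: ler_pM => //; move: (v) => [v1 v2] /=; rewrite le_max lexx ?orbT.
have hB : `|be| <= 2^-1 * (16 * M3 * `|c| + 4 * `|d|) * `|al r|.
  rewrite /be /darboux_beta normrZ ger0_norm // -[leRHS]mulrA ler_wpM2l //.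
  apply: le_trans (ler_normD _ _) _; rewrite mulrDl; apply: lerD; last first.
    by apply: le_trans (qnorm_mul _ _) _; rewrite -/d mulrAC.
  apply: le_trans (qnorm_mul _ _) _; rewrite -/c.
  have h4 := qnorm_mul (N r) (al r).
  have : `|N r * al r| <= 4 * M3 * `|al r|.
    by apply: le_trans h4 _; rewrite ler_wpM2r // ler_wpM2l.
  move=> h5; rewrite -[leLHS]mulrA.
  have h6 : `|N r * al r| * `|c| <= 4 * M3 * `|al r| * `|c| by rewrite ler_wpM2r.
  rewrite (_ : 16 * M3 * `|c| * `|al r| = 4 * (4 * M3 * `|al r| * `|c|)); first by rewrite ler_wpM2l.
  by move: (`|c|) (`|al r|) => x1 x2; ring.
have h7 : `|Fv| * `|be| <= `|v| * (M1 + M2) * (2^-1 * (16 * M3 * `|c| + 4 * `|d|) * `|al r|).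
  by apply: ler_pM.
apply: le_trans (qnorm_mul _ _) _; rewrite -[leLHS]mulrA.
apply: le_trans (ler_wpM2l _ h7) _ => //; rewrite le_eqVlt; apply/orP; left; apply/eqP.
by move: (`|c|) (`|d|) (`|v|) (`|al r|) => x1 x2 x3 x4; ring.
Qed.

End Parallel.

(** * The criterion as a polynomial equation, and the transforms of parallel sections *)

Section CriterionPolynomial.
Context {R : realType}.
Variables n s p C D : quat R.
Hypotheses (nn : n * n = -1) (sE : s + s = n * C + D) (pC : p * C = - (1 + 1)).

Let E := D * D + n * (C * D - D * C) + (C + C) + C * C.

(** Doubling replaces [s] by [n C + D], and right multiplication by [C] replaces [p] by -2. In the
    applications [C] is a - 1 conjugated by [al], and [pC] expresses a - 1 = - 2 rho. *)
Let polynomial_defect : (s * n + n * s + s * s * p - 1 + (s * n + n * s + s * s * p - 1)) * C = - E.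
Proof.
have e1 : s * s * p * C + s * s * p * C = - ((s + s) * (s + s)).
  rewrite -mulrA pC mulrN mulrDr mulr1 -opprD mulrDl.
  by rewrite !mulrDr.
have -> : (s * n + n * s + s * s * p - 1 + (s * n + n * s + s * s * p - 1)) * C =
    ((s + s) * n + n * (s + s)) * C + (s * s * p * C + s * s * p * C) - (C + C).
  rewrite !mulrDl !mulrDr !mulrDl mulNr mul1r.
  by move: (s * n * C) (n * s * C) (s * s * p * C) => x y z; qabel.
rewrite e1 sE /E !(mulrBr, mulrDl, mulrDr) !mulrA nn !mulN1r !mulNr.
move: (n * C * n * C) (D * n * C) (C * C) (n * D * C) (n * C * D) (D * D) => x y z u v w.
by qabel.
Qed.

Lemma criterion_polynomial : C != 0 -> (s * n + n * s + s * s * p = 1 <-> E = 0).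
Proof.
move=> C0; split=> [S|E0].
  by apply: oppr_inj; rewrite -polynomial_defect S subrr addr0 mul0r oppr0.
apply/eqP; rewrite -subr_eq0; apply/eqP; apply: qadd_self_eq0; apply: qmulr_eq0 C0.
by rewrite polynomial_defect E0 oppr0.
Qed.

(** Multiplied on the left by [al^-1 df], this expression becomes the derivative of [al^-1 V] along
    a solution of the linear system. *)
Lemma criterion_section (al be c V : quat R) : E = 0 -> V = D * al -> C * al = al * c ->
  be + be = n * al * c + V -> (al - n * be) * c + s * V = 0.
Proof.
move=> E0 VE Cal beE; apply: qadd_self_eq0.
have -> : (al - n * be) * c + s * V + ((al - n * be) * c + s * V) =
    (al * c + al * c) - n * (be + be) * c + (s + s) * V.
  rewrite !(mulrBl, mulrDl, mulrDr).
  by move: (al * c) (n * be * c) (s * V) => x y z; qabel.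
rewrite beE sE mulrDr !mulrA nn mulN1r mulNr.
have -> : (n * C + D) * V = E * al - (C + C) * al - C * C * al + n * D * C * al.
  rewrite /E VE !(mulrBr, mulrDr, mulrBl, mulrDl) !mulrA.
  move: (n * C * D * al) (D * D * al) (n * D * C * al) (C * al) (C * C * al) => x y z u v.
  by qabel.
rewrite E0 mul0r -!mulrA Cal !mulrDl Cal VE [C * (al * c)]mulrA Cal !mulrA mulNr.
by move: (al * c) (al * c * c) (n * D * al * c) => x y z; qabel.
Qed.

End CriterionPolynomial.

Section MuToRho.
Context {R : realType} {S : riemann_surface R}.
Variables f N : S -> quat R.
Hypothesis hf : cmc_data f N.
Variables (a b : R[i]) (al : S -> quat R).
Hypotheses (ab : a ^+ 2 + b ^+ 2 = 1) (a1 : a != 1).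
Hypotheses (par : parallel_with f N a b al) (al0 : exists p, al p != 0).
Let g p := f p + N p.
Let be := darboux_beta N al a b.
Let r : quat R := ((1 - a) / 2)%:H.
Implicit Types (X : tangent S) (p : S).

Let nz p : al p != 0 /\ be p != 0.
Proof.
have h := parallel_neq0 hf par al0 p.
by split=> //; exact: (parallel_beta_neq0 hf ab a1 h).
Qed.

Let r0 : r != 0.
Proof.
by rewrite qC_eq0 mulf_neq0 ?invr_eq0 ?pnatr_eq0 // subr_eq0 eq_sym.
Qed.

Lemma mu_pair : darboux_pair f N (fun p => be p * (al p)^-1) (fun p => al p * r^-1 * (al p)^-1).
Proof.
apply: rho_pair => //; first by case: par.
- by apply: (smooth_darboux_beta hf); case: par.
- by case: par.
- by move=> X; exact: (parallel_dbeta hf _ ab par).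
Qed.

(** For a parallel section [D] is b conjugated by [al] and commutes with [C]. The polynomial is then
    the conjugate of (a - 1)^2 + b^2 + 2 (a - 1), which is 0 because a^2 + b^2 = 1. *)
Lemma mu_criterion : cmc_criterion N (fun p => be p * (al p)^-1) (fun p => al p * r^-1 * (al p)^-1).
Proof.
move=> p; rewrite /pair_square; have [x0 _] := nz p.
have e1 : al p * (al p)^-1 = 1 by rewrite mulrV.
have e2 : (al p)^-1 * al p = 1 by rewrite mulVr.
have rr : r^-1 * r = 1 by rewrite mulVr.
have cr : (a - 1)%:H = - (r + r).
  rewrite /r -qCD -qCN; congr qC.
  by rewrite -splitr opprB.
have beE := darboux_beta_double N al a b p; rewrite -/be in beE.
have cd := qC_comm (a - 1) b; have cE := coef_quat ab.
have c0 : (a - 1)%:H != 0 :> quat R by rewrite qC_eq0 subr_eq0.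
move: (al p) (be p) ((al p)^-1) r ((a - 1)%:H) (b%:H) e1 e2 rr cr beE cd cE x0 c0.
move=> x y e q c d e1 e2 rr cr beE cd cE x0 c0.
apply: (@criterion_polynomial _ _ _ _ (x * c * e) (x * d * e) (cmc_N2 hf p) _ _ _).2.
- by rewrite -mulrDl beE mulrDl !mulrA.
- rewrite !mulrA -[x / q * e * x]mulrA e2 mulr1 cr mulrN mulrDr -[x / q * q]mulrA rr mulr1.
  by rewrite mulNr mulrDl e1.
- rewrite !qmul_neq0 //; apply/eqP => e0; have /eqP := e1.
  by rewrite e0 mulr0 eq_sym oner_eq0.
have m u v : x * u * e * (x * v * e) = x * (u * v) * e.
  by rewrite !mulrA -[x * u * e * x]mulrA e2 mulr1.
rewrite !m cd subrr mulr0 addr0 -mulrDl -mulrDr -addrA -mulrDl -mulrDr -mulrDl -mulrDr.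
by rewrite [c + c + _]addrC addrA [d * d + _]addrC cE addNr mulr0 mul0r.
Qed.

Lemma mu_rho_darboux : rho_darboux f g ((1 - a) / 2) (fun p => f p + al p * (be p)^-1).
Proof.
exists al, be; split=> //.
- by split; [case: par|apply: (smooth_darboux_beta hf); case: par].
- by move=> X; rewrite -!sdifE; case: par.
- by move=> X; rewrite -!sdifE; exact: (parallel_dbeta hf _ ab par).
Qed.

Lemma mu_cmc : cmc_in_3space_after_translation (fun p => f p + al p * (be p)^-1).
Proof.
have [c hc] := criterion_cmc hf mu_pair mu_criterion.
exists c, (darboux_normal N (fun p => be p * (al p)^-1)); apply/cmc_surfaceP.
have -> : (fun p => f p + al p * (be p)^-1 + c) =
    fun p => darboux_surface f (fun p => be p * (al p)^-1) p + c.
  by apply/funext => p; have [x0 y0] := nz p; congr (_ + _); exact: rho_transform.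
exact: hc.
Qed.

End MuToRho.

(** * The spectral parameter and its coefficients *)

Section Coefficients.
Context {R : realType}.
Implicit Types (a b mu rho : R[i]).

(** With mu = a + i b this is the formula mu^-1 = a - i b, through which [coef_a] and [coef_b] give
    back a and b. *)
Lemma spectral_mul a b : a ^+ 2 + b ^+ 2 = 1 -> (a - 'i%C * b) * (a + 'i%C * b) = 1.
Proof. by move=> ab; rewrite -subr_sqr exprMn sqr_i mulN1r opprK. Qed.

Lemma spectral_neq0 a b : a ^+ 2 + b ^+ 2 = 1 -> a + 'i%C * b != 0.
Proof.
move=> /spectral_mul E; apply/eqP => h.
by have /eqP := E; rewrite h mulr0 eq_sym oner_eq0.
Qed.

Lemma spectral_inv a b : a ^+ 2 + b ^+ 2 = 1 -> (a + 'i%C * b)^-1 = a - 'i%C * b.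
Proof.
move=> ab; have n0 := spectral_neq0 ab.
by apply: (mulIf n0); rewrite mulVf // spectral_mul.
Qed.

Lemma coef_a_spectral a b : a ^+ 2 + b ^+ 2 = 1 -> coef_a (a + 'i%C * b) = a.
Proof.
move=> ab; rewrite /coef_a spectral_inv // addrACA subrr addr0.
by rewrite mulrDl -splitr.
Qed.

Lemma coef_b_spectral a b : a ^+ 2 + b ^+ 2 = 1 -> coef_b (a + 'i%C * b) = b.
Proof.
move=> ab; rewrite /coef_b spectral_inv //.
have -> : a - 'i%C * b - (a + 'i%C * b) = 2 * - ('i%C * b) by ring.
by rewrite mulrAC mulfV ?pnatr_eq0 // mul1r mulrN mulrA -expr2 sqr_i mulN1r opprK.
Qed.

Lemma coef_sqr mu : mu != 0 -> coef_a mu ^+ 2 + coef_b mu ^+ 2 = 1.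
Proof.
move=> mu0; rewrite /coef_a /coef_b [('i%C * _) ^+ 2]exprMn sqr_i.
by field.
Qed.

Lemma coef_a_eq1 mu : mu != 0 -> coef_a mu = 1 -> mu = 1.
Proof.
move=> mu0 h; apply/eqP; rewrite -subr_eq0 -sqrf_eq0.
have -> : (mu - 1) ^+ 2 = 2 * mu * (coef_a mu - 1) by rewrite /coef_a; field.
by rewrite h subrr mulr0.
Qed.

Lemma coef_a_eqN1 mu : mu != 0 -> coef_a mu = -1 -> mu = -1.
Proof.
move=> mu0 h; apply/eqP; rewrite -subr_eq0 -sqrf_eq0.
have -> : (mu - -1) ^+ 2 = 2 * mu * (coef_a mu + 1) by rewrite /coef_a; field.
by rewrite h addNr mulr0.
Qed.

End Coefficients.

(** * From solutions of the linear system to parallel sections *)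

Section RhoSection.
Context {R : realType} {S : riemann_surface R}.
Variables f N : S -> quat R.
Hypothesis hf : cmc_data f N.
Let g p := f p + N p.
Let sf := cmc_smooth hf.
Let sN := cmc_smoothN hf.
Implicit Types (X : tangent S) (p : S).
Variables (rho : R[i]) (al be : S -> quat R).
Hypotheses (rho0 : rho != 0) (rho1 : rho != 1) (sal : smooth al) (sbe : smooth be).
Hypothesis dal : forall X, sdif al X = - (sdif f X * be (base X)).
Hypothesis dbe : forall X, sdif be X = - (sdif g X * al (base X) * rho%:H).
Hypothesis nz : forall p, al p != 0 /\ be p != 0.
Let a := 1 - 2 * rho.
Let c : quat R := (a - 1)%:H.

Let cE : c = - (rho%:H + rho%:H).
Proof. by rewrite /c -qCD -qCN; congr qC; rewrite /a; ring. Qed.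

(** Equals [al] times b when [al] is itself parallel with [be] its [darboux_beta]. *)
Definition complementary p := be p + be p - N p * al p * c.

Let V := complementary.
Let sNa : smooth (fun p => N p * al p) := smoothM sN sal.
Let sNac : smooth (fun p => N p * al p * c) := smoothM sNa (smooth_cst c).

Lemma smooth_complementary : smooth V.
Proof. by apply: smoothD; [exact: smoothD|exact: smoothN]. Qed.

(** The dg terms coming from [be] and from dN cancel because [c] is - 2 rho, which leaves a multiple
    of df. *)
Lemma sdif_complementary X :
  sdif V X = sdif f X * ((al (base X) - N (base X) * be (base X)) * c).
Proof.
rewrite (sdif_add X (smoothD sbe sbe) (smoothN sNac)) (sdif_opp X sNac) (sdif_add X sbe sbe).
rewrite (sdif_mul X sNa (smooth_cst c)) sdif_cst (sdif_mul X sN sal) (sdif_normal hf) -/g dal dbe.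
have cr := cE; have nF := cmc_anticomm hf X.
move: (base X) (sdif f X) (sdif g X) nF => p F G nF.
move: (al p) (be p) (N p) c (rho%:H) cr nF => x y n d r cr nF.
rewrite mulr0 add0r -opprD -mulrDr.
have -> : G * x * (r + r) = - (G * x * d) by rewrite cr mulrN opprK.
rewrite opprK !(mulrBr, mulrBl, mulrDl) !(mulrN, mulNr) !mulrA nF !mulNr opprK.
by move: (G * x * d) (F * n * y * d) (F * x * d) => u v w; qabel.
Qed.

Definition half_section (d : R[i]) p := 2^-1 *: (al p + V p * (d%:H)^-1).

Lemma half_section_algebra (n x y v d k h : quat R) : n * n = -1 -> c * d = d * c -> d * k = 1 -> k * d = 1 ->
  c * c + d * d = - (c + c) -> v = y + y - n * x * c -> h + h = x + v * k ->
  n * h * c + h * d = y - (x - n * y) * c * k.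
Proof.
move=> nn cd dk kd cdE vE hE; apply: qdouble_inj.
have ck : c * k = k * c.
  by rewrite -[LHS]mul1r -kd -!mulrA [d * (c * k)]mulrA -cd -[c * d * k]mulrA dk mulr1.
have -> : n * h * c + h * d + (n * h * c + h * d) = n * (h + h) * c + (h + h) * d.
  by rewrite mulrDr !mulrDl addrACA.
rewrite hE mulrDr !mulrDl -[v * k * d]mulrA kd mulr1.
have -> : n * (v * k) * c = n * v * (c * k) by rewrite ck !mulrA.
have -> : x * d = - (x * (c * k)) - x * (c * k) - x * (c * c * k).
  have E : (c * c + d * d) * k = - (c + c) * k by rewrite cdE.
  rewrite mulrDl -[d * d * k]mulrA dk mulr1 mulNr mulrDl in E.
  have -> : d = - (c * k + c * k) - c * c * k by rewrite -E addrAC subrr add0r.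
  by rewrite mulrBr mulrN mulrDr opprD.
rewrite vE !(mulrBr, mulrBl, mulrDl, mulrDr) !mulrA nn !mulN1r !mulNr.
move: (n * x * c) (n * y * c * k) (x * c * c * k) (x * c * k) => u1 u2 u3 u4.
by qabel.
Qed.

Let k (b : R[i]) : quat R := (b%:H)^-1.

(** The right side is minus the coefficient of df in the derivative of [half_section], which makes
    the half parallel. Its second term changes sign with b, so the two halves add up to [be]. *)
Lemma half_section_beta b p : a ^+ 2 + b ^+ 2 = 1 -> b != 0 ->
  darboux_beta N (half_section b) a b p =
  2^-1 *: (be p - (al p - N p * be p) * c * k b).
Proof.
move=> ab b0; have d0 : b%:H != 0 :> quat R by rewrite qC_eq0.
have dk : b%:H * k b = 1 by rewrite mulrV.
have kd : k b * b%:H = 1 by rewrite mulVr.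
congr (_ *: _); apply: (half_section_algebra (cmc_N2 hf p) (qC_comm (a - 1) b) dk kd (coef_quat ab) erefl).
exact: qhalf_add.
Qed.

Lemma half_section_parallel b : a ^+ 2 + b ^+ 2 = 1 -> b != 0 ->
  parallel_with f N a b (half_section b).
Proof.
move=> ab b0; have sV := smooth_complementary.
have sVk : smooth (fun p => V p * k b) := smoothM sV (smooth_cst (k b)).
split; first by apply: smoothZ; exact: smoothD.
move=> X; rewrite half_section_beta // (sdif_scale _ X (smoothD sal sVk)) (sdif_add X sal sVk).
rewrite (sdif_mul X sV (smooth_cst (k b))) sdif_cst mulr0 add0r sdif_complementary dal.
rewrite -[in RHS]scalerAr -[in RHS]scalerN; congr (_ *: _).
by rewrite mulrBr opprB addrC !mulrA.
Qed.

Lemma half_section_sum b p : half_section b p + half_section (- b) p = al p.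
Proof.
rewrite /half_section qCN invrN mulrN -scalerDr addrACA subrr addr0.
by rewrite scalerDr qhalf_add.
Qed.

Lemma half_section_beta_sum b p : a ^+ 2 + b ^+ 2 = 1 -> b != 0 ->
  darboux_beta N (half_section b) a b p + darboux_beta N (half_section (- b)) a (- b) p = be p.
Proof.
move=> ab b0; rewrite !half_section_beta ?sqrrN ?oppr_eq0 //.
rewrite /k qCN invrN mulrN opprK -scalerDr addrACA addNr addr0.
by rewrite scalerDr qhalf_add.
Qed.

Lemma rho_splitting (sq : R[i]) (fh : S -> quat R) : sq ^+ 2 = rho * (1 - rho) ->
  (forall p, fh p = f p + al p * (be p)^-1) ->
  let b := 2 * sq in
  exists alp alm : S -> quat R,
    let bep := darboux_beta N alp a b in
    let bem := darboux_beta N alm a (- b) in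
    [/\ cmc_parallel f N (a + 'i%C * b) alp,
        cmc_parallel f N (a - 'i%C * b) alm,
        (forall p, bep p + bem p != 0) &
        (forall p, fh p = f p + (alp p + alm p) * (bep p + bem p)^-1)].
Proof.
move=> sqE fE b.
have ab : a ^+ 2 + b ^+ 2 = 1 by rewrite /a /b exprMn sqE; ring.
have b0 : b != 0.
  rewrite /b mulf_neq0 ?pnatr_eq0 // -sqrf_eq0 sqE mulf_neq0 //.
  by rewrite subr_eq0 eq_sym.
have abN : a ^+ 2 + (- b) ^+ 2 = 1 by rewrite sqrrN.
exists (half_section b), (half_section (- b)); split.
- apply/cmc_parallelP; rewrite coef_a_spectral // coef_b_spectral //.
  exact: half_section_parallel.
- rewrite -mulrN; apply/cmc_parallelP; rewrite coef_a_spectral // coef_b_spectral //.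
  by apply: half_section_parallel => //; rewrite oppr_eq0.
- by move=> p; rewrite half_section_beta_sum //; case: (nz p).
- by move=> p; rewrite half_section_beta_sum // half_section_sum.
Qed.

Let s p := be p * (al p)^-1.
Let P p := al p * (rho%:H)^-1 * (al p)^-1.

Lemma rho_darboux_pair : darboux_pair f N s P.
Proof. by apply: rho_pair => //; rewrite qC_eq0. Qed.

Hypothesis star : cmc_criterion N s P.

Let a0 p : al p != 0. Proof. by case: (nz p). Qed.
Let ae p : al p * (al p)^-1 = 1. Proof. by rewrite mulrV //; exact: a0. Qed.
Let ea p : (al p)^-1 * al p = 1. Proof. by rewrite mulVr //; exact: a0. Qed.
Let rr : (rho%:H)^-1 * rho%:H = 1 :> quat R.
Proof. by rewrite mulVr // -[_ \is a _]/(_ != 0) qC_eq0. Qed.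
Let c0 : c != 0.
Proof.
rewrite qC_eq0 subr_eq0 /a -subr_eq0 addrAC subrr add0r oppr_eq0.
by rewrite mulf_neq0 ?pnatr_eq0.
Qed.
Let VE p : be p + be p = N p * al p * c + V p. Proof. by rewrite /V /complementary [RHS]addrC subrK. Qed.

Let C p := al p * c * (al p)^-1.
Let W p := V p * (al p)^-1.

Let sW p : s p + s p = N p * C p + W p.
Proof. by rewrite /s -mulrDl VE mulrDl !mulrA. Qed.

Let PC p : P p * C p = - (1 + 1).
Proof.
rewrite /P /C; move: (al p) ((al p)^-1) (ae p) (ea p) c cE rr => x e xe ex d dE.
move: (rho%:H) ((rho%:H)^-1) dE => r q dE qr.
rewrite !mulrA -[x * q * e * x]mulrA ex mulr1 dE mulrN mulrDr -[x * q * r]mulrA qr mulr1.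
by rewrite mulNr mulrDl xe.
Qed.

Let C0 p : C p != 0.
Proof. by rewrite !qmul_neq0 // ?invr_eq0; exact: a0. Qed.

Let criterion_poly p : W p * W p + N p * (C p * W p - W p * C p) + (C p + C p) + C p * C p = 0.
Proof. exact: (criterion_polynomial (cmc_N2 hf p) (sW p) (PC p) (C0 p)).1 (star p). Qed.

Let WV p : V p = W p * al p. Proof. by rewrite /W -mulrA ea mulr1. Qed.
Let Ca p : C p * al p = al p * c. Proof. by rewrite /C -mulrA ea mulr1. Qed.

Let sV : smooth (fun p => (al p)^-1) := smoothV sal a0.

Definition monodromy p := (al p)^-1 * V p.

(** The derivative is [al^-1 df] times the expression that [criterion_section] shows to be 0; this
    is where the criterion is used. *)
Lemma monodromy_constant p q : monodromy p = monodromy q.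
Proof.
have sm : smooth monodromy := smoothM sV smooth_complementary.
apply: (D0_constant sm) => X; set b := base X.
rewrite (sdif_mul X sV smooth_complementary) sdif_complementary (sdif_inv X sal a0) dal.
have E := criterion_section (cmc_N2 hf b) (sW b) (criterion_poly b) (WV b) (Ca b) (VE b).
have -> : (al b)^-1 * (sdif f X * ((al b - N b * be b) * c)) +
    - ((al b)^-1 * - (sdif f X * be b) * (al b)^-1) * V b =
    (al b)^-1 * sdif f X * ((al b - N b * be b) * c + s b * V b).
  by rewrite /s !(mulrN, mulNr) opprK [RHS]mulrDr !mulrA.
by rewrite E mulr0.
Qed.

Variable p0 : S.
Let s0 := monodromy p0.
Let Vs0 p : V p = al p * s0.
Proof. by rewrite /s0 (monodromy_constant p0 p) /monodromy mulrA ae mul1r. Qed.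

Let criterion_poly_al p : al p * (s0 * s0) + N p * (al p * (c * s0 - s0 * c)) + al p * (c + c) +
  al p * (c * c) = 0.
Proof.
have := congr1 (fun q => q * al p) (criterion_poly p); rewrite mul0r /C /W Vs0 => <-.
move: (al p) ((al p)^-1) (ea p) (N p) c s0 => x e ex n d t.
have m u v : x * u * e * (x * v * e) = x * (u * v) * e.
  by rewrite !mulrA -[x * u * e * x]mulrA ex mulr1.
by rewrite !m !(mulrBr, mulrBl, mulrDl, mulrDr) -!mulrA ex !mulr1.
Qed.

(* Otherwise [al^-1 N al] would be constant, which makes [dg] a left multiple of [df],
   which the rotations of the two differentials exclude. *)
Let monodromy_comm : c * s0 = s0 * c.
Proof.
apply/eqP; rewrite -subr_eq0; apply/negP => /negP w0; set w := _ - _ in w0.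
(* [criterion_poly_al] is linear in [N] with coefficient [al w]; solving it for [al^-1 N al] gives
   this constant. *)
pose n1 := - ((s0 * s0 + (c + c) + c * c) * w^-1).
have SP p : N p * (al p * w) = - (al p * (s0 * s0 + (c + c) + c * c)).
  apply/eqP; rewrite -addr_eq0 -[X in _ == X](criterion_poly_al p) -/w; apply/eqP.
  move: (s0 * s0) (c + c) (c * c) (N p * (al p * w)) => k1 k2 k3 y; rewrite !mulrDr.
  by move: (al p * k1) (al p * k2) (al p * k3) => *; qabel.
have Nal p : N p * al p = al p * n1.
  have wu : w \is a GRing.unit by [].
  have n1w : n1 * w = - (s0 * s0 + (c + c) + c * c) by rewrite mulNr mulrVK.
  by apply: (mulIr wu); rewrite -mulrA SP -[al p * n1 * w]mulrA n1w mulrN.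
have E X : sdif g X * al (base X) = sdif f X * (al (base X) - N (base X) * be (base X) - be (base X) * n1).
  have := congr1 (fun u => sdif u X) (funext Nal).
  rewrite (sdif_mul X sN sal) (sdif_mul X sal (smooth_cst n1)) sdif_cst (sdif_normal hf) -/g dal.
  have nF := cmc_anticomm hf X; move: (sdif f X) (sdif g X) nF => F G nF.
  move: (N (base X)) (al (base X)) (be (base X)) nF => n x y nF.
  rewrite mulr0 add0r mulrN mulrA nF mulNr opprK mulrBl mulNr.
  move=> e; rewrite !(mulrBr, mulrDr) !mulrA.
  have -> : G * x = (F * n * y + (G * x - F * x)) + F * x - F * n * y.
    by move: (G * x) (F * x) (F * n * y) => u v z; qabel.
  by rewrite e; move: (F * x) (F * n * y) (F * y * n1) => u v z; qabel.
have [q [X [_ X0 G0]] _] := punctured_exists (generic_tangent hf p0).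
have e1 := E X; have e2 := E (tangentJ X).
rewrite (sdif_dual_J hf X) (cmc_left hf X) -[base (tangentJ X)]/(base X) in e2.
move/eqP: G0; apply; apply: qmulr_eq0 (a0 (base X)).
apply: (@qmul_eq0 _ (N (base X)) (sdif g X * al (base X))); last exact: unit_im_neq0 (cmc_N2 hf (base X)).
apply: qopp_self_eq0; move: e2; rewrite -[N _ * sdif f X * _]mulrA -e1 => e2.
by rewrite -[in LHS]e2 mulNr mulrA.
Qed.

Lemma criterion_mu (fh : S -> quat R) : (forall p, fh p = f p + al p * (be p)^-1) ->
  exists mu : R[i], [/\ mu != 0, mu != 1, mu != -1 & mu_darboux f N mu fh].
Proof.
move=> fE.
have [b ab] : exists b, a ^+ 2 + b ^+ 2 = 1.
  by exists (sqrtc (1 - a ^+ 2)); rewrite sqr_sqrtc subrKC.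
pose d : quat R := b%:H.
(* Once [c] and [s0] commute the polynomial reduces to s0^2 + 2 c + c^2 = 0, and a^2 + b^2 = 1 is
   the same equation for [d]. *)
have s0sq : s0 * s0 = d * d.
  have := criterion_poly_al p0; rewrite monodromy_comm subrr !mulr0 addr0 -!mulrDr.
  move=> /qmul_eq0 /(_ (a0 p0)) => E.
  apply: (addIr (c + c + c * c)); rewrite addrA E -/d.
  by rewrite [c + c + _]addrC addrA [d * d + _]addrC (coef_quat ab) addNr.
(* Equal squares give [s0 (s0 + d) = (s0 + d) d], so [h = s0 + d] conjugates [s0] into [d]. If this
   sum vanishes, [s0 = - d] is already complex and the sign is absorbed in [b']. *)
have [h [b' [h0 ab' s0h ch]]] : exists h b', [/\ h != 0, a ^+ 2 + b' ^+ 2 = 1,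
    s0 * h = h * b'%:H & c * h = h * c].
  have [e|h0] := eqVneq (s0 + d) 0.
    exists 1, (- b); split; rewrite ?oner_neq0 ?sqrrN ?mulr1 ?mul1r //.
    by apply/eqP; rewrite qCN -addr_eq0 e.
  exists (s0 + d), b; split=> //; first by rewrite mulrDr mulrDl s0sq addrC.
  by rewrite mulrDr mulrDl monodromy_comm qC_comm.
have sal' : smooth (fun p => al p * h) := smoothM sal (smooth_cst h).
have beE p : darboux_beta N (fun p => al p * h) a b' p = be p * h.
  apply: qdouble_inj; rewrite darboux_beta_double -mulrDl VE mulrDl Vs0.
  by rewrite -[al p * s0 * h]mulrA s0h -[N p * al p * c * h]mulrA ch !mulrA.
have a1 : a != 1.
  by rewrite /a -subr_eq0 addrAC subrr add0r oppr_eq0 mulf_neq0 ?pnatr_eq0.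
have aN1 : a != -1.
  rewrite /a -subr_eq0 opprK (_ : 1 - 2 * rho + 1 = 2 * (1 - rho)); last by ring.
  by rewrite mulf_neq0 ?pnatr_eq0 // subr_eq0 eq_sym.
have aE := coef_a_spectral ab'; have bE := coef_b_spectral ab'.
exists (a + 'i%C * b'); split.
- exact: spectral_neq0.
- by apply: contraNneq a1 => e; rewrite -aE e /coef_a invr1 mulfV ?pnatr_eq0.
- by apply: contraNneq aN1 => e; rewrite -aE e /coef_a invrN invr1 -opprD mulNr mulfV ?pnatr_eq0.
exists (fun p => al p * h); split.
- apply/cmc_parallelP; rewrite aE bE; split=> // X.
  by rewrite beE (sdif_mul X sal (smooth_cst h)) sdif_cst mulr0 add0r dal mulNr mulrA.
- by exists p0; exact: qmul_neq0.
move=> p; rewrite aE bE beE fE; congr (_ + _).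
have [ua ub] := nz p; have hu : h \is a GRing.unit by [].
have bu : be p \is a GRing.unit by [].
by rewrite invrM // mulrA mulrK.
Qed.

End RhoSection.

Unset Implicit Arguments.
Theorem theorem4p13 (R : realType) (M Mt : riemann_surface R) (pr : Mt -> M)
    (hpr : universal_cover pr) (f N : M -> quat R) (hf : cmc_surface f N) :
  let ft : Mt -> quat R := fun p => f (pr p) in
  let Nt : Mt -> quat R := fun p => N (pr p) in
  let gt : Mt -> quat R := fun p => f (pr p) + N (pr p) in
  (forall (rho : R[i]) (fhat : Mt -> quat R), rho != 0 -> rho != 1 ->
     rho_darboux ft gt rho fhat ->
     forall sq : R[i], sq ^+ 2 = rho * (1 - rho) ->
     let a : R[i] := 1 - 2 * rho in
     let b : R[i] := 2 * sq in
     exists alphap alpham : Mt -> quat R,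
       let betap := darboux_beta Nt alphap a b in
       let betam := darboux_beta Nt alpham a (- b) in
       [/\ cmc_parallel ft Nt (a + 'i%C * b) alphap,
           cmc_parallel ft Nt (a - 'i%C * b) alpham,
           (forall p, betap p + betam p != 0) &
           (forall p, fhat p =
              ft p + (alphap p + alpham p) * (betap p + betam p)^-1)])
  /\
  (forall fhat : Mt -> quat R,
     (exists mu : R[i], [/\ mu != 0, mu != 1, mu != -1 &
        mu_darboux ft Nt mu fhat])
     <->
     ((exists rho : R[i], [/\ rho != 0, rho != 1 &
         rho_darboux ft gt rho fhat])
      /\ cmc_in_3space_after_translation fhat)).
Proof.
move=> ft Nt gt; have hft : cmc_data ft Nt := cmc_pullback hpr ((cmc_surfaceP f N).1 hf).
split=> [rho fh rho0 rho1 [al [be [[sal sbe] dal dbe nz fE]]] sq sqE a b|fh].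
  have dal' X : sdif al X = - (sdif ft X * be (base X)) by rewrite !sdifE.
  have dbe' X : sdif be X = - (sdif gt X * al (base X) * rho%:H) by rewrite !sdifE.
  exact: (rho_splitting hft rho0 rho1 sal sbe dal' dbe' nz sqE fE).
split=> [[mu [mu0 mu1 muN1 [al [/cmc_parallelP par al0 fE]]]]|[[rho [rho0 rho1]]]].
  have ab := coef_sqr mu0.
  have a1 : coef_a mu != 1 by apply: contraNneq mu1 => /(coef_a_eq1 mu0) ->.
  have aN1 : coef_a mu != -1 by apply: contraNneq muN1 => /(coef_a_eqN1 mu0) ->.
  have -> : fh = fun p => ft p + al p * (darboux_beta Nt al (coef_a mu) (coef_b mu) p)^-1.
    exact/funext.
  split; last exact: (mu_cmc hft ab a1 par al0).
  (* From a = 1 - 2 rho; the conditions a <> 1 and a <> -1 become rho <> 0 and rho <> 1. *)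
  exists ((1 - coef_a mu) / 2); split; last exact: (mu_rho_darboux hft ab a1 par al0).
    by rewrite mulf_neq0 ?invr_eq0 ?pnatr_eq0 // subr_eq0 eq_sym.
  apply: contraNneq aN1 => e; apply/eqP.
  have -> : coef_a mu = 1 - 2 * ((1 - coef_a mu) / 2) by field.
  by rewrite e; ring.
move=> [al [be [[sal sbe] dal dbe nz fE]]] [c [N' /cmc_surfaceP hc]].
have dal' X : sdif al X = - (sdif ft X * be (base X)) by rewrite !sdifE.
have dbe' X : sdif be X = - (sdif gt X * al (base X) * rho%:H) by rewrite !sdifE.
have hd := rho_darboux_pair rho0 sal sbe dal' dbe' nz.
have fhE : (fun p => fh p + c) = fun p => darboux_surface ft (fun p => be p * (al p)^-1) p + c.
  by apply/funext => p; have [a0 b0] := nz p; rewrite fE (rho_transform _ a0 b0).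
rewrite fhE in hc; have star := cmc_implies_criterion hft hd hc.
have [p0 _] := @rs_nonempty _ Mt.
exact: (criterion_mu hft rho0 rho1 sal sbe dal' dbe' nz star p0 fE).
Qed.
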